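(* Let $L_1,L_2$ be fibred-$\mathbb Z_2$-symmetric Lagrangian submanifold-germs of $(T^*\mathbb R^m,\omega)$ at $(0,0)$, determined by odd generating family-germs $F_1$ and $F_2$ respectively. Then the fibred-$\mathbb Z_2$-symmetric Lagrangian map-germs $\pi|_{L_1}:L_1\to\mathbb R^m$ and $\pi|_{L_2}:L_2\to\mathbb R^m$ are $\mathbb Z_2$-symmetrically Lagrangian equivalent if and only if $F_1$ and $F_2$ are fibred $\mathcal R^{odd}$-equivalent.
   Context: $T^*\mathbb R^m$ has coordinates $(\kappa,\lambda)$, $\pi(\kappa,\lambda)=\lambda$, $\omega=\sum_i d\kappa_i\wedge d\lambda_i$, and $\zeta(\kappa,\lambda)=(-\kappa,\lambda)$. All objects are smooth (or all real analytic). A Lagrangian submanifold-germ $L$ at $(0,0)$ is fibred-$\mathbb Z_2$-symmetric if $\zeta(L)=L$; then $\pi|_L$ is a fibred-$\mathbb Z_2$-symmetric Lagrangian map-germ. A symplectomorphism-germ $\Phi$ of $T^*\mathbb R^m$ is fibred if it maps fibres of $\pi$ to fibres, and odd if $\Phi\circ\zeta=\zeta\circ\Phi$. $\pi|_{L_1}$ and $\pi|_{L_2}$ are $\mathbb Z_2$-symmetrically Lagrangian equivalent if there is an odd fibred symplectomorphism-germ mapping $L_1$ to $L_2$. A function-germ $F:(\mathbb R^n\times\mathbb R^m,(0,0))\to\mathbb R$, $(\beta,\lambda)\mapsto F(\beta,\lambda)$, is a generating family of $L$ if $$L=\Big\{(\kappa,\lambda):\ \exists\,\beta,\ \tfrac{\partial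 F}{\partial\beta}(\beta,\lambda)=0,\ \kappa=\tfrac{\partial F}{\partial\lambda}(\beta,\lambda)\Big\},$$ where it is required that the Lagrangian section of $T^*\mathbb R^{n+m}$ generated by $F$ (the graph of $dF$) be transversal to $\{\alpha=0\}$, $\alpha$ being the momenta dual to $\beta$ (equivalently, the map $\frac{\partial F}{\partial\beta}$ has rank $n$ at $(0,0)$). $F$ is odd if $F(-\beta,\lambda)\equiv-F(\beta,\lambda)$. Odd generating family-germs $F,G:(\mathbb R^n\times\mathbb R^m,0)\to\mathbb R$ are fibred $\mathcal R^{odd}$-equivalent if $F=G\circ\Psi$ for some diffeomorphism-germ $\Psi$ of $(\mathbb R^n\times\mathbb R^m,0)$ of the form $\Psi(\beta,\lambda)=(\Phi(\beta,\lambda),\Lambda(\lambda))$ such that $\Phi(\cdot,\lambda)$ is, for every $\lambda$, an odd diffeomorphism-germ of $(\mathbb R^n,0)$, i.e. $\Phi(-\beta,\lambda)=-\Phi(\beta,\lambda)$. *)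

(* Defs.v *)
From mathcomp Require Import all_boot all_order all_algebra.
From mathcomp Require Import all_classical all_reals all_analysis.

Set Implicit Arguments.
Unset Strict Implicit.
Unset Printing Implicit Defensive.

Import Order.TTheory GRing.Theory Num.Theory.
Import numFieldNormedType.Exports.

Local Open Scope classical_set_scope.
Local Open Scope ring_scope.

(* Conventions.  R^N is 'rV[R]_N; R^n x R^m is 'rV[R]_(n + m), the pair       *)
(* (beta, lambda) being row_mx beta lambda; T^*R^m is 'rV[R]_(m + m), with    *)
(* (kappa, lambda) = row_mx kappa lambda.  A germ at 0 is given by a          *)
(* representative, i.e. by a total function or a set, and every condition on  *)
(* it is only imposed on some neighbourhood of 0.                             *)

Inductive category := Smooth | Analytic.

Section Regularity.
Variables (R : realType) (N : nat).
Implicit Types (U : set 'rV[R]_N) (f : 'rV[R]_N -> R).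

Definition partial (i : 'I_N) f : 'rV[R]_N -> R :=
  fun x => 'D_(delta_mx 0 i) f x.

Definition iter_partial (s : seq 'I_N) f : 'rV[R]_N -> R := foldr partial f s.

Definition smooth_on U f : Prop :=
  forall (s : seq 'I_N) (x : 'rV[R]_N), U x ->
    {for x, continuous (iter_partial s f)} /\
    forall i : 'I_N, derivable (iter_partial s f) x (delta_mx 0 i).

Definition monomial (a : 'I_N -> nat) (h : 'rV[R]_N) : R :=
  \prod_(i < N) h 0 i ^+ a i.

(* The multi-indices of the k-th partial sum are those in {0, ..., k-1}^N;    *)
(* as absolute convergence is demanded, the sum does not depend on this       *)
(* exhaustion of the set of all multi-indices.                                *)
Definition power_series_sum (c : ('I_N -> nat) -> R) (h : 'rV[R]_N) (l : R)
    : Prop :=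
  cvgn (fun k : nat => \sum_(a : {ffun 'I_N -> 'I_k})
          `|c (fun i => a i : nat) * monomial (fun i => a i : nat) h|) /\
  (fun k : nat => \sum_(a : {ffun 'I_N -> 'I_k})
          c (fun i => a i : nat) * monomial (fun i => a i : nat) h) @ \oo --> l.

Definition analytic_on U f : Prop :=
  forall x : 'rV[R]_N, U x ->
    exists (c : ('I_N -> nat) -> R) (r : R), 0 < r /\
      forall h : 'rV[R]_N, (forall i, `|h 0 i| < r) ->
        power_series_sum c h (f (x + h)).

Definition regular_germ (k : category) f : Prop :=
  exists U : set 'rV[R]_N, [/\ open U, U 0 &
    match k with Smooth => smooth_on U f | Analytic => analytic_on U f end].

End Regularity.

Definition regular_map_germ (R : realType) (k : category) (N M : nat)
    (f : 'rV[R]_N -> 'rV[R]_M) : Prop :=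
  forall j : 'I_M, regular_germ k (fun x => f x 0 j).

(* The source (R^N, 0) and the target (R^M, 0) are allowed to be written with *)
(* different dimensions; the existence of such a germ forces N = M.           *)
Definition diffeo_germ (R : realType) (k : category) (N M : nat)
    (f : 'rV[R]_N -> 'rV[R]_M) : Prop :=
  [/\ f 0 = 0, regular_map_germ k f &
    exists g : 'rV[R]_M -> 'rV[R]_N,
      [/\ g 0 = 0, regular_map_germ k g,
          \forall x \near (0 : 'rV[R]_N), g (f x) = x &
          \forall y \near (0 : 'rV[R]_M), f (g y) = y]].

Definition set_germ_eq (R : realType) (N : nat) (A B : set 'rV[R]_N) : Prop :=
  \forall x \near (0 : 'rV[R]_N), A x <-> B x.

(* (beta, lambda) |-> (- beta, lambda); for n = m this is the involution zeta *)
(* of T^*R^m.                                                                 *)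
Definition zeta (R : realType) (n m : nat) (x : 'rV[R]_(n + m))
    : 'rV[R]_(n + m) :=
  row_mx (- lsubmx x) (rsubmx x).

Section Cotangent.
Variables (R : realType) (m : nat).
Implicit Types (L : set 'rV[R]_(m + m)) (Phi : 'rV[R]_(m + m) -> 'rV[R]_(m + m)).

Definition cot_proj (x : 'rV[R]_(m + m)) : 'rV[R]_m := rsubmx x.

(* omega = \sum_i d kappa_i /\ d lambda_i *)
Definition omega (u v : 'rV[R]_(m + m)) : R :=
  \sum_(i < m) (u 0 (lshift m i) * v 0 (rshift m i)
              - v 0 (lshift m i) * u 0 (rshift m i)).

(* phi straightens L to {y | rsubmx y = 0}, so L is an m-dimensional          *)
(* submanifold-germ through 0 whose tangent space at x is the kernel of       *)
(* u |-> rsubmx ('d phi x u).                                                 *)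
Definition lagrangian_germ (k : category) L : Prop :=
  exists phi : 'rV[R]_(m + m) -> 'rV[R]_(m + m),
    [/\ diffeo_germ k phi,
        \forall x \near (0 : 'rV[R]_(m + m)), L x <-> rsubmx (phi x) = 0 &
        \forall x \near (0 : 'rV[R]_(m + m)), L x ->
          forall u v : 'rV[R]_(m + m),
            rsubmx ('d phi x u) = 0 -> rsubmx ('d phi x v) = 0 ->
            omega u v = 0].

Definition fibred_Z2_symmetric_lagrangian (k : category) L : Prop :=
  lagrangian_germ k L /\ set_germ_eq [set zeta x | x in L] L.

Definition symplectomorphism_germ (k : category) Phi : Prop :=
  diffeo_germ k Phi /\
  \forall x \near (0 : 'rV[R]_(m + m)), forall u v : 'rV[R]_(m + m),
    omega ('d Phi x u) ('d Phi x v) = omega u v.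

Definition fibred_germ Phi : Prop :=
  exists U : set 'rV[R]_(m + m), nbhs (0 : 'rV[R]_(m + m)) U /\
    forall x y, U x -> U y ->
      cot_proj x = cot_proj y -> cot_proj (Phi x) = cot_proj (Phi y).

Definition odd_germ Phi : Prop :=
  \forall x \near (0 : 'rV[R]_(m + m)), Phi (zeta x) = zeta (Phi x).

(* For a germ of diffeomorphism Phi, the image germ of L1 is L2 iff           *)
(* L1 = Phi^-1(L2) near 0; the preimage, unlike Phi @` L1, only depends on    *)
(* the germs.                                                                 *)
Definition Z2_lagrangian_equiv (k : category) (L1 L2 : set 'rV[R]_(m + m))
    : Prop :=
  exists Phi : 'rV[R]_(m + m) -> 'rV[R]_(m + m),
    [/\ symplectomorphism_germ k Phi, fibred_germ Phi, odd_germ Phi &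
        set_germ_eq L1 (Phi @^-1` L2)].

End Cotangent.

Section GeneratingFamilies.
Variables (R : realType) (m : nat).

Definition dF_beta (n : nat) (F : 'rV[R]_(n + m) -> R) (x : 'rV[R]_(n + m))
    : 'rV[R]_n :=
  \row_(i < n) partial (lshift m i) F x.

Definition dF_lambda (n : nat) (F : 'rV[R]_(n + m) -> R) (x : 'rV[R]_(n + m))
    : 'rV[R]_m :=
  \row_(j < m) partial (rshift n j) F x.

Definition generated_set (n : nat) (F : 'rV[R]_(n + m) -> R)
    (W : set 'rV[R]_(n + m)) : set 'rV[R]_(m + m) :=
  [set x | exists beta : 'rV[R]_n,
     let p := row_mx beta (cot_proj x) in
     [/\ W p, dF_beta F p = 0 & lsubmx x = dF_lambda F p]].

(* F being a germ at (0, 0), beta ranges over a neighbourhood of 0; the germ  *)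
(* of the generated set is the same for all small enough neighbourhoods W     *)
(* of (0, 0), and L is required to be that germ.                              *)
Definition generating_family (k : category) (n : nat)
    (F : 'rV[R]_(n + m) -> R) (L : set 'rV[R]_(m + m)) : Prop :=
  [/\ regular_germ k F,
      \rank (jacobian (dF_beta F) 0) = n &
      exists W0 : set 'rV[R]_(n + m), nbhs (0 : 'rV[R]_(n + m)) W0 /\
        forall W : set 'rV[R]_(n + m), nbhs (0 : 'rV[R]_(n + m)) W -> W `<=` W0 ->
          set_germ_eq L (generated_set F W)].

Definition odd_family (n : nat) (F : 'rV[R]_(n + m) -> R) : Prop :=
  \forall x \near (0 : 'rV[R]_(n + m)), F (zeta x) = - F x.

(* F and G may have parameter spaces R^n1 and R^n2 written with different     *)
(* dimensions; equivalence forces n1 = n2, and then this is the equivalence   *)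
(* of families with the same parameter space.                                 *)
Definition fibred_Rodd_equiv (k : category) (n1 n2 : nat)
    (F : 'rV[R]_(n1 + m) -> R) (G : 'rV[R]_(n2 + m) -> R) : Prop :=
  exists (Phi : 'rV[R]_n1 -> 'rV[R]_m -> 'rV[R]_n2)
         (Lambda : 'rV[R]_m -> 'rV[R]_m),
    let Psi (x : 'rV[R]_(n1 + m)) : 'rV[R]_(n2 + m) :=
      row_mx (Phi (lsubmx x) (rsubmx x)) (Lambda (rsubmx x)) in
    [/\ diffeo_germ k Psi,
        \forall lambda \near (0 : 'rV[R]_m),
          diffeo_germ k (fun beta => Phi beta lambda),
        \forall x \near (0 : 'rV[R]_(n1 + m)),
          Phi (- lsubmx x) (rsubmx x) = - Phi (lsubmx x) (rsubmx x) &
        \forall x \near (0 : 'rV[R]_(n1 + m)), F x = G (Psi x)].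

End GeneratingFamilies.

(* Main.v *)
Require Import Defs.
From HB Require Import structures.
From mathcomp Require Import all_boot all_order all_algebra.
From mathcomp Require Import all_classical all_reals all_analysis.
From mathcomp Require Import perm ring lra.

Set Implicit Arguments.
Unset Strict Implicit.
Unset Printing Implicit Defensive.

Import Order.TTheory GRing.Theory Num.Theory.
Import numFieldNormedType.Exports.

Local Open Scope classical_set_scope.
Local Open Scope ring_scope.

(** Write [beta] for the parameters and [lambda] for the base variables of a
    family [F], and call a point critical when [dF_beta F] vanishes there.

    An odd fibred symplectomorphism is the cotangent lift of its base map
    (lemma [symplectic_is_lift]): it preserves the zero section by oddness, and
    the symplectic identity tested on a fibre and a base direction says that
    its fibre component, multiplied by the transposed Jacobian of the base map,
    has the fibre identity as derivative along the fibres.  Conversely every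
    cotangent lift is an odd fibred symplectomorphism ([lift_symplectic]).  So
    the lagrangian equivalences are the changes [lambda -> Lambda lambda] of
    the base, and these act on generating families by substitution
    ([generates_lift]).  This gives the implication from families to germs at
    once, since a fibred equivalence of families is a substitution followed by
    a change of [beta], and a change of [beta] does not move the generated set.

    In the other direction a base change reduces the problem to two odd
    families [F] and [G] that generate the same germ, and one needs an odd
    change of [beta] over the identity of the base that takes [G] to [F]
    ([odd_families_equivalent]).  As [F] is odd, [dF_beta F] is even in [beta]
    and its Jacobian at [0] is the mixed block [A] of second derivatives, which
    has rank [n].  Hence [dF_lambda F], an odd function of [beta] with
    derivative [A^T], is an immersion in [beta].  A critical point of [F] and
    the critical point of [G] that lie over the same point of the germ have the
    same [lambda] and the same [dF_lambda], so solving the projected equation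
    [dF_lambda G (e, lambda) = dF_lambda F (beta, lambda)] for [e] extends the
    matching of critical points to an odd map [e] on a full neighbourhood
    ([matching]).  Comparing ranks ([matching_rank]) shows that the two numbers
    of parameters agree and that [H = (e, lambda)] is a local diffeomorphism.

    Now [F] and [G o H] agree to first order on the critical set of [F].  The
    rank condition lets one use [dF_beta F] as part of a coordinate system
    ([straighten]), so that the difference is a quadratic form
    [dF_beta F . A . (dF_beta F)^T] whose matrix may be taken odd and hence
    zero at the origin ([critical_difference]).  A correction of the form
    [K = (beta + dF_beta F . B, lambda)] absorbs it: expanding [F o K] to
    second order, [F o K = G o H] follows from a matrix equation
    [B + B M B^T + A = 0], which the implicit function theorem solves near
    [B = 0], with [B] odd ([quadratic_correction]).  Then [H o K^-1] is the
    required change of parameters.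

    The argument is uniform in the category.  It uses of the regular germs
    only the algebra operations, composition, partial derivatives, Hadamard's
    quotients [f (x + y) = f x + \sum_i y_i q_i (x, y)] and the inverse function
    theorem.  For smooth germs the quotients are integrals along segments
    ([smooth_hadamard]).  For analytic germs everything is read off from an
    inductive class of functions with an absolutely convergent expansion
    ([majorized]), which is closed under these operations by induction.  The
    inverse function is the limit of the Picard iteration; the quotients bound
    its steps in norm, which yields the inverse map, and in the majorant, which
    yields its analyticity. *)

(** * Row vectors, neighbourhoods and first derivatives *)

Section RowNorm.
Variables (R : realType) (N : nat).
Implicit Types x h : 'rV[R]_N.

Lemma continuous_epsP (V : normedModType R) (f : 'rV[R]_N -> V) x :
  {for x, continuous f} <->
  forall e, 0 < e -> \forall y \near x, `|f x - f y| <= e.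
Proof. exact: (@cvgrPdist_le _ _ _ (nbhs x) (nbhs_filter x)). Qed.

Lemma near_all (P : 'rV[R]_N -> Prop) x : (forall y, P y) -> \forall y \near x, P y.
Proof. by move=> Py; apply: (@filterS _ _ (nbhs_filter x) setT) => //; exact: filterT. Qed.

Lemma near0P (P : 'rV[R]_N -> Prop) : (\forall y \near (0 : 'rV[R]_N), P y) <->
  exists2 d, 0 < d & forall y, `|y| < d -> P y.
Proof.
split=> [/nbhs_ballP[d d0 dP]|[d d0 dP]].
  by exists d => // y yd; apply: dP; rewrite -ball_normE/= sub0r normrN.
apply/nbhs_ballP; exists d => // y; rewrite -ball_normE/= sub0r normrN; exact: dP.
Qed.

Lemma near_forall (I : finType) (P : I -> 'rV[R]_N -> Prop) x :
  (forall i, \forall y \near x, P i y) -> \forall y \near x, forall i, P i y.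
Proof. exact: (@filter_forall _ _ _ _ (nbhs_filter x)). Qed.

Lemma coord_le_norm x i : `|x 0 i| <= `|x|.
Proof.
rewrite [leRHS]/Num.Def.normr/= mx_normrE.
exact: (le_bigmax _ (fun i => `|x i.1 i.2|) (0, i)).
Qed.

Lemma row_norm_le x (s : R) : 0 <= s -> (forall i, `|x 0 i| <= s) -> `|x| <= s.
Proof.
move=> s0 xs; rewrite [leLHS]/Num.Def.normr/= mx_normrE.
by apply: bigmax_le => // -[i j] _ /=; rewrite ord1.
Qed.

(** The differential of a function with partial derivatives a; it carries a
    linear structure so that it can be compared with the differential. *)
Definition linform (a : 'I_N -> R) h : R := \sum_i h 0 i * a i.

Lemma linform_is_linear a : linear (linform a).
Proof.
move=> k u v; rewrite /linform scaler_sumr -big_split/=.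
by apply: eq_bigr => i _; rewrite !mxE mulrDl -mulrA.
Qed.

HB.instance Definition _ a :=
  GRing.isLinear.Build R 'rV[R]_N R _ (linform a) (linform_is_linear a).

Lemma linform_continuous a : continuous (linform a).
Proof.
move=> h; apply: (@cvg_big _ _ _ _ _ _ _ (nbhs h) _ _ _ (nbhs_filter h)) => [|i _].
  exact: add_continuous.
by apply: cvgMr_tmp; exact: coord_continuous.
Qed.

Lemma differentiable_of_expansion (f : 'rV[R]_N -> R) x (a : 'I_N -> R) :
  (forall e, 0 < e -> \forall h \near (0 : 'rV[R]_N),
     `|f (x + h) - f x - linform a h| <= e * `|h|) ->
  differentiable f x /\ 'd f x = linform a :> (_ -> _).
Proof.
move=> H.
have fE : f \o shift x =
    (cst (f x) : 'rV[R]_N -> R^o) + (linform a : 'rV[R]_N -> R^o) +o_ (0 : 'rV[R]_N) id.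
  apply/eqaddoP => e e0; near=> h.
  rewrite [X in `|X|](_ : _ = f (x + h) - f x - linform a h); last first.
    by rewrite [x + h]addrC -addrA -opprD.
  by near: h; exact: H.
have dE := diff_unique (@linform_continuous a) fE; split => //.
apply/diff_locallyP; split; first by rewrite dE; exact: linform_continuous.
by rewrite dE.
Unshelve. all: by end_near. Qed.

(** Continuity of the Hadamard quotients at a single point already gives
    differentiability there, with the values of the quotients as partial
    derivatives. This is how analytic functions are seen to be
    differentiable. *)
Lemma differentiable_of_quotients (f : 'rV[R]_N -> R) x
    (q : 'I_N -> 'rV[R]_N -> R) :
  (\forall h \near (0 : 'rV[R]_N), f (x + h) = f x + \sum_i h 0 i * q i h) ->
  (forall i, {for 0, continuous (q i)}) ->
  differentiable f x /\ 'd f x = linform (q^~ 0) :> (_ -> _).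
Proof.
move=> fq qa; apply: differentiable_of_expansion => e e0.
have e1 : 0 < e / N.+1%:R by rewrite divr_gt0.
have : \forall h \near (0 : 'rV[R]_N), forall i, `|q i 0 - q i h| <= e / N.+1%:R.
  by apply: near_forall => i; move/continuous_epsP : (qa i); exact.
apply: filterS2 fq => h -> qh.
rewrite [f x + _]addrC addrK /linform -sumrB.
apply: le_trans (ler_norm_sum _ _ _) _.
apply: (@le_trans _ _ (\sum_(i < N) (`|h| * (e / N.+1%:R)))).
  apply: ler_sum => i _; rewrite -mulrBr normrM distrC.
  by apply: ler_pM => //; exact: coord_le_norm.
rewrite sumr_const card_ord -[leLHS]mulr_natr -mulrA mulrC.
apply: ler_wpM2r => //.
by rewrite mulrAC ler_pdivrMr// ler_pM2l// ler_nat.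
Qed.

Lemma diff_linformE (f : 'rV[R]_N -> R) x (v : 'rV[R]_N) : differentiable f x ->
  'd f x v = linform (fun i => partial i f x) v.
Proof.
move=> df; rewrite /linform {1}(row_sum_delta v) linear_sum.
by apply: eq_bigr => i _; rewrite linearZ/= /partial deriveE.
Qed.

Lemma partial_eq_near i (f g : 'rV[R]_N -> R) x :
  (\forall y \near x, f y = g y) -> partial i f x = partial i g x.
Proof. exact: near_eq_derive. Qed.

End RowNorm.

Section ChainRule.
Variables (R : realType) (N M : nat).

Lemma differentiable_rowP (g : 'rV[R]_N -> 'rV[R]_M) x :
  (forall j, differentiable (fun y => g y 0 j) x) -> differentiable g x.
Proof.
move=> dg.
have -> : g = \sum_(j < M) (fun y => g y 0 j *: delta_mx 0 j).
  by apply/funext => y; rewrite fct_sumE -row_sum_delta.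
by apply: differentiable_sum => j; exact: differentiableZl.
Qed.

Lemma differentiable_row_coord (g : 'rV[R]_N -> 'rV[R]_M) x j :
  differentiable g x -> differentiable (fun y => g y 0 j) x.
Proof. by move=> dg; exact: (@differentiable_comp _ _ _ _ g (fun M : 'rV[R]__ => M 0 j) x dg (differentiable_coord _ _ _)). Qed.

Lemma diff_row_coord (g : 'rV[R]_N -> 'rV[R]_M) x j v :
  differentiable g x -> 'd g x v 0 j = 'd (fun y => g y 0 j) x v.
Proof.
move=> dg; have dgj := differentiable_row_coord j dg.
rewrite -!deriveE// derive_mx ?mxE//; exact: diff_derivable.
Qed.

Lemma partial_comp (f : 'rV[R]_M -> R) (g : 'rV[R]_N -> 'rV[R]_M) x i :
  (forall j, differentiable (fun y => g y 0 j) x) -> differentiable f (g x) ->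
  partial i (f \o g) x =
  \sum_j partial i (fun y => g y 0 j) x * partial j f (g x).
Proof.
move=> dgj df; have dg := differentiable_rowP dgj.
rewrite /partial deriveE; last exact: differentiable_comp.
rewrite diff_comp//= diff_linformE// /linform.
by apply: eq_bigr => j _; rewrite diff_row_coord// deriveE.
Qed.

Lemma differentiable_comp_row (f : 'rV[R]_M -> R) (g : 'rV[R]_N -> 'rV[R]_M) x :
  (forall j, differentiable (fun y => g y 0 j) x) -> differentiable f (g x) ->
  differentiable (f \o g) x.
Proof.
by move=> dgj df; apply: differentiable_comp => //; exact: differentiable_rowP.
Qed.

Lemma continuous_rowP (g : 'rV[R]_N -> 'rV[R]_M) x :
  (forall j, {for x, continuous (fun y => g y 0 j)}) -> {for x, continuous g}.
Proof.
move=> cg; apply/continuous_epsP => e e0.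
have : \forall y \near x, forall j, `|g x 0 j - g y 0 j| <= e.
  by apply: near_forall => j; move/continuous_epsP : (cg j); exact.
apply: filterS => y gy; apply: row_norm_le; first exact: ltW.
by move=> j; rewrite !mxE.
Qed.

Lemma near_comp (g : 'rV[R]_N -> 'rV[R]_M) x y (P : 'rV[R]_M -> Prop) :
  {for x, continuous g} -> g x = y -> (\forall z \near y, P z) ->
  \forall z \near x, P (g z).
Proof. by move=> cg <- Py; exact: cg. Qed.

End ChainRule.

(** * Functions of class C^n *)

Section Ck.
Variables (R : realType) (N : nat).

(** Partial derivatives are taken one at a time, so that closure properties
    follow by induction on the order; smoothness is this property for every
    order. *)
Fixpoint Ck (n : nat) (U : set 'rV[R]_N) (f : 'rV[R]_N -> R) : Prop :=
  (forall x, U x -> {for x, continuous f}) /\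
  if n is n'.+1 then
    (forall x, U x -> forall i, derivable f x (delta_mx 0 i)) /\
    forall i, Ck n' U (partial i f)
  else True.

Variables (U : set 'rV[R]_N).
Hypothesis oU : open U.
Implicit Types (f g : 'rV[R]_N -> R).

Lemma Ck_continuous n f x : Ck n U f -> U x -> {for x, continuous f}.
Proof. by case: n => [|n] [cf _]; exact: cf. Qed.

Lemma near_open x : U x -> \forall y \near x, U y.
Proof. by move=> Ux; apply: open_nbhs_nbhs; split. Qed.

Lemma eq_on_near f g x : {in U, f =1 g} -> U x -> \forall y \near x, f y = g y.
Proof. by move=> fg /near_open; apply: filterS => y Uy; rewrite fg// inE. Qed.

Lemma continuous_eq_near f g x : (\forall y \near x, f y = g y) ->
  {for x, continuous f} -> {for x, continuous g}.
Proof.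
move=> fg /continuous_epsP cf; apply/continuous_epsP => e /cf.
rewrite (nbhs_singleton fg).
by apply: filterS2 fg => y ->.
Qed.

Lemma Ck_eq n f g : {in U, f =1 g} -> Ck n U f -> Ck n U g.
Proof.
elim: n f g => [|n IHn] f g fg [cf /= df]; (split => [x Ux|]; first exact:
  continuous_eq_near (eq_on_near fg Ux) (cf _ Ux)) => //.
case: df => df Df; split=> [x Ux i|i].
  by apply: near_eq_derivable (df _ Ux i); exact: eq_on_near.
apply: IHn (Df i) => x /set_mem Ux; apply: partial_eq_near.
exact: eq_on_near.
Qed.

Lemma CkW n f : Ck n.+1 U f -> Ck n U f.
Proof.
elim: n f => [|n IHn] f [cf [df Df]]; first by split.
by split => //; split=> // i; exact: IHn.
Qed.

Lemma Ck_partial n i f : Ck n.+1 U f -> Ck n U (partial i f).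
Proof. by case=> _ [_]; exact. Qed.

Lemma smooth_onP f : smooth_on U f <-> forall n, Ck n U f.
Proof.
split=> [sf n|Cf s].
  elim: n f sf => [|n IHn] f sf.
    by split=> // x Ux; have [] := sf [::] x Ux.
  split=> [x Ux|]; first by have [] := sf [::] x Ux.
  split=> [x Ux i|i]; first by have [_] := sf [::] x Ux; exact.
  apply: IHn => s x Ux; have := sf (rcons s i) x Ux.
  by rewrite /iter_partial foldr_rcons.
elim/last_ind: s f Cf => [|s i IHs] f Cf x Ux.
  split; first exact: Ck_continuous (Cf 0%N) Ux.
  by have [_ [+ _]] := Cf 1%N; exact.
rewrite /iter_partial foldr_rcons; apply: IHs => // n.
exact: Ck_partial (Cf n.+1).
Qed.

Lemma Ck_cst n c : Ck n U (fun=> c).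
Proof.
elim: n c => [|n IHn] c; (split=> [x _|]; first exact: cst_continuous) => //.
split=> [x _ i|i]; first exact: derivable_cst.
apply: (@Ck_eq n (fun=> 0)) => // x _.
by rewrite /partial (derive_cst c).
Qed.

Lemma Ck_coord n i : Ck n U (fun x => x 0 i).
Proof.
case: n => [|n]; (split=> [x _|]; first exact: coord_continuous) => //.
split=> [x _ j|j].
  by apply: diff_derivable; exact: differentiable_coord.
apply: (@Ck_eq n (fun=> (delta_mx 0 j : 'rV_N) 0 i)); last exact: Ck_cst.
move=> x _; rewrite /partial; apply/esym.
suff <- : ('D_(delta_mx 0 j) id x) 0 i = 'D_(delta_mx 0 j) (fun y : 'rV[R]_N => y 0 i) x
  by rewrite derive_id.
by rewrite derive_mx ?mxE//; exact: derivable_id.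
Qed.

Lemma Ck_add n f g : Ck n U f -> Ck n U g -> Ck n U (fun x => f x + g x).
Proof.
elim: n f g => [|n IHn] f g [cf df] [cg dg];
  (split=> [x Ux|]; first exact: continuousD (cf _ Ux) (cg _ Ux)) => //.
case: df dg => df Df [dg Dg]; split=> [x Ux i|i].
  by apply: derivableD; [exact: df|exact: dg].
apply: Ck_eq (IHn _ _ (Df i) (Dg i)) => x /set_mem Ux.
by rewrite [RHS]deriveD//; [exact: df|exact: dg].
Qed.

Lemma Ck_sum n (I : Type) (r : seq I) (F : I -> 'rV[R]_N -> R) :
  (forall i, Ck n U (F i)) -> Ck n U (fun x => \sum_(i <- r) F i x).
Proof.
move=> CF; elim: r => [|i r IHr].
  by apply: Ck_eq (Ck_cst n 0) => x _; rewrite big_nil.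
by apply: Ck_eq (Ck_add (CF i) IHr) => x _; rewrite big_cons.
Qed.

Lemma Ck_mul n f g : Ck n U f -> Ck n U g -> Ck n U (fun x => f x * g x).
Proof.
elim: n f g => [|n IHn] f g Cf Cg; have [cf df] := Cf; have [cg dg] := Cg;
  (split=> [x Ux|]; first exact: continuousM (cf _ Ux) (cg _ Ux)) => //.
case: df dg => df Df [dg Dg]; split=> [x Ux i|i].
  by apply: derivableM; [exact: df|exact: dg].
apply: Ck_eq (Ck_add (IHn _ _ (CkW Cf) (Dg i)) (IHn _ _ (CkW Cg) (Df i))).
by move=> x /set_mem Ux; rewrite [RHS]deriveM//; [exact: df|exact: dg].
Qed.

End Ck.

Section C1.
Variable (R : realType).

Lemma is_derive_line (V : normedModType R) (f : V -> R) (y v : V) (s : R) :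
  derivable f (y + s *: v) v ->
  is_derive s 1 (fun t => f (y + t *: v)) ('D_v f (y + s *: v)).
Proof.
have E : (fun h : R => h^-1 *: ((fun t => f (y + t *: v)) (h *: (1 : R) + s)
             - f (y + s *: v)))
       = (fun h : R => h^-1 *: (f (h *: v + (y + s *: v)) - f (y + s *: v))).
  apply/funext => h; congr (_ *: (f _ - _)).
  by rewrite [h *: 1]mulr1 scalerDl addrCA.
by move=> df; apply: DeriveDef; rewrite /derivable /derive E.
Qed.

(** The parameter is allowed to be negative, as difference quotients need
    both signs. *)
Lemma MVT_line (V : normedModType R) (f : V -> R) (y v : V) (t : R) :
  (forall s, `|s| <= `|t| -> derivable f (y + s *: v) v) ->
  exists2 c, `|c| <= `|t| & f (y + t *: v) - f y = t * 'D_v f (y + c *: v).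
Proof.
move=> df; pose g s := f (y + s *: v).
have dg (s : R) : `|s| <= `|t| -> is_derive s 1 g ('D_v f (y + s *: v)).
  by move=> /df; exact: is_derive_line.
have g0 : g 0 = f y by rewrite /g scale0r addr0.
have cg (a b : R) : (forall s, s \in `[a, b]%R -> `|s| <= `|t|) ->
    {within `[a, b], continuous g}.
  move=> ab; apply: derivable_within_continuous => s sab.
  by have [] := dg s (ab s sab).
have [t0|t0] := leP 0 t.
  have It (s : R) : s \in `[0, t]%R -> `|s| <= `|t|.
    by rewrite in_itv/= => /andP[s0 st]; rewrite !ger0_norm.
  have [|c cI E] := @MVT_segment _ g (fun s => 'D_v f (y + s *: v)) _ _ t0 _ (cg _ _ It).
    by move=> s sI; apply: dg; apply: It; exact: subset_itv_oo_cc sI.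
  by exists c; [exact: It|rewrite -g0 -/(g t) E subr0 mulrC].
have It (s : R) : s \in `[t, 0]%R -> `|s| <= `|t|.
  by rewrite in_itv/= => /andP[ts s0]; rewrite !ler0_norm ?lerN2// ltW.
have [|c cI E] := @MVT_segment _ g (fun s => 'D_v f (y + s *: v)) _ _ (ltW t0) _ (cg _ _ It).
  by move=> s sI; apply: dg; apply: It; exact: subset_itv_oo_cc sI.
exists c; first exact: It.
by apply: oppr_inj; rewrite opprB -g0 -/(g t) E sub0r mulrN mulrC.
Qed.

(** Continuous partial derivatives give a Hadamard quotient that is
    continuous at the origin, in each coordinate: move from x to x + h one
    coordinate at a time and apply the mean value theorem to each step. *)
Lemma C1_differentiable (N : nat) (f : 'rV[R]_N -> R) x :
  (\forall y \near x, forall i, derivable f y (delta_mx 0 i)) ->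
  (forall i, {for x, continuous (partial i f)}) ->
  differentiable f x.
Proof.
move=> df cf.
(* the first k coordinates of h, so that consecutive truncations differ in
   one coordinate *)
pose trunc k (h : 'rV[R]_N) : 'rV[R]_N := \row_i (if (i < k)%N then h 0 i else 0).
pose q (i : 'I_N) (h : 'rV[R]_N) := if h 0 i == 0 then partial i f x
  else (f (x + trunc i.+1 h) - f (x + trunc i h)) / h 0 i.
have truncS (i : 'I_N) h : trunc i.+1 h = trunc i h + h 0 i *: delta_mx 0 i.
  apply/rowP => j; rewrite !mxE eqxx/= ltnS leq_eqVlt -val_eqE/=.
  have [/val_inj->|ji] := eqVneq (j : nat) i; last by rewrite mulr0 addr0.
  by rewrite ltnn mulr1 add0r.
suff H : differentiable f x /\ 'd f x = linform (q^~ 0) :> (_ -> _) by case: H.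
apply: differentiable_of_quotients.
  apply: near_all => h.
  have E : f (x + h) - f x = \sum_i h 0 i * q i h; last by rewrite -E subrKC.
  have -> : f (x + h) - f x =
      \sum_(0 <= i < N) (f (x + trunc i.+1 h) - f (x + trunc i h)).
    rewrite telescope_sumr//; congr (f _ - f _).
      by congr (_ + _); apply/rowP => i; rewrite !mxE ltn_ord.
    by rewrite (_ : trunc _ _ = 0) ?addr0//; apply/rowP => i; rewrite !mxE ltn0.
  rewrite big_mkord; apply: eq_bigr => i _; rewrite /q.
  have [h0|h0] := eqVneq (h 0 i) 0; last by rewrite mulrC divfK.
  by rewrite truncS h0 scale0r addr0 subrr mul0r.
move=> i; apply/continuous_epsP => e e0.
have q0 : q i 0 = partial i f x by rewrite /q mxE eqxx.
have /nbhs_ballP[d d0 dP] : \forall y \near x,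
   (forall i, derivable f y (delta_mx 0 i)) /\ `|partial i f x - partial i f y| <= e.
  by apply: filterI df _; move/continuous_epsP : (cf i); exact.
rewrite q0; apply/nbhs_ballP; exists d => // h.
rewrite -ball_normE/= sub0r normrN => hd; rewrite /q.
have [h0|h0] := eqVneq (h 0 i) 0; first by rewrite subrr normr0 ltW.
have small (s : R) : `|s| <= `|h 0 i| ->
    ball x d (x + trunc i h + s *: delta_mx 0 i).
  move=> sh; rewrite -ball_normE/= -addrA opprD addrA subrr sub0r normrN.
  apply: le_lt_trans hd; apply: row_norm_le => // j; rewrite !mxE eqxx/=.
  have [ji|ji] := ltnP j i.
    rewrite (_ : (j == i) = false) ?mulr0 ?addr0 ?coord_le_norm//.
    by apply/negbTE; rewrite -val_eqE neq_ltn ji.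
  rewrite add0r; case: (j == i); last by rewrite mulr0 normr0.
  by rewrite mulr1 (le_trans sh)// coord_le_norm.
have [s /small/dP[+ _]|c /small/dP[_ cP] E] := @MVT_line _ f (x + trunc i h)
  (delta_mx 0 i) (h 0 i); first exact.
by rewrite truncS addrA E mulrAC divff// mul1r.
Qed.

Lemma Ck_differentiable (N n : nat) (U : set 'rV[R]_N) f x :
  open U -> Ck n.+1 U f -> U x -> differentiable f x.
Proof.
move=> oU [_ [df Df]] Ux; apply: C1_differentiable => [|i].
  by apply: filterS (near_open oU Ux) => y; exact: df.
exact: Ck_continuous (Df i) Ux.
Qed.

Lemma continuous_comp_row (N M : nat) (g : 'rV[R]_N -> 'rV[R]_M) f x :
  (forall j, {for x, continuous (fun y => g y 0 j)}) ->
  {for g x, continuous f} -> {for x, continuous (f \o g : _ -> R)}.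
Proof.
by move=> /continuous_rowP cg cf; apply: continuous_comp.
Qed.

Lemma Ck_comp (N M n : nat) (U : set 'rV[R]_N) (V : set 'rV[R]_M)
    (g : 'rV[R]_N -> 'rV[R]_M) f : open U -> open V ->
  (forall x, U x -> V (g x)) ->
  (forall j, Ck n U (fun x => g x 0 j)) -> Ck n V f -> Ck n U (f \o g).
Proof.
move=> oU oV UV; elim: n f => [|n IHn] f Cg Cf; (split=> [x Ux|]; first by
  apply: continuous_comp_row => [j|];
  [exact: Ck_continuous (Cg j) Ux|exact: Ck_continuous Cf (UV _ Ux)]) => //.
have dg x : U x -> forall j, differentiable (fun x => g x 0 j) x.
  by move=> Ux j; exact: Ck_differentiable oU (Cg j) Ux.
have df x : U x -> differentiable f (g x).
  by move=> /UV; exact: Ck_differentiable oV Cf.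
split=> [x Ux i|i].
  apply: diff_derivable; apply: differentiable_comp_row; [exact: dg|exact: df].
apply: (@Ck_eq _ _ _ oU n (fun x => \sum_j partial i (fun y => g y 0 j) x
                               * (partial j f \o g) x)).
  by move=> x /set_mem Ux; rewrite partial_comp//; [exact: dg|exact: df].
apply: Ck_sum => // j; apply: Ck_mul => //; first exact: Ck_partial (Cg j).
by apply: IHn => [j'|]; [exact: CkW|exact: Ck_partial Cf].
Qed.

End C1.

(** * Integrals over the unit interval that depend on parameters *)

Section UnitIntegral.
Variable R : realType.
Implicit Types u v : R -> R.
Local Notation mu := (@lebesgue_measure R).

Definition unit_integral u : R := (\int[mu]_(t in `[0, 1]) u t)%R.

Definition unit_continuous u := forall t, 0 <= t <= 1 -> {for t, continuous u}.

Let unit_itvP t : [set` `[(0 : R), 1]] t <-> 0 <= t <= 1.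
Proof. by rewrite /= in_itv. Qed.

Lemma unit_integrable u : unit_continuous u -> mu.-integrable `[0, 1] (EFin \o u).
Proof.
move=> cu; apply: continuous_compact_integrable; first exact: segment_compact.
apply: continuous_in_subspaceT => t; rewrite inE => /unit_itvP; exact: cu.
Qed.

Lemma unit_integral_near u v e : unit_continuous u -> unit_continuous v ->
  (forall t, 0 <= t <= 1 -> `|u t - v t| <= e) ->
  `|unit_integral u - unit_integral v| <= e.
Proof.
move=> cu cv uv; rewrite /unit_integral -RintegralB//; try exact: unit_integrable.
have cuv : unit_continuous (fun t => u t - v t).
  by move=> t t01; apply: continuousB; [exact: cu|exact: cv].
apply: le_trans (le_normr_Rintegral _ (unit_integrable cuv)) _ => //.
apply: (@le_trans _ _ (\int[mu]_(t in `[0, 1]) e)%R).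
  apply: le_Rintegral => //.
  - apply: (@unit_integrable (fun t => `|u t - v t|)) => t t01.
    exact: cvg_norm (cuv t t01).
  - by apply: (@unit_integrable (cst e)) => t _; exact: cst_continuous.
rewrite Rintegral_cst//= lebesgue_measure_itv/= lte01/=.
by rewrite subr0 mulr1.
Qed.

Lemma unit_integralZ c u : unit_continuous u ->
  unit_integral (fun t => c * u t) = c * unit_integral u.
Proof. by move=> cu; rewrite /unit_integral RintegralZl//; exact: unit_integrable. Qed.

Lemma unit_integralD u v : unit_continuous u -> unit_continuous v ->
  unit_integral (fun t => u t + v t) = unit_integral u + unit_integral v.
Proof. by move=> cu cv; rewrite /unit_integral RintegralD//; exact: unit_integrable. Qed.

Lemma unit_integralB u v : unit_continuous u -> unit_continuous v ->
  unit_integral (fun t => u t - v t) = unit_integral u - unit_integral v.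
Proof. by move=> cu cv; rewrite /unit_integral RintegralB//; exact: unit_integrable. Qed.

Lemma unit_continuous_sum n (u : 'I_n -> R -> R) :
  (forall i, unit_continuous (u i)) -> unit_continuous (fun t => \sum_i u i t).
Proof.
move=> cu t t01; apply: cvg_big => [|i _]; first exact: add_continuous.
exact: cu.
Qed.

Lemma unit_integral_sum n (u : 'I_n -> R -> R) : (forall i, unit_continuous (u i)) ->
  unit_integral (fun t => \sum_i u i t) = \sum_i unit_integral (u i).
Proof.
elim: n u => [|n IHn] u cu.
  rewrite big_ord0; under [X in unit_integral X]eq_fun do rewrite big_ord0.
  by rewrite /unit_integral Rintegral_cst// mul0r.
rewrite big_ord_recl -IHn//.
under [X in unit_integral X]eq_fun do rewrite big_ord_recl.
by rewrite unit_integralD//; exact: unit_continuous_sum.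
Qed.

Lemma unit_integral_FTC u v :
  (forall t : R, 0 <= t <= 1 -> is_derive t 1 u (v t)) -> unit_continuous v ->
  unit_integral v = u 1 - u 0.
Proof.
move=> du cv.
have cu (t : R) : 0 <= t <= 1 -> {for t, continuous u}.
  by move=> /du[dut _]; apply: differentiable_continuous; exact/derivable1_diffP.
rewrite /unit_integral /Rintegral (@continuous_FTC2 _ v u 0 1)//.
- apply: continuous_in_subspaceT => t; rewrite inE => /unit_itvP; exact: cv.
- split.
  + by move=> t /subset_itv_oo_cc/unit_itvP/du[].
  + by apply: cvg_at_right_filter; apply: cu; rewrite lexx ler01.
  + by apply: cvg_at_left_filter; apply: cu; rewrite lexx ler01.
- by move=> t /subset_itv_oo_cc/unit_itvP/du[_ <-]; rewrite derive1E.
Qed.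

Section Slices.
Variable (M : nat).
Implicit Types (z : 'rV[R]_M) (U : set 'rV[R]_M) (G : 'rV[R]_(1 + M) -> R).

Definition slice (t : R) z : 'rV[R]_(1 + M) := row_mx (const_mx t) z.

Lemma sliceE t z (j : 'I_(1 + M)) : slice t z 0 j =
  match fintype.split j with inl _ => t | inr k => z 0 k end.
Proof. by rewrite mxE; case: (fintype.split j) => k //; rewrite mxE. Qed.

Lemma slice_dist t t' z z' e : `|t - t'| < e -> `|z - z'| < e ->
  `|slice t z - slice t' z'| < e.
Proof.
move=> te ze; have [d [te' ze' de]] : exists d, [/\ `|t - t'| <= d, `|z - z'| <= d & d < e].
  exists (Num.max `|t - t'| `|z - z'|).
  by rewrite !le_max !lexx orbT gt_max te ze.
apply: le_lt_trans de; apply: row_norm_le; first exact: le_trans te'.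
move=> j; rewrite (_ : (slice t z - slice t' z') 0 j = slice t z 0 j - slice t' z' 0 j); last first.
  by rewrite [LHS]mxE [X in _ + X]mxE.
rewrite !sliceE; case: (fintype.split j) => k //.
by apply: le_trans ze'; apply: le_trans (coord_le_norm _ k); rewrite !mxE.
Qed.

(** The integrand has to be regular on an open set O that contains the
    cylinder over U, for its integral to be regular on U. *)
Definition slab U (O : set 'rV[R]_(1 + M)) :=
  forall t z, 0 <= t <= 1 -> U z -> O (slice t z).

(** Compactness of the unit interval makes the closeness uniform in the
    integration variable. *)
Lemma near_slices G z e : (forall t, 0 <= t <= 1 -> {for slice t z, continuous G}) ->
  0 < e -> \forall z' \near z, forall t, 0 <= t <= 1 ->
    `|G (slice t z') - G (slice t z)| <= e.
Proof.
move=> cG e0.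
have [cK _] := compact_near_coveringP `[(0 : R), 1].
have H : \forall z' \near z,
    `[(0 : R), 1] `<=` (fun t => `|G (slice t z') - G (slice t z)| <= e).
  apply: (cK (@segment_compact _ 0 1) _ (nbhs z) _ (nbhs_filter z)).
  move=> t /unit_itvP t01.
  have e2 : 0 < e / 2 by rewrite divr_gt0.
  have /continuous_epsP/(_ _ e2)/nbhs_ballP[d d0 dP] := cG t t01.
  exists (ball t d, ball z d); first by split; exact: nbhsx_ballx.
  move=> [t' z'] [/= tt' zz'].
  have {}zz' : `|z - z'| < d by move: zz'; rewrite -ball_normE.
  have P1 : `|G (slice t z) - G (slice t' z')| <= e / 2.
    by apply: dP; rewrite -ball_normE/=; apply: slice_dist.
  have P2 : `|G (slice t z) - G (slice t' z)| <= e / 2.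
    by apply: dP; rewrite -ball_normE/=; apply: slice_dist => //; rewrite subrr normr0.
  rewrite [e]splitr -(subrKA (G (slice t z))) (le_trans (ler_normD _ _))//.
  by rewrite lerD// distrC.
by apply: filterS H => z' P t t01; apply: P; exact/unit_itvP.
Qed.

Definition slice_integral G z := unit_integral (fun t => G (slice t z)).

Lemma slice_unit_continuous G z :
  (forall t, 0 <= t <= 1 -> {for slice t z, continuous G}) ->
  unit_continuous (fun t => G (slice t z)).
Proof.
move=> cG t t01; apply/(@cvgrPdist_le _ _ _ (nbhs t)) => e e0.
have /continuous_epsP/(_ _ e0)/nbhs_ballP[d d0 dP] := cG t t01.
apply/nbhs_ballP; exists d => // t' tt'; apply: dP.
by rewrite -ball_normE/=; apply: slice_dist => //; rewrite subrr normr0.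
Qed.

Lemma slice_integral_continuous G z :
  (\forall z' \near z, forall t, 0 <= t <= 1 -> {for slice t z', continuous G}) ->
  {for z, continuous (slice_integral G)}.
Proof.
move=> cG; apply/continuous_epsP => e e0.
have cz := nbhs_singleton cG; have := near_slices cz e0.
apply: filterS2 cG => z' cz' zz'.
apply: unit_integral_near => [| |t t01].
- exact: slice_unit_continuous.
- exact: slice_unit_continuous.
- by rewrite distrC; exact: zz'.
Qed.

Lemma slice_line t z (i : 'I_M) (s : R) :
  slice t (s *: delta_mx 0 i + z) = s *: delta_mx 0 (rshift 1 i) + slice t z.
Proof.
apply/rowP => j; rewrite sliceE.
rewrite [RHS]mxE sliceE [X in _ = X + _]mxE [delta_mx _ _ _ _]mxE eqxx/=.
case: splitP => k jk.
  rewrite (_ : j == _ = false) ?mulr0 ?add0r//.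
  by apply/negbTE; rewrite -val_eqE/= jk; case: k {jk} => -[].
rewrite !mxE eqxx/=; congr (_ * _%:R + _).
by rewrite -!val_eqE/= jk eqn_add2l.
Qed.

(** Differentiation under the integral sign: the mean value theorem turns
    the difference quotient into a value of the partial derivative at a
    nearby slice, and these values are close uniformly in the integration
    variable. *)
Lemma slice_integral_derive G z i :
  (\forall z' \near z, forall t, 0 <= t <= 1 -> {for slice t z', continuous G}) ->
  (\forall z' \near z, forall t, 0 <= t <= 1 ->
     derivable G (slice t z') (delta_mx 0 (rshift 1 i))) ->
  (forall t, 0 <= t <= 1 -> {for slice t z, continuous (partial (rshift 1 i) G)}) ->
  is_derive z (delta_mx 0 i) (slice_integral G)
    (slice_integral (partial (rshift 1 i) G) z).
Proof.
move=> cG dG cD.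
suff H : h^-1 *: (slice_integral G (h *: delta_mx 0 i + z) - slice_integral G z)
    @[h --> 0^'] --> slice_integral (partial (rshift 1 i) G) z.
  by apply: DeriveDef; [apply/cvg_ex; eexists; exact: H|exact/cvg_lim].
apply/cvgrPdist_le => e e0.
have /nbhs_ballP[d d0 dP] : \forall z' \near z, forall t, 0 <= t <= 1 ->
   [/\ {for slice t z', continuous G},
     derivable G (slice t z') (delta_mx 0 (rshift 1 i)) &
    `|partial (rshift 1 i) G (slice t z') - partial (rshift 1 i) G (slice t z)| <= e].
  have := near_slices cD e0; apply: filterS3 cG dG => z' c' d' e' t t01.
  by split; [exact: c'|exact: d'|exact: e'].
have small (s : R) : `|s| < d -> ball z d (s *: delta_mx 0 i + z).
  move=> sd; rewrite -ball_normE/= opprD addrCA subrr addr0 normrN.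
  apply: le_lt_trans sd; apply: row_norm_le => // j.
  rewrite !mxE eqxx/= normrM; case: (j == i); last by rewrite normr0 mulr0.
  by rewrite normr1 mulr1.
near=> h.
have h0 : h != 0 by near: h; exact: nbhs_dnbhs_neq.
have hd : `|h| < d by near: h; exact: dnbhs0_lt.
have ch : unit_continuous (fun t => G (slice t (h *: delta_mx 0 i + z))).
  by apply: slice_unit_continuous => t t01; have [] := dP _ (small _ hd) t t01.
have c0 : unit_continuous (fun t => G (slice t z)).
  by apply: slice_unit_continuous; exact: nbhs_singleton cG.
rewrite -unit_integralB// -[_ *: _]unit_integralZ//; last first.
  by move=> t t01; apply: continuousB; [exact: ch|exact: c0].
apply: unit_integral_near.
- exact: slice_unit_continuous.
- move=> t t01; apply: continuousM; first exact: cst_continuous.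
  by apply: continuousB; [exact: ch|exact: c0].
move=> t t01; rewrite slice_line [X in G X - _]addrC.
have [s sh|c ch' ->] := @MVT_line _ _ G (slice t z) (delta_mx 0 (rshift 1 i)) h.
  rewrite addrC -slice_line.
  by have [] := dP _ (small _ (le_lt_trans sh hd)) t t01.
rewrite mulrA mulVf// mul1r distrC [X in 'D_ _ _ X]addrC -slice_line.
by have [] := dP _ (small _ (le_lt_trans ch' hd)) t t01.
Unshelve. all: by end_near. Qed.

Lemma Ck_slice_integral n U (O : set 'rV[R]_(1 + M)) G : open U -> open O -> slab U O ->
  Ck n O G -> Ck n U (slice_integral G).
Proof.
move=> oU oO UO; elim: n G => [|n IHn] G CG;
  (split=> [z Uz|]; first by apply: slice_integral_continuous;
     apply: filterS (near_open oU Uz) => z' Uz' t t01;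
     apply: Ck_continuous CG _; exact: UO) => //.
have D z : U z -> forall i, is_derive z (delta_mx 0 i) (slice_integral G)
    (slice_integral (partial (rshift 1 i) G) z).
  move=> Uz i; apply: slice_integral_derive.
  - apply: filterS (near_open oU Uz) => z' Uz' t t01.
    by apply: Ck_continuous CG _; exact: UO.
  - apply: filterS (near_open oU Uz) => z' Uz' t t01.
    by case: CG => _ [+ _]; apply; exact: UO.
  - move=> t t01; apply: Ck_continuous (Ck_partial _ CG) _; exact: UO.
split=> [z Uz i|i]; first by have [] := D z Uz i.
apply: (Ck_eq oU) (IHn _ (Ck_partial (rshift 1 i) CG)) => z /set_mem Uz.
by have [_ <-] := D z Uz i.
Qed.

End Slices.
End UnitIntegral.

(** * Hadamard's lemma for smooth functions *)

Section SmoothHadamard.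
Variables (R : realType) (N : nat).

Let segment_point (p : 'rV[R]_(1 + (N + N))) : 'rV[R]_N :=
  \row_j (p 0 (rshift 1 (lshift N j))
    + p 0 (lshift (N + N) ord0) * p 0 (rshift 1 (rshift N j))).

Let segment_pointE t x y : segment_point (slice t (row_mx x y)) = x + t *: y.
Proof.
apply/rowP => j; rewrite [LHS]mxE /slice.
by rewrite !(row_mxEr, row_mxEl) !mxE.
Qed.

Let Ck_segment_point n j : Ck n setT (fun p => segment_point p 0 j).
Proof.
apply: (@Ck_eq _ _ _ openT n (fun p => p 0 (rshift 1 (lshift N j))
    + p 0 (lshift (N + N) ord0) * p 0 (rshift 1 (rshift N j)))).
  by move=> p _; rewrite mxE.
apply: Ck_add; [exact: openT|exact: Ck_coord openT _ _|].
by apply: Ck_mul; [exact: openT|exact: Ck_coord openT _ _|exact: Ck_coord openT _ _].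
Qed.

Lemma CkS n M (U V : set 'rV[R]_M) f : U `<=` V -> Ck n V f -> Ck n U f.
Proof.
move=> UV; elim: n f => [|n IHn] f [cf Df]; split=> //; try by move=> x /UV; exact: cf.
case: Df => df Df; split=> [x Ux i|i]; first exact: df (UV _ Ux) i.
exact: IHn (Df i).
Qed.

(** The quotients are the integrals over the segment from x to x + y of the
    partial derivatives of f, by the fundamental theorem of calculus. *)
Lemma smooth_hadamard (U : set 'rV[R]_N) f : open U -> U 0 -> smooth_on U f ->
  exists V : set 'rV[R]_(N + N), [/\ open V, V 0 &
  exists q : 'I_N -> 'rV[R]_(N + N) -> R, (forall i, smooth_on V (q i)) /\
    forall x y, V (row_mx x y) ->
      f (x + y) = f x + \sum_i y 0 i * q i (row_mx x y)].
Proof.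
move=> oU U0 /smooth_onP Cf.
have /nbhs_ballP[d d0 dU] := near_open oU U0.
have {}Cf n : Ck n (ball (0 : 'rV[R]_N) d) f by exact: CkS dU (Cf n).
have oW : open (ball (0 : 'rV[R]_N) d) by exact: ball_open.
pose V := ball (0 : 'rV[R]_(N + N)) (d / 2).
pose O := segment_point @^-1` ball (0 : 'rV[R]_N) d.
have oO : open O.
  apply: open_comp => // p _; apply: continuous_rowP => j.
  exact: Ck_continuous (Ck_segment_point 0 j) _.
have oV : open V by exact: ball_open.
have VO : slab V O.
  move=> t z /andP[t0 t1]; rewrite -[z]hsubmxK.
  rewrite /V -ball_normE/= sub0r normrN => zd.
  rewrite /O /= segment_pointE -ball_normE/= sub0r normrN [d]splitr.
  apply: le_lt_trans (ler_normD _ _) _; apply: ltrD.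
    apply: le_lt_trans zd; apply: row_norm_le => // j.
    by rewrite (le_trans _ (coord_le_norm _ (lshift N j)))// row_mxEl.
  apply: le_lt_trans zd; apply: row_norm_le => // j.
  rewrite mxE normrM (ger0_norm t0).
  apply: (@le_trans _ _ `|rsubmx z 0 j|); first by rewrite ler_piMl.
  by rewrite (le_trans _ (coord_le_norm _ (rshift N j)))// row_mxEr.
have CG n i : Ck n O (partial i f \o segment_point).
  apply: (Ck_comp oO oW) => //; last exact: Ck_partial (Cf n.+1).
  by move=> j; apply: CkS (Ck_segment_point n j).
exists V; split => //; first by apply: ballxx; rewrite divr_gt0.
exists (fun i => slice_integral (partial i f \o segment_point)); split.
  by move=> i; apply/smooth_onP => n; exact: Ck_slice_integral oV oO VO (CG n i).
move=> x y Vxy.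
have O_t (t : R) : 0 <= t <= 1 -> ball (0 : 'rV[R]_N) d (x + t *: y).
  by move=> t01; have := VO t _ t01 Vxy; rewrite /O/= segment_pointE.
have cv i : unit_continuous (fun t => partial i f (x + t *: y)).
  have := @slice_unit_continuous _ _ (partial i f \o segment_point) (row_mx x y).
  rewrite (_ : (fun t => _) = fun t => partial i f (x + t *: y)); last first.
    by apply/funext => t; rewrite /= segment_pointE.
  by apply=> s s01; apply: Ck_continuous (CG 0%N i) _; exact: VO.
have cyv i : unit_continuous (fun t => y 0 i * partial i f (x + t *: y)).
  by move=> t t01; apply: continuousM; [exact: cst_continuous|exact: cv].
suff E : unit_integral (fun t => \sum_i y 0 i * partial i f (x + t *: y))
    = f (x + y) - f x.
  rewrite -[LHS](subrKC (f x)) -E unit_integral_sum//.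
  congr (_ + _); apply: eq_bigr => i _.
  rewrite (unit_integralZ _ (cv i)) /slice_integral.
  rewrite [in RHS](_ : (fun t => _) = fun t => partial i f (x + t *: y))//.
  by apply/funext => t /=; rewrite segment_pointE.
have := @unit_integral_FTC _ (fun t => f (x + t *: y))
  (fun t => \sum_i y 0 i * partial i f (x + t *: y)).
rewrite scale1r scale0r addr0; apply.
- move=> t t01.
  have df : differentiable f (x + t *: y).
    by apply: (Ck_differentiable oW (Cf 1%N)); exact: O_t.
  have dfy : derivable f (x + t *: y) y by exact: diff_derivable.
  have := is_derive_line dfy.
  by rewrite deriveE// diff_linformE.
- exact: unit_continuous_sum.
Qed.

End SmoothHadamard.

Section CkMatrix.
Variables (R : realType) (N : nat) (U : set 'rV[R]_N).
Hypothesis oU : open U.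

Lemma Ck_opp n f : Ck n U f -> Ck n U (fun x => - f x).
Proof.
move=> Cf; apply: (Ck_eq oU) (Ck_mul oU (Ck_cst oU n (- 1)) Cf) => x _.
by rewrite mulN1r.
Qed.

Lemma Ck_prod n (I : Type) (r : seq I) (F : I -> 'rV[R]_N -> R) :
  (forall i, Ck n U (F i)) -> Ck n U (fun x => \prod_(i <- r) F i x).
Proof.
move=> CF; elim: r => [|i r IHr].
  by apply: (Ck_eq oU) (Ck_cst oU n 1) => x _; rewrite big_nil.
by apply: (Ck_eq oU) (Ck_mul oU (CF i) IHr) => x _; rewrite big_cons.
Qed.

Lemma Ck_inv n (f : 'rV[R]_N -> R) : (forall x, U x -> f x != 0) -> Ck n U f ->
  Ck n U (fun x => (f x)^-1).
Proof.
move=> f0; elim: n => [|n IHn] Cf; (split=> [x Ux|]; first by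
  exact: cvgV (f0 _ Ux) (Ck_continuous Cf Ux)) => //.
have df x i : U x -> derivable f x (delta_mx 0 i) by case: Cf => _ [+ _] => /[apply].
split=> [x Ux i|i]; first by apply: derivableV; [exact: f0|exact: df].
have If := IHn (CkW Cf).
apply: (Ck_eq oU) (Ck_opp (Ck_mul oU (Ck_mul oU If If) (Ck_partial i Cf))).
move=> x /set_mem Ux; rewrite [RHS]deriveV//; [|exact: f0|exact: df].
by rewrite scaleNr -mulrN -invfM -expr2 mulrN.
Qed.

Lemma Ck_det n p (A : 'rV[R]_N -> 'M[R]_p) :
  (forall i j, Ck n U (fun x => A x i j)) -> Ck n U (fun x => \det (A x)).
Proof.
move=> CA; apply: (Ck_eq oU) (@Ck_sum _ _ _ oU n _ (index_enum _)
  (fun s : {perm 'I_p} => fun x => (-1) ^+ s * \prod_i A x i (s i)) _) => // s.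
apply: (Ck_mul oU); first exact: Ck_cst.
exact: Ck_prod.
Qed.

Lemma Ck_invmx n p (A : 'rV[R]_N -> 'M[R]_p) :
  (forall x, U x -> A x \in unitmx) -> (forall i j, Ck n U (fun x => A x i j)) ->
  forall i j, Ck n U (fun x => invmx (A x) i j).
Proof.
move=> uA CA i j.
have Cinv : Ck n U (fun x => (\det (A x))^-1).
  by apply: Ck_inv; [move=> x /uA; rewrite unitmxE unitfE|exact: Ck_det].
have Ccof : Ck n U (fun x => cofactor (A x) j i).
  apply: (Ck_mul oU); first exact: Ck_cst.
  apply: Ck_det => i' j'; apply: (Ck_eq oU) (CA (lift j i') (lift i j')) => x _.
  by rewrite !mxE.
apply: (Ck_eq oU) (Ck_mul oU Cinv Ccof) => x /set_mem /uA uAx.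
by rewrite /invmx uAx !mxE.
Qed.

End CkMatrix.

(** * Absolutely convergent expansions on a ball *)

Section BoundedSeries.
Variable R : realType.
Implicit Types (u B : nat -> R).

(** Weierstrass test, in the form in which the bounds are only known
    through their partial sums. *)
Lemma bounded_series_cvg u B M : (forall n, `|u n| <= B n) ->
  (forall n, \sum_(i < n) B i <= M) -> cvgn (fun n => \sum_(i < n) u i).
Proof.
move=> uB BM.
have -> : (fun n => \sum_(i < n) u i) = series u.
  by apply/funext => n; rewrite /series /= big_mkord.
suff H : cvgn (series (fun n => `|u n|)) by exact: normed_cvg H.
apply: nondecreasing_is_cvgn.
  by apply/nondecreasing_seqP => n; rewrite /series/= !big_mkord big_ord_recr lerDl.
exists M => _ [n _ <-]; apply: le_trans (BM n).
by rewrite /series/= big_mkord; exact: ler_sum.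
Qed.

Lemma sum_tail (F : nat -> R) J J' : (J <= J')%N ->
  \sum_(n < J') F n - \sum_(n < J) F n = \sum_(J <= n < J') F n.
Proof.
move=> JJ'; rewrite -(big_mkord xpredT F) (big_cat_nat _ JJ')//=.
by rewrite big_mkord addrAC subrr add0r.
Qed.

(** Dominated convergence for series: a bound B that does not depend on k
    makes the tails of the series uniformly small, which permits the
    interchange of the two limits. *)
Lemma tannery (u : nat -> nat -> R) (v w : nat -> R) B (V M : R) :
  (forall n k, `|u n k| <= B n) -> (forall n, \sum_(i < n) B i <= M) ->
  (forall n, u n k @[k --> \oo] --> v n) ->
  (forall k, (fun J => \sum_(n < J) u n k) @ \oo --> w k) ->
  (fun J => \sum_(n < J) v n) @ \oo --> V ->
  w @ \oo --> V.
Proof.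
move=> uB BM uv uw vV.
have B0 n : 0 <= B n by apply: le_trans (uB n 0%N).
have cB : cvgn (fun n => \sum_(i < n) B i).
  by apply: (@bounded_series_cvg B B M) => // n; rewrite ger0_norm.
set b := limn (fun n => \sum_(i < n) B i) in cB *.
have tail J k : `|w k - \sum_(n < J) u n k| <= b - \sum_(n < J) B n.
  have H1 : (fun J' => `|\sum_(n < J') u n k - \sum_(n < J) u n k|) @ \oo -->
      `|w k - \sum_(n < J) u n k|.
    by apply: cvg_norm; apply: cvgB; [exact: uw|exact: cvg_cst].
  have H2 : (fun J' => \sum_(n < J') B n - \sum_(n < J) B n) @ \oo -->
      b - \sum_(n < J) B n.
    by apply: cvgB; [exact: cB|exact: cvg_cst].
  apply: (ler_cvg_to H1 H2); exists J => // J' /= JJ'.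
  rewrite (sum_tail (u^~ k) JJ') (sum_tail B JJ').
  by apply: le_trans (ler_norm_sum _ _ _) _; exact: ler_sum.
apply/cvgrPdist_le => e e0; have e3 : 0 < e / 3 by rewrite divr_gt0.
have [J [tJ vJ]] : exists J, b - \sum_(n < J) B n <= e / 3 /\
    `|V - \sum_(n < J) v n| <= e / 3.
  have /cvgrPdist_le/(_ _ e3) H1 := cB.
  have /cvgrPdist_le/(_ _ e3) H2 := vV.
  have [J _ /(_ J (leqnn J))[/= H3 H4]] := filterI H1 H2.
  by exists J; split => //; exact: le_trans (ler_norm _) H3.
have H : (fun k => \sum_(n < J) u n k) @ \oo --> \sum_(n < J) v n.
  by apply: cvg_big => [|n _]; [exact: add_continuous|exact: uv].
have /cvgrPdist_le/(_ _ e3) := H; apply: filterS => k Hk.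
have -> : V - w k = (V - \sum_(n < J) v n) +
   (\sum_(n < J) v n - \sum_(n < J) u n k) - (w k - \sum_(n < J) u n k) by ring.
have -> : e = e / 3 + e / 3 + e / 3 by field.
apply: le_trans (ler_normB _ _) _; apply: lerD; last exact: le_trans (tail J k) tJ.
by apply: le_trans (ler_normD _ _) _; exact: lerD.
Qed.

End BoundedSeries.

Section Majorized.
Variable R : realType.

(** The functions that agree on the closed ball of radius s with an
    absolutely convergent, possibly iterated, sum of monomials, where M
    bounds the sum of the sup norms of the terms. A monomial is given by
    the list of its factors. Closure under sums, products and compositions
    is then a plain induction, where power series would call for a
    rearrangement each time. *)
Inductive majorized N (s : R) : ('rV[R]_N -> R) -> R -> Prop :=
| majorized_monomial c (a : seq 'I_N) f M :
    (forall h : 'rV[R]_N, `|h| <= s -> f h = c * \prod_(i <- a) h 0 i) ->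
    `|c| * s ^+ size a <= M -> majorized s f M
| majorized_series (F : nat -> 'rV[R]_N -> R) (B : nat -> R) f M :
    (forall n, majorized s (F n) (B n)) ->
    (forall n, \sum_(i < n) B i <= M) ->
    (forall h : 'rV[R]_N, `|h| <= s -> (fun n => \sum_(i < n) F i h) @ \oo --> f h) ->
    majorized s f M.

Section OneRadius.
Variables (N : nat) (s : R).
Hypothesis s0 : 0 <= s.
Implicit Types (f g : 'rV[R]_N -> R).

Lemma majorized_ge0 f M : majorized s f M -> 0 <= M.
Proof.
elim=> {f M} [c a f M _|F B f M _ _ BM _].
  by apply: le_trans; rewrite mulr_ge0// exprn_ge0.
by have := BM 0%N; rewrite big_ord0.
Qed.

Lemma majorizedW f M M' : M <= M' -> majorized s f M -> majorized s f M'.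
Proof.
move=> + mf; case: mf => {f M} [c a f M fE cM|F B f M FB BM Ff] MM.
  by apply: majorized_monomial fE _; exact: le_trans cM MM.
by apply: majorized_series FB _ Ff => n; exact: le_trans (BM n) MM.
Qed.

Lemma majorized_eq f g M : (forall h : 'rV[R]_N, `|h| <= s -> f h = g h) ->
  majorized s f M -> majorized s g M.
Proof.
move=> fg mf; case: mf fg => {f M} [c a f M fE cM|F B f M FB BM Ff] fg.
  by apply: majorized_monomial cM => h hs; rewrite -fg// fE.
by apply: majorized_series FB BM _ => h hs; rewrite -fg//; exact: Ff.
Qed.

Lemma majorized_bound f M (h : 'rV[R]_N) : majorized s f M -> `|h| <= s -> `|f h| <= M.
Proof.
move=> mf hs; elim: mf => {f M} [c a f M -> //|F B f M _ FB BM /(_ h hs) Ff].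
  apply: le_trans; rewrite normrM ler_wpM2l//.
  elim: a => [|i a IHa]; first by rewrite big_nil normr1 expr0.
  rewrite big_cons normrM exprS ler_pM//.
  exact: le_trans (coord_le_norm h i) hs.
have H : (fun n => `|\sum_(i < n) F i h|) @ \oo --> `|f h| by exact: cvg_norm.
have H' : (fun _ : nat => M) @ \oo --> M by exact: cvg_cst.
apply: (ler_cvg_to H H'); apply: nearW => n /=.
apply: le_trans (BM n); apply: le_trans (ler_norm_sum _ _ _) _.
by apply: ler_sum => i _; exact: FB.
Qed.

Lemma majorized_cst c : majorized s (fun _ : 'rV[R]_N => c) `|c|.
Proof.
apply: (@majorized_monomial _ _ c [::]); last by rewrite expr0 mulr1.
by move=> h _; rewrite big_nil mulr1.
Qed.

Lemma majorized_coord i : majorized s (fun h : 'rV[R]_N => h 0 i) s.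
Proof.
apply: (@majorized_monomial _ _ 1 [:: i]); last by rewrite normr1 mul1r.
by move=> h _; rewrite big_seq1 mul1r.
Qed.

Lemma majorized_add f g M M' : majorized s f M -> majorized s g M' ->
  majorized s (fun h : 'rV[R]_N => f h + g h) (M + M').
Proof.
move=> mf mg.
(* the two-term series, padded with zeros *)
pose two (V : nmodType) (x y : V) n := if n is n'.+1 then (if n' is 0%N then y else 0) else x.
have E (V : nmodType) (x y : V) n : \sum_(i < n.+2) two V x y i = x + y.
  by rewrite !big_ord_recl big1 ?addr0.
apply: (@majorized_series _ _ (two ('rV[R]_N -> R) f g) (two R M M')).
- by case=> [|[|n]] //=; rewrite -(normr0 R); exact: majorized_cst.
- case=> [|[|n]]; last by rewrite E.
    by rewrite big_ord0 addr_ge0//; [exact: majorized_ge0 mf|exact: majorized_ge0 mg].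
  by rewrite big_ord1 lerDl; exact: majorized_ge0 mg.
- move=> h _; apply: cvg_near_cst; exists 2%N => // n /=.
  case: n => [|[|n]]// _; rewrite -[RHS](E _ _ _ n).
  by apply: eq_bigr => -[[|[|i]] ?].
Qed.

Lemma majorized_sum (I : Type) (r : seq I) (P : pred I) (F : I -> 'rV[R]_N -> R)
  (B : I -> R) : (forall i, majorized s (F i) (B i)) ->
  majorized s (fun h : 'rV[R]_N => \sum_(i <- r | P i) F i h) (\sum_(i <- r | P i) B i).
Proof.
move=> FB; elim: r => [|i r IHr].
  have := majorized_cst 0; rewrite normr0 big_nil; apply: majorized_eq => h _.
  by rewrite big_nil.
rewrite big_cons; case: ifPn => Pi.
  by apply: majorized_eq (majorized_add (FB i) IHr) => h _; rewrite big_cons Pi.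
by apply: majorized_eq IHr => h _; rewrite big_cons (negbTE Pi).
Qed.

Lemma majorized_scale c f M : majorized s f M ->
  majorized s (fun h : 'rV[R]_N => c * f h) (`|c| * M).
Proof.
elim=> {f M} [c' a f M fE cM|F B f M _ IH BM Ff].
  apply: (@majorized_monomial _ _ (c * c') a) => [h hs|].
    by rewrite fE// mulrA.
  by rewrite normrM -mulrA ler_wpM2l.
apply: majorized_series IH _ _ => [n|h hs].
  by rewrite -mulr_sumr ler_wpM2l.
under eq_fun do rewrite -mulr_sumr.
by apply: cvgMl_tmp; exact: Ff.
Qed.

Lemma majorized_mul f g M M' : majorized s f M -> majorized s g M' ->
  majorized s (fun h : 'rV[R]_N => f h * g h) (M * M').
Proof.
move=> mf mg; elim: mf => {f M} [c a f M fE cM|F B f M _ IH BM Ff].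
  suff H : majorized s (fun h : 'rV[R]_N => (\prod_(i <- a) h 0 i) * g h) (s ^+ size a * M').
    apply: majorizedW (majorized_eq _ (majorized_scale c H)).
      by rewrite mulrA ler_wpM2r//; exact: majorized_ge0 mg.
    by move=> h hs; rewrite fE// mulrA.
  elim: mg => {g M'} [c' a' g M' gE cM'|G B g M' _ IH BM Gg].
    apply: (@majorized_monomial _ _ c' (a ++ a')) => [h hs|].
      by rewrite gE// big_cat/= mulrCA.
    by rewrite size_cat exprD mulrCA ler_wpM2l// exprn_ge0.
  apply: majorized_series IH _ _ => [n|h hs].
    by rewrite -mulr_sumr ler_wpM2l// exprn_ge0.
  under eq_fun do rewrite -mulr_sumr.
  by apply: cvgMl_tmp; exact: Gg.
apply: majorized_series IH _ _ => [n|h hs].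
  by rewrite -mulr_suml ler_wpM2r//; exact: majorized_ge0 mg.
under eq_fun do rewrite -mulr_suml.
by apply: cvgMr_tmp; exact: Ff.
Qed.

Lemma majorized_prod (I : Type) (r : seq I) (F : I -> 'rV[R]_N -> R)
  (B : I -> R) : (forall i, majorized s (F i) (B i)) ->
  majorized s (fun h : 'rV[R]_N => \prod_(i <- r) F i h) (\prod_(i <- r) B i).
Proof.
move=> FB; elim: r => [|i r IHr].
  have := majorized_cst 1; rewrite normr1 big_nil; apply: majorized_eq => h _.
  by rewrite big_nil.
rewrite big_cons.
by apply: majorized_eq (majorized_mul (FB i) IHr) => h _; rewrite big_cons.
Qed.

Lemma majorized_limn (F : nat -> 'rV[R]_N -> R) (B : nat -> R) M :
  (forall n, majorized s (F n) (B n)) -> (forall n, \sum_(i < n) B i <= M) ->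
  (forall h : 'rV[R]_N, `|h| <= s -> cvgn (fun n => \sum_(i < n) F i h)) /\
  majorized s (fun h : 'rV[R]_N => limn (fun n => \sum_(i < n) F i h)) M.
Proof.
move=> FB BM.
have cF (h : 'rV[R]_N) : `|h| <= s -> cvgn (fun n => \sum_(i < n) F i h).
  by move=> hs; apply: (@bounded_series_cvg _ (fun i => F i h) B M) => // n; exact: majorized_bound.
by split => //; exact: majorized_series FB BM cF.
Qed.

End OneRadius.

Lemma majorized_shrink N (s s' : R) (f : 'rV[R]_N -> R) M : 0 <= s' -> s' <= s ->
  majorized s f M -> majorized s' f M.
Proof.
move=> s'0 s's; elim=> {f M} [c a f M fE cM|F B f M _ IH BM Ff].
  apply: (@majorized_monomial _ _ c a) => [h hs|].
    by apply: fE; exact: le_trans hs s's.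
  by apply: le_trans cM; rewrite ler_wpM2l// lerXn2r// nnegrE// (le_trans s'0).
by apply: majorized_series IH BM _ => h hs; apply: Ff; exact: le_trans hs s's.
Qed.

(** The ball of radius s is sent into the ball of radius r, and the product
    of the components along a monomial has the bound that the monomial
    itself has at radius r. *)
Lemma majorized_comp N N' (s r : R) (g : 'rV[R]_N -> 'rV[R]_N') f M :
  0 <= s -> 0 <= r -> (forall j, majorized s (fun h : 'rV[R]_N => g h 0 j) r) ->
  majorized r f M -> majorized s (f \o g) M.
Proof.
move=> s0 r0 gr.
have gh (h : 'rV[R]_N) : `|h| <= s -> `|g h| <= r.
  by move=> hs; apply: row_norm_le => // j; exact: (majorized_bound (gr j) hs).
elim=> {f M} [c a f M fE cM|F B f M _ IH BM Ff].
  have := majorized_scale c (majorized_prod s0 a gr).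
  rewrite big_const_seq count_predT iter_mulr_1 => H; apply: majorizedW cM _.
  by apply: majorized_eq H => h hs; rewrite /= fE//; exact: gh.
by apply: majorized_series IH BM _ => h hs; apply: Ff; exact: gh.
Qed.

(** Peeling off one factor at a time divides a monomial at x + y by the
    coordinates of y; the radius 4 s leaves room for the sum x + y, of size
    2 s, and for the terms that the division produces, so that the bound M
    / s does not depend on the degree. That uniformity is what carries the
    quotients through a series. *)
Lemma majorized_hadamard N (s : R) (f : 'rV[R]_N -> R) M : 0 < s ->
  majorized (4 * s) f M -> exists q : 'I_N -> 'rV[R]_(N + N) -> R,
    (forall i, majorized s (q i) (M / s)) /\
    forall x y : 'rV[R]_N, `|x| <= s -> `|y| <= s ->
      f (x + y) = f x + \sum_i y 0 i * q i (row_mx x y).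
Proof.
move=> s0; have s0' := ltW s0; have s40 : 0 <= 4 * s by rewrite mulr_ge0.
have pair_le (x y : 'rV[R]_N) : `|x| <= s -> `|y| <= s -> `|row_mx x y| <= s.
  move=> xs ys; apply: row_norm_le => // j; rewrite mxE; case: fintype.split => k.
    exact: le_trans (coord_le_norm _ _) xs.
  exact: le_trans (coord_le_norm _ _) ys.
have sum_le (x y : 'rV[R]_N) : `|x| <= s -> `|y| <= s -> `|x + y| <= 4 * s.
  move=> xs ys; apply: le_trans (ler_normD _ _) _; apply: le_trans (lerD xs ys) _.
  lra.
elim=> {f M} [c a f M fE cM|F B f M _ IH BM Ff].
  suff [q [qB qE]] : exists q : 'I_N -> 'rV[R]_(N + N) -> R,
    (forall i, majorized s (q i) ((4 * s) ^+ size a / s)) /\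
    forall x y : 'rV[R]_N, \prod_(i <- a) (x + y) 0 i = \prod_(i <- a) x 0 i
       + \sum_i y 0 i * q i (row_mx x y).
    exists (fun i z => c * q i z); split=> [i|x y xs ys].
      apply: majorizedW (majorized_scale c (qB i)).
      by rewrite mulrA ler_wpM2r// invr_ge0.
    rewrite !fE ?qE ?mulrDr ?mulr_sumr ?sum_le//; last first.
      by apply: le_trans xs _; rewrite ler_peMl// ler1n.
    by congr (_ + _); apply: eq_bigr => i _; rewrite mulrCA.
  elim: a {cM fE} => [|i0 a [q [qB qE]]].
    exists (fun _ _ => 0); split=> [i|x y].
      apply: majorizedW (majorized_cst _ _ 0).
      by rewrite normr0 expr0 mul1r invr_ge0.
    by rewrite !big_nil big1 ?addr0// => i _; rewrite mulr0.
  pose xy (i : 'I_N) (z : 'rV[R]_(N + N)) := z 0 (lshift N i) + z 0 (rshift N i).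
  have xyB i : majorized s (xy i) (s + s).
    by apply: majorized_add => //; exact: majorized_coord.
  exists (fun i z => (i == i0)%:R * \prod_(j <- a) xy j z + z 0 (lshift N i0) * q i z).
  split=> [i|x y].
    apply: (@majorizedW _ _ _ (`|(i == i0)%:R| * \prod_(j <- a) (s + s) + s * ((4 * s) ^+ size a / s))).
      rewrite big_const_seq count_predT iter_mulr_1 /= exprS.
      have sn0 : s != 0 by rewrite gt_eqF.
      have -> : 4 * s * (4 * s) ^+ size a / s =
          3 * (4 * s) ^+ size a + s * ((4 * s) ^+ size a / s) by field.
      rewrite lerD2r.
      have H : (s + s) ^+ size a <= (4 * s) ^+ size a.
        by rewrite lerXn2r ?nnegrE ?addr_ge0//; lra.
      have H0 : 0 <= (s + s) ^+ size a by rewrite exprn_ge0 ?addr_ge0.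
      by case: (i == i0); rewrite ?normr1 ?normr0; lra.
    apply: majorized_add => //.
      by apply: majorized_scale; exact: majorized_prod.
    by apply: majorized_mul => //; exact: majorized_coord.
  rewrite !big_cons qE mxE mulrDl mulrDr -addrA; congr (_ + _).
  rewrite [RHS](eq_bigr _ (fun i _ => mulrDr _ _ _)) big_split/= addrC; congr (_ + _).
    rewrite [RHS](bigD1 i0)//= eqxx mul1r [X in _ = _ + X]big1 ?addr0; last first.
      by move=> i /negbTE ->; rewrite mul0r mulr0.
    rewrite -qE; congr (_ * _); apply: eq_bigr => i _.
    by rewrite /xy row_mxEl row_mxEr mxE.
  by rewrite mulr_sumr; apply: eq_bigr => i _; rewrite row_mxEl mulrCA.
have /choice[q /all_and2[qB qE]] := IH.
have BMs n : \sum_(i < n) B i / s <= M / s.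
  by rewrite -mulr_suml ler_wpM2r// invr_ge0.
have cq (i : 'I_N) := (majorized_limn (fun n => qB n i) BMs).1.
exists (fun i z => limn (fun n => \sum_(k < n) q k i z)); split=> [i|x y xs ys].
  exact: (majorized_limn (fun n => qB n i) BMs).2.
have H1 := Ff _ (sum_le _ _ xs ys).
have H2 : (fun n => \sum_(i < n) F i x) @ \oo --> f x.
  by apply: Ff; apply: le_trans xs _; rewrite ler_peMl// ler1n.
have H3 : (fun n => \sum_i y 0 i * \sum_(k < n) q k i (row_mx x y)) @ \oo -->
   \sum_i y 0 i * limn (fun n => \sum_(k < n) q k i (row_mx x y)).
  apply: cvg_big => [|i _]; first exact: add_continuous.
  by apply: cvgMl_tmp; apply: cq; exact: pair_le.
have := cvgD H2 H3.
rewrite (_ : _ + _ = fun n => \sum_(i < n) F i (x + y)); last first.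
  apply/funext => n; rewrite fctE.
  under [X in _ + X = _]eq_bigr do rewrite mulr_sumr.
  rewrite exchange_big/= -big_split/=; apply: eq_bigr => k _.
  by rewrite qE.
by move=> H4; apply: (cvg_unique _ H1); [exact: norm_hausdorff|exact: H4].
Qed.

End Majorized.

(** * Expansions on a ball and power series *)

Section PowerSeries.
Variables (R : realType) (N : nat).
Implicit Types (c : ('I_N -> nat) -> R) (h : 'rV[R]_N).

(** The exhaustion of the multi-indices by boxes by which power series are
    summed. *)
Definition box_sum (G : ('I_N -> nat) -> R) (k : nat) : R :=
  \sum_(a : {ffun 'I_N -> 'I_k}) G (fun i => a i : nat).

Lemma box_sum_widen G k K : (k <= K)%N ->
  box_sum G k = \sum_(a : {ffun 'I_N -> 'I_K} | [forall i, (a i < k)%N])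
     G (fun i => a i : nat).
Proof.
move=> kK; pose w (b : {ffun 'I_N -> 'I_k}) := [ffun i => widen_ord kK (b i)].
have winj : injective w.
  move=> b b' /ffunP bb; apply/ffunP => i; have := bb i.
  by rewrite !ffunE => /(congr1 val)/= ?; exact: val_inj.
rewrite /box_sum (eq_bigr (fun b => G (fun i => w b i : nat))); last first.
  move=> b _; congr G; apply/funext => i; by rewrite ffunE.
transitivity (\sum_(b in predT) G (fun i => w b i : nat)); first exact: eq_bigl.
rewrite -(big_imset (fun a : {ffun 'I_N -> 'I_K} => G (fun i => a i : nat))) /=; last first.
  by move=> b b' _ _; exact: winj.
apply: eq_bigl => a; apply/imsetP/forallP => [[b _ ->] i|ak].
  by rewrite ffunE/= ltn_ord.
exists [ffun i => Ordinal (ak i)]; first by rewrite inE.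
by apply/ffunP => i; rewrite !ffunE; exact: val_inj.
Qed.

Lemma box_sum_mono G k K : (k <= K)%N -> (forall b, 0 <= G b) ->
  box_sum G k <= box_sum G K.
Proof.
move=> kK G0; rewrite (box_sum_widen G kK) /box_sum.
rewrite [leRHS](bigID (fun a : {ffun 'I_N -> 'I_K} => [forall i, (a i < k)%N]))/=.
by rewrite lerDl; apply: sumr_ge0.
Qed.

Lemma box_sum_term G (b : 'I_N -> nat) : (forall b', 0 <= G b') ->
  exists k, G b <= box_sum G k.
Proof.
move=> G0; exists (\sum_i b i).+1%N; rewrite /box_sum.
rewrite (bigD1 [ffun i => inord (b i)])//= (_ : (fun i => _) = b); last first.
  apply/funext => i; rewrite ffunE inordK// ltnS.
  by rewrite (bigD1 i)//= leq_addr.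
by rewrite lerDl sumr_ge0.
Qed.

Lemma monomial_normE (b : 'I_N -> nat) h : `|monomial b h| = \prod_i `|h 0 i| ^+ b i.
Proof. by rewrite /monomial normr_prod; apply: eq_bigr => i _; rewrite normrX. Qed.

Lemma monomial_le (b : 'I_N -> nat) h (s : R) : `|h| <= s ->
  `|monomial b h| <= monomial b (const_mx s : 'rV_N).
Proof.
move=> hs; rewrite monomial_normE /monomial; apply: ler_prod => i _.
rewrite exprn_ge0//= mxE lerXn2r ?nnegrE//.
  exact: le_trans (normr_ge0 h) hs.
exact: le_trans (coord_le_norm h i) hs.
Qed.

(** The terms of a power series are grouped into the shells between
    consecutive boxes; absolute convergence at the corner of the ball
    bounds the sum of the majorants of the shells. *)
Lemma majorized_powser c (f : 'rV[R]_N -> R) r s : 0 < s -> s < r ->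
  (forall h : 'rV[R]_N, (forall i, `|h 0 i| < r) -> power_series_sum c h (f h)) ->
  exists M, majorized s f M.
Proof.
move=> s0 sr cf.
pose G h b := c b * monomial b h.
pose As (b : 'I_N -> nat) := `|c b| * monomial b (const_mx s : 'rV[R]_N).
have mono_s0 (b : 'I_N -> nat) : 0 <= monomial b (const_mx s : 'rV[R]_N).
  by rewrite /monomial prodr_ge0// => i _; rewrite mxE exprn_ge0// ltW.
have As0 b : 0 <= As b by rewrite mulr_ge0.
have [M AM] : exists M, forall k, box_sum As k <= M.
  have [|cA _] := cf (const_mx s); first by move=> i; rewrite mxE gtr0_norm.
  have /cvg_ex[l Al] := cA; exists l => k.
  have {}Al : (box_sum As : nat -> R) @ \oo --> l.
    rewrite (_ : box_sum As = fun k : nat => \sum_(a : {ffun 'I_N -> 'I_k})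
       `|c (fun i => a i : nat) * monomial (fun i => a i : nat) (const_mx s : 'rV[R]_N)|)//.
    apply/funext => n; apply: eq_bigr => a _.
    by rewrite normrM [X in _ * X]ger0_norm.
  apply: (ler_cvg_to (@cvg_cst _ (box_sum As k) _ _ _) Al).
  by exists k => // n /= kn; exact: box_sum_mono.
(* the n-th shell: multi-indices in the box of side n.+1 but not in that of
   side n, and the zero multi-index when n = 0 *)
pose P n (a : {ffun 'I_N -> 'I_n.+1}) := (n == 0%N) || ~~ [forall i, (a i < n)%N].
pose F n h := \sum_(a : {ffun 'I_N -> 'I_n.+1} | P n a) G h (fun i => a i : nat).
pose B n := \sum_(a : {ffun 'I_N -> 'I_n.+1} | P n a) As (fun i => a i : nat).
have sumP (H : ('I_N -> nat) -> R) k : \sum_(n < k.+1)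
    \sum_(a : {ffun 'I_N -> 'I_n.+1} | P n a) H (fun i => a i : nat) = box_sum H k.+1.
  elim: k => [|k IHk]; first by rewrite big_ord1; apply: eq_bigl => a; rewrite /P eqxx.
  rewrite big_ord_recr/= IHk (box_sum_widen H (leqnSn k.+1)) /box_sum.
  rewrite [RHS](bigID (fun a : {ffun 'I_N -> 'I_k.+2} => [forall i, (a i < k.+1)%N]))/=; congr (_ + _).
have mono_maj (b : 'I_N -> nat) : majorized s (monomial b) (monomial b (const_mx s : 'rV[R]_N)).
  have s0' := ltW s0; rewrite /monomial.
  have H i : majorized s (fun h => h 0 i ^+ b i) ((const_mx s : 'rV[R]_N) 0 i ^+ b i).
    rewrite mxE; have := majorized_prod s0' (nseq (b i) tt) (fun=> majorized_coord s i).
    rewrite big_nseq iter_mulr_1; apply: majorized_eq => h _.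
    by rewrite big_nseq iter_mulr_1.
  have := majorized_prod s0' (index_enum 'I_N) H; exact.
exists M; apply: (@majorized_series _ _ _ F B).
- move=> n; apply: majorized_sum; first exact: ltW.
  by move=> a; apply: majorized_scale => //; exact: ltW.
- by case=> [|k]; [rewrite big_ord0; exact: le_trans (sumr_ge0 _ _) (AM 0%N)
                  |rewrite /B (sumP As)].
- move=> h hs; rewrite -(cvg_shiftS (fun n => \sum_(i < n) F i h)).
  rewrite (_ : (fun n => _) = (fun n => box_sum (G h) n.+1)); last first.
    by apply/funext => n /=; rewrite /F (sumP (G h)).
  rewrite (cvg_shiftS (box_sum (G h))).
  have [|_] := cf h; last exact.
  by move=> i; apply: le_lt_trans sr; exact: le_trans (coord_le_norm h i) hs.
Qed.

Lemma monomial_count (a : seq 'I_N) h :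
  \prod_(i <- a) h 0 i = monomial (fun i => count_mem i a) h.
Proof.
rewrite /monomial; elim: a => [|j a IHa]; first by rewrite big_nil big1.
rewrite big_cons IHa [RHS](bigD1 j)//= eqxx exprS -mulrA; congr (_ * _).
rewrite (bigD1 j)//=; congr (_ * _); apply: eq_bigr => i /negbTE ij.
by rewrite eq_sym ij.
Qed.

Definition coefficients (s : R) (f : 'rV[R]_N -> R) M c :=
  (forall k, box_sum (fun b => `|c b| * monomial b (const_mx s : 'rV[R]_N)) k <= M) /\
  forall h, `|h| <= s -> box_sum (fun b => c b * monomial b h) @ \oo --> f h.

(** Collecting the coefficients of a monomial over an iterated series needs
    two facts: the collected coefficient converges, since each of its terms
    is dominated by a majorant, and the box sums may be exchanged with the
    outer sum, which is [tannery]. *)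
Lemma majorized_coefficients s f M : 0 < s -> majorized s f M ->
  exists c, coefficients s f M c.
Proof.
move=> s0; elim=> {f M} [c a f M fE cM|F B f M _ IH BM Ff].
  pose ca i := count_mem i a.
  (* a single monomial: only the multi-index that counts its factors has a
     nonzero coefficient *)
  pose d (b : 'I_N -> nat) := if [forall i, b i == ca i] then c else 0.
  have dE (H : ('I_N -> nat) -> R) k : box_sum (fun b => (if [forall i, b i == ca i] then c else 0) * H b) k =
      if [forall i, (ca i < k)%N] then c * H ca else 0.
    rewrite /box_sum; case: ifPn => [/forallP cak|]; last first.
      rewrite negb_forall => /existsP[i cik]; apply: big1 => b _.
      case: ifPn => [/forallP/(_ i)/eqP bi|]; last by rewrite mul0r.
      by rewrite -bi ltn_ord in cik.
    rewrite (bigD1 [ffun i => Ordinal (cak i)])//= big1 ?addr0.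
      rewrite ifT; last by apply/forallP => i; rewrite ffunE.
      by congr (_ * H _); apply/funext => i; rewrite ffunE.
    move=> b bc; case: ifPn => [/forallP bca|]; last by rewrite mul0r.
    case/eqP: bc; apply/ffunP => i; rewrite ffunE; apply: val_inj.
    exact/eqP/bca.
  exists d; split=> [k|h hs].
    have E b : `|d b| * monomial b (const_mx s : 'rV[R]_N) =
       (if [forall i, b i == ca i] then c else 0) * (Num.sg c * monomial b (const_mx s : 'rV[R]_N)).
      rewrite /d; case: ifP => _; last by rewrite normr0 !mul0r.
      by rewrite mulrA [c * _]mulrC -normrEsg.
    rewrite (funext E) (dE (fun b => Num.sg c * monomial b (const_mx s : 'rV[R]_N))).
    case: ifP => _; last by apply: le_trans cM; rewrite mulr_ge0// exprn_ge0// ltW.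
    apply: le_trans cM; rewrite mulrA [c * _]mulrC -normrEsg.
    rewrite -monomial_count; under eq_bigr do rewrite mxE.
    by rewrite big_const_seq count_predT iter_mulr_1.
  apply: cvg_near_cst; exists (\sum_i ca i).+1%N => // k /= kk.
  rewrite dE ifT; first by rewrite fE// monomial_count.
  apply/forallP => i; apply: leq_ltn_trans kk.
  by rewrite (bigD1 i)//= leq_addr.
have /choice[c cP] := IH.
have mono_s0 (b : 'I_N -> nat) : 0 < monomial b (const_mx s : 'rV[R]_N).
  by rewrite /monomial prodr_gt0// => i _; rewrite mxE exprn_gt0.
have cb n b : `|c n b| <= B n / monomial b (const_mx s : 'rV[R]_N).
  rewrite ler_pdivlMr//.
  have [|k] := @box_sum_term (fun b => `|c n b| * monomial b (const_mx s : 'rV[R]_N)) b.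
    by move=> b'; rewrite mulr_ge0// ltW.
  by move=> /le_trans; apply; exact: (cP n).1.
have ccvg b : cvgn (fun J => \sum_(n < J) c n b).
  apply: (@bounded_series_cvg _ _ _ (M / monomial b (const_mx s : 'rV[R]_N))) (cb^~ b) _ => n.
  by rewrite -mulr_suml ler_wpM2r// invr_ge0 ltW.
pose d b := limn (fun J => \sum_(n < J) c n b).
exists d; split=> [k|h hs].
  have H : (fun J => box_sum (fun b => `|\sum_(n < J) c n b| * monomial b (const_mx s : 'rV[R]_N)) k) @ \oo -->
      box_sum (fun b => `|d b| * monomial b (const_mx s : 'rV[R]_N)) k.
    apply: cvg_big => [|b _]; first exact: add_continuous.
    by apply: cvgMr_tmp; apply: cvg_norm; exact: ccvg.
  apply: (ler_cvg_to H (@cvg_cst _ M _ _ _)); apply: nearW => J.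
  apply: le_trans (BM J); rewrite /box_sum.
  apply: (@le_trans _ _ (\sum_(a : {ffun 'I_N -> 'I_k}) \sum_(n < J)
     `|c n (fun i => a i : nat)| * monomial (fun i => a i : nat) (const_mx s : 'rV[R]_N))).
    apply: ler_sum => b _; rewrite -mulr_suml.
    by apply: ler_wpM2r; [exact/ltW/mono_s0|exact: ler_norm_sum].
  rewrite exchange_big/=; apply: ler_sum => n _; exact: (cP n).1.
apply: (@tannery _ (fun n k => box_sum (fun b => c n b * monomial b h) k)
   (fun n => F n h) _ B (f h) M) => //.
- move=> n k; apply: le_trans ((cP n).1 k); rewrite /box_sum.
  apply: le_trans (ler_norm_sum _ _ _) _; apply: ler_sum => b _.
  by rewrite normrM ler_wpM2l// monomial_le.
- by move=> n; exact: (cP n).2.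
- move=> k; rewrite /box_sum.
  rewrite (_ : (fun J => _) = fun J => \sum_(a : {ffun 'I_N -> 'I_k})
     (\sum_(n < J) c n (fun i => a i : nat)) * monomial (fun i => a i : nat) h); last first.
    apply/funext => J; rewrite exchange_big/=; apply: eq_bigr => b _.
    by rewrite mulr_suml.
  apply: cvg_big => [|b _]; first exact: add_continuous.
  by apply: cvgMr_tmp; exact: ccvg.
- exact: Ff.
Qed.

Lemma coefficients_powser s f M c h : coefficients s f M c -> (forall i, `|h 0 i| < s) ->
  0 < s -> power_series_sum c h (f h).
Proof.
move=> [cM cf] hs s0; have {}hs : `|h| <= s.
  by apply: row_norm_le => [|i]; rewrite ltW.
split; last exact: cf.
rewrite (_ : (fun k => _) = box_sum (fun b => `|c b * monomial b h|))//.
apply: nondecreasing_is_cvgn.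
  by move=> k K kK; exact: box_sum_mono.
exists M => _ [k _ <-]; apply: le_trans (cM k); apply: ler_sum => b _.
by rewrite normrM ler_wpM2l// monomial_le.
Qed.

End PowerSeries.

(** * The calculus of regular germs *)

Section MajorizedShift.
Variables (R : realType) (N : nat).
Implicit Types (f : 'rV[R]_N -> R).

Lemma majorized_shift (s s' : R) f M (x : 'rV[R]_N) : 0 <= s' -> `|x| + s' <= s ->
  majorized s f M -> majorized s' (fun h => f (x + h)) M.
Proof.
move=> s0 xs mf; have s00 : 0 <= s by apply: le_trans xs; rewrite addr_ge0.
apply: (majorized_comp s0 s00 _ mf) => j.
apply: (@majorizedW _ _ _ _ (`|x 0 j| + s')).
  by apply: le_trans xs; rewrite lerD2r; exact: coord_le_norm.
have := majorized_add s0 (majorized_cst _ _ (x 0 j)) (majorized_coord s' j).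
by apply: majorized_eq => h _; rewrite mxE.
Qed.

Lemma majorized0 (s M : R) : 0 <= M -> majorized s (fun _ : 'rV[R]_N => 0) M.
Proof. by move=> M0; have := majorized_cst N s 0; rewrite normr0; exact: majorizedW. Qed.

Lemma lsubmx_norm_le M (z : 'rV[R]_(N + M)) : `|lsubmx z| <= `|z|.
Proof. by apply: row_norm_le => // i; rewrite mxE; exact: coord_le_norm. Qed.

Lemma rsubmx_norm_le M (z : 'rV[R]_(M + N)) : `|rsubmx z| <= `|z|.
Proof. by apply: row_norm_le => // i; rewrite mxE; exact: coord_le_norm. Qed.

Lemma row_mx_norm_le (M : nat) (x : 'rV[R]_N) (y : 'rV[R]_M) s :
  `|x| <= s -> `|y| <= s -> `|row_mx x y| <= s.
Proof.
move=> xs ys; apply: row_norm_le => [|j]; first exact: le_trans (normr_ge0 x) xs.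
rewrite mxE; case: fintype.split => k.
  exact: le_trans (coord_le_norm _ _) xs.
exact: le_trans (coord_le_norm _ _) ys.
Qed.

Lemma near_openP (P : 'rV[R]_N -> Prop) (x : 'rV[R]_N) : (\forall y \near x, P y) ->
  exists U : set 'rV[R]_N, [/\ open U, U x & forall y, U y -> P y].
Proof.
move=> /nbhs_ballP[e e0 eP]; exists (ball x e); split => //; first exact: ball_open.
exact: ballxx.
Qed.

Lemma near_norm_lt (x : 'rV[R]_N) (s : R) : 0 < s -> \forall y \near x, `|y - x| < s.
Proof.
move=> s0; apply/nbhs_ballP; exists s => // y.
by rewrite -ball_normE/= distrC.
Qed.

Lemma near0_norm_lt (s : R) : 0 < s -> \forall y \near (0 : 'rV[R]_N), `|y| < s.
Proof. by move=> /(near_norm_lt 0); apply: filterS => y; rewrite subr0. Qed.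

Lemma majorized_continuous (s : R) f M (x : 'rV[R]_N) : majorized s f M -> `|x| < s ->
  {for x, continuous f}.
Proof.
move=> mf xs; pose t := (s - `|x|) / 4.
have t0 : 0 < t by rewrite divr_gt0// subr_gt0.
have mg : majorized (4 * t) (fun h => f (x + h)) M.
  apply: majorized_shift mf; first by rewrite mulr_ge0// ltW.
  by rewrite /t mulrC divfK// subrKC.
have [q [qM qE]] := majorized_hadamard t0 mg.
apply/continuous_epsP => e e0.
have M0 : 0 <= M by apply: majorized_ge0 mg; rewrite mulr_ge0// ltW.
pose C := N%:R * (M / t) + 1.
have C0 : 0 < C by rewrite ltr_wpDl// mulr_ge0// divr_ge0// ltW.
have : \forall y \near x, `|y - x| < Num.min t (e / C).
  by apply: near_norm_lt; rewrite lt_min t0 divr_gt0.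
apply: filterS => y; rewrite lt_min => /andP[yt ye].
have -> : f y = f (x + (0 + (y - x))) by rewrite add0r subrKC.
rewrite qE ?normr0 ?addr0 ?(ltW t0) ?(ltW yt)// opprD addNKr normrN.
apply: le_trans (ler_norm_sum _ _ _) _.
apply: (@le_trans _ _ (\sum_(i < N) `|y - x| * (M / t))).
  apply: ler_sum => i _; rewrite normrM; apply: ler_pM => //; first exact: coord_le_norm.
  by apply: (majorized_bound (qM i)); apply: row_mx_norm_le; rewrite ?normr0 ltW.
rewrite sumr_const card_ord -[leLHS]mulr_natr -mulrA [_ * N%:R]mulrC.
rewrite ltr_pdivlMr// in ye; apply: le_trans (ltW ye).
by rewrite ler_wpM2l// /C lerDl.
Qed.

(** A function that vanishes at a point has arbitrarily small majorants on
    small balls around it, because its Hadamard quotients are bounded. This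
    allows a majorized function to be composed with any analytic germ. *)
Lemma majorized_small (t : R) (f : 'rV[R]_N -> R) B x e : 0 < t ->
  majorized t (fun h => f (x + h)) B -> 0 < e ->
  exists r, 0 < r /\ majorized r (fun h => f (x + h) - f x) e.
Proof.
move=> t0 mf e0; have t4 : 0 < t / 4 by rewrite divr_gt0.
have [|q [qM qE]] := @majorized_hadamard _ _ _ (fun h => f (x + h)) B t4.
  by rewrite mulrC divfK.
pose C := N%:R * (B / (t / 4)) + 1.
have B0 : 0 <= B by apply: majorized_ge0 mf; exact: ltW.
have C0 : 0 < C by rewrite ltr_wpDl// mulr_ge0// divr_ge0// ltW.
pose r := Num.min (t / 4) (e / C).
have r0 : 0 < r by rewrite lt_min t4 divr_gt0.
have rt : r <= t / 4 by rewrite ge_min lexx.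
exists r; split => //.
have m1 i : majorized r (fun h => q i (row_mx 0 h)) (B / (t / 4)).
  apply: (majorized_comp (ltW r0) (ltW t4) _ (qM i)) => l.
  case: (split_ordP l) => l' ->.
    by apply: majorized_eq (majorized0 _ (ltW t4)) => h _; rewrite row_mxEl mxE.
  apply: majorizedW rt _; apply: majorized_eq (majorized_coord _ l') => h _.
  by rewrite row_mxEr.
have m2 := majorized_sum (ltW r0) (index_enum 'I_N) xpredT
  (fun i => majorized_mul (ltW r0) (majorized_coord r i) (m1 i)).
apply: majorizedW (majorized_eq _ m2).
  rewrite sumr_const card_ord -[leLHS]mulr_natr -mulrA [_ * N%:R]mulrC.
  apply: (@le_trans _ _ (e / C * C)); last by rewrite divfK// gt_eqF.
  apply: ler_pM; [exact: ltW|by rewrite mulr_ge0// divr_ge0// ltW| |by rewrite /C lerDl].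
  by rewrite ge_min lexx orbT.
move=> h hr; have := qE 0 h; rewrite normr0 add0r addr0.
by move=> /(_ (ltW t4) (le_trans hr rt)) ->; rewrite addrC addKr.
Qed.

End MajorizedShift.

Lemma finite_min (R : realType) (I : finType) (r : I -> R) : (forall i, 0 < r i) ->
  exists r0, 0 < r0 /\ forall i, r0 <= r i.
Proof.
move=> rP; exists (\big[Num.min/1]_j r j); split; last by move=> j; exact: bigmin_le.
by apply: lt_bigmin.
Qed.

Section RegularAt.
Variable R : realType.
Implicit Types (k : category).

(** The germ at an arbitrary base point; at the origin this is convertible
    to [regular_germ]. *)
Definition regular_at k N (x : 'rV[R]_N) (f : 'rV[R]_N -> R) : Prop :=
  exists U : set 'rV[R]_N, [/\ open U, U x &
    match k with Smooth => smooth_on U f | Analytic => analytic_on U f end].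

Section OneSpace.
Variable N : nat.
Implicit Types (x y : 'rV[R]_N) (f g : 'rV[R]_N -> R).

(** Smoothness and analyticity on a set are pointwise conditions; this is
    the condition at one point. *)
Definition regular_point k y f : Prop := match k with
  | Smooth => smooth_on [set y] f
  | Analytic => analytic_on [set y] f
  end.

Lemma regular_atP k x f : regular_at k x f <-> \forall y \near x, regular_point k y f.
Proof.
split=> [[U [oU Ux Uf]]|].
  apply: filterS (near_open oU Ux) => y Uy.
  by case: k Uf => Uf; [move=> s _ ->|move=> _ ->]; exact: Uf.
move=> /near_openP[U [oU Ux UP]]; exists U; split => //.
by case: k UP => UP; [move=> s y /UP|move=> y /UP]; exact.
Qed.

Lemma regular_at_near k x f : regular_at k x f -> \forall y \near x, regular_at k y f.
Proof.
by move=> [U [oU Ux Uf]]; apply: filterS (near_open oU Ux) => y Uy; exists U.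
Qed.

Lemma near_shift0 x (P : 'rV[R]_N -> Prop) :
  (\forall y \near x, P y) <-> \forall h \near (0 : 'rV[R]_N), P (x + h).
Proof.
split=> /nbhs_ballP[e e0 eP]; apply/nbhs_ballP; exists e => // y.
  rewrite -ball_normE/= sub0r normrN => ye; apply: eP.
  by rewrite -ball_normE/= opprD addNKr normrN.
rewrite -ball_normE/= distrC => ye; rewrite -(subrKC x y); apply: eP.
by rewrite -ball_normE/= sub0r normrN.
Qed.

Lemma majorized_powser_near (s : R) f M x : 0 < s -> majorized s (fun h => f (x + h)) M ->
  regular_at Analytic x f.
Proof.
move=> s0 mf; apply/regular_atP.
have s2 : 0 < s / 2 by rewrite divr_gt0.
apply: filterS (near_norm_lt x s2) => y yx _ ->.
have m2 : majorized (s / 2) (fun h => f (y + h)) M.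
  have := @majorized_shift _ _ s (s / 2) _ M (y - x) (ltW s2) _ mf.
  rewrite [X in _ <= X]splitr lerD2r => /(_ (ltW yx)).
  by apply: majorized_eq => h _; rewrite addrA subrKC.
have [c cP] := majorized_coefficients s2 m2.
by exists c, (s / 2); split => // h hs; exact: (coefficients_powser cP).
Qed.

Lemma analytic_atP x f : regular_at Analytic x f <->
  exists s M, 0 < s /\ majorized s (fun h => f (x + h)) M.
Proof.
split=> [[U [_ Ux /(_ x Ux)[c [r [r0 cf]]]]]|[s [M [s0 mf]]]]; last first.
  exact: majorized_powser_near mf.
have r2 : 0 < r / 2 by rewrite divr_gt0.
have [|M mf] := majorized_powser r2 _ cf.
  by rewrite ltr_pdivrMr// ltr_pMr// ltr1n.
by exists (r / 2), M.
Qed.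

Lemma smooth_atP x f : regular_at Smooth x f <->
  exists U, [/\ open U, U x & forall n, Ck n U f].
Proof. by split=> -[U [oU Ux /smooth_onP Uf]]; exists U. Qed.

Lemma regular_at_eq k x f g : (\forall y \near x, f y = g y) ->
  regular_at k x f -> regular_at k x g.
Proof.
move=> fg; case: k.
  move=> /smooth_atP[U [oU Ux Uf]].
  have : \forall y \near x, U y /\ f y = g y by apply: filterI fg; exact: near_open.
  move=> /near_openP[V [oV Vx VP]]; apply/smooth_atP; exists V; split => // n.
  apply: (Ck_eq oV) (CkS _ (Uf n)) => [y /set_mem /VP[]//|y /VP[]//].
move=> /analytic_atP[s [M [s0 mf]]]; apply/analytic_atP.
move/near_shift0/nbhs_ballP: fg => [e /= e0 eP].
have m0 : 0 < Num.min s (e / 2) by rewrite lt_min s0 divr_gt0.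
exists (Num.min s (e / 2)), M; split => //.
have := majorized_shrink (ltW m0) _ mf; rewrite ge_min lexx => /(_ isT).
apply: majorized_eq => h; rewrite le_min => /andP[_ he]; apply: eP.
rewrite -ball_normE/= sub0r normrN; apply: le_lt_trans he _.
by rewrite ltr_pdivrMr// ltr_pMr// ltr1n.
Qed.

Lemma regular_at_cst k x c : regular_at k x (fun=> c).
Proof.
case: k; last by apply/analytic_atP; exists 1, `|c|; split => //; exact: majorized_cst.
by apply/smooth_atP; exists setT; split=> // [|n]; [exact: openT|exact: Ck_cst openT _ _].
Qed.

Lemma regular_at_coord k x i : regular_at k x (fun y => y 0 i).
Proof.
case: k; last first.
  apply/analytic_atP; exists 1, (`|x 0 i| + 1); split => //.
  have := majorized_add ler01 (majorized_cst _ _ (x 0 i)) (majorized_coord 1 i).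
  by apply: majorized_eq => h _; rewrite mxE.
by apply/smooth_atP; exists setT; split=> // [|n]; [exact: openT|exact: Ck_coord openT _ _].
Qed.

Lemma smooth_at2 x f g : regular_at Smooth x f -> regular_at Smooth x g ->
  exists U, [/\ open U, U x, forall n, Ck n U f & forall n, Ck n U g].
Proof.
move=> /smooth_atP[U [oU Ux Uf]] /smooth_atP[V [oV Vx Vg]].
exists (U `&` V); split; [exact: openI|by []|move=> n|move=> n].
  by apply: CkS (Uf n) => y [].
by apply: CkS (Vg n) => y [].
Qed.

Lemma analytic_at2 x f g : regular_at Analytic x f -> regular_at Analytic x g ->
  exists s M M', [/\ 0 < s, majorized s (fun h => f (x + h)) M &
    majorized s (fun h => g (x + h)) M'].
Proof.
move=> /analytic_atP[s [M [s0 mf]]] /analytic_atP[s' [M' [s'0 mg]]].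
have m0 : 0 < Num.min s s' by rewrite lt_min s0.
exists (Num.min s s'), M, M'; split => //.
  by apply: majorized_shrink mf; rewrite ?ge_min ?lexx// ltW.
by apply: majorized_shrink mg; rewrite ?ge_min ?lexx ?orbT// ltW.
Qed.

Lemma regular_at_add k x f g : regular_at k x f -> regular_at k x g ->
  regular_at k x (fun y => f y + g y).
Proof.
case: k => xf xg.
  have [U [oU Ux Uf Ug]] := smooth_at2 xf xg; apply/smooth_atP; exists U; split => // n.
  exact: (Ck_add oU).
have [s [M [M' [s0 mf mg]]]] := analytic_at2 xf xg; apply/analytic_atP.
by exists s, (M + M'); split => //; apply: majorized_add => //; exact: ltW.
Qed.

Lemma regular_at_mul k x f g : regular_at k x f -> regular_at k x g ->
  regular_at k x (fun y => f y * g y).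
Proof.
case: k => xf xg.
  have [U [oU Ux Uf Ug]] := smooth_at2 xf xg; apply/smooth_atP; exists U; split => // n.
  exact: (Ck_mul oU).
have [s [M [M' [s0 mf mg]]]] := analytic_at2 xf xg; apply/analytic_atP.
by exists s, (M * M'); split => //; apply: majorized_mul => //; exact: ltW.
Qed.

Lemma regular_at_opp k x f : regular_at k x f -> regular_at k x (fun y => - f y).
Proof.
move=> xf; apply: regular_at_eq (regular_at_mul (regular_at_cst k x (-1)) xf).
by apply: near_all => y; rewrite mulN1r.
Qed.

Lemma regular_at_sub k x f g : regular_at k x f -> regular_at k x g ->
  regular_at k x (fun y => f y - g y).
Proof. by move=> xf xg; apply: regular_at_add => //; exact: regular_at_opp. Qed.

Lemma regular_at_sum k x (I : Type) (r : seq I) (P : pred I) (F : I -> 'rV[R]_N -> R) :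
  (forall i, P i -> regular_at k x (F i)) ->
  regular_at k x (fun y => \sum_(i <- r | P i) F i y).
Proof.
move=> CF; elim: r => [|i r IHr].
  by apply: regular_at_eq (regular_at_cst k x 0); apply: near_all => y; rewrite big_nil.
case: (boolP (P i)) => Pi.
  apply: regular_at_eq (regular_at_add (CF i Pi) IHr).
  by apply: near_all => y; rewrite big_cons Pi.
by apply: regular_at_eq IHr; apply: near_all => y; rewrite big_cons (negbTE Pi).
Qed.

(** The Hadamard quotients of f at y = 0 are its partial derivatives, which
    are thereby majorized as well. *)
Lemma analytic_differentiable (s : R) f M x : 0 < s ->
  majorized (4 * s) (fun h => f (x + h)) M ->
  exists q : 'I_N -> 'rV[R]_(N + N) -> R, (forall i, majorized s (q i) (M / s)) /\
   forall a, `|a| < s -> differentiable f (x + a) /\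
     forall i, partial i f (x + a) = q i (row_mx a 0).
Proof.
move=> s0 mf; have [q [qM qE]] := majorized_hadamard s0 mf.
exists q; split => // a sa.
have [||df dE] := @differentiable_of_quotients _ _ f (x + a) (fun i h => q i (row_mx a h)).
- apply: filterS (near0_norm_lt _ s0) => h hs.
  by rewrite -addrA qE// ltW.
- move=> i; apply: (continuous_comp_row (g := fun h => row_mx a h)) => [j|].
    case: (split_ordP j) => l ->.
      rewrite (_ : (fun _ => _) = cst (a 0 l)); first exact: cst_continuous.
      by apply/funext => h; rewrite row_mxEl.
    rewrite (_ : (fun _ => _) = (fun h : 'rV[R]_N => h 0 l)); first exact: coord_continuous.
    by apply/funext => h; rewrite row_mxEr.
  apply: majorized_continuous (qM i) _.
  have [t ta ts] : exists2 t, `|a| <= t & t < s by exists `|a|.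
  apply: le_lt_trans ts; apply: row_mx_norm_le => //.
  by rewrite normr0; apply: le_trans ta.
split => // i; rewrite /partial deriveE// dE /linform (bigD1 i)//= mxE !eqxx mul1r.
by rewrite big1 ?addr0// => j /negbTE ji; rewrite mxE eqxx/= ji mul0r.
Qed.

Lemma regular_at_differentiable k x f : regular_at k x f -> differentiable f x.
Proof.
case: k; first by move=> /smooth_atP[U [oU Ux Uf]]; exact: Ck_differentiable oU (Uf 1%N) Ux.
move=> /analytic_atP[s [M [s0 mf]]].
have s4 : 0 < s / 4 by rewrite divr_gt0.
have [|q [_ qP]] := @analytic_differentiable (s / 4) f M x s4; first by rewrite mulrC divfK.
by have := qP 0; rewrite normr0 addr0 => /(_ s4)[].
Qed.

Lemma regular_at_continuous k x f : regular_at k x f -> {for x, continuous f}.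
Proof. by move=> /regular_at_differentiable; exact: differentiable_continuous. Qed.

Lemma regular_at_partial k x i f : regular_at k x f -> regular_at k x (partial i f).
Proof.
case: k.
  move=> /smooth_atP[U [oU Ux Uf]]; apply/smooth_atP; exists U; split=> // n.
  exact: Ck_partial (Uf n.+1).
move=> /analytic_atP[s [M [s0 mf]]]; have s4 : 0 < s / 4 by rewrite divr_gt0.
have [|q [qM qP]] := @analytic_differentiable (s / 4) f M x s4; first by rewrite mulrC divfK.
apply/analytic_atP; exists (s / 4 / 2), (M / (s / 4)); split; first by rewrite divr_gt0.
have s42 : s / 4 / 2 < s / 4 by rewrite ltr_pdivrMr// ltr_pMr// ltr1n.
have s8 : 0 <= s / 4 / 2 by rewrite divr_ge0 ?ltW.
have m8 : majorized (s / 4 / 2) (fun h => q i (row_mx h 0)) (M / (s / 4)).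
  apply: (majorized_comp s8 (ltW s4) _ (qM i)) => j.
  case: (split_ordP j) => l ->.
    apply: majorizedW (ltW s42) _; apply: majorized_eq (majorized_coord _ l) => h _.
    by rewrite row_mxEl.
  by apply: majorized_eq (majorized0 _ _ (ltW s4)) => h _; rewrite row_mxEr mxE.
apply: majorized_eq m8 => h hs.
by rewrite (qP h (le_lt_trans hs s42)).2.
Qed.

End OneSpace.

(** In the analytic case the components of g minus their values at x are
    small enough, on a small ball, to be substituted into the expansion of
    f around the value of g. *)
Lemma regular_at_comp k N M (x : 'rV[R]_N) (g : 'rV[R]_N -> 'rV[R]_M) f :
  (forall j, regular_at k x (fun y => g y 0 j)) -> regular_at k (g x) f ->
  regular_at k x (f \o g).
Proof.
case: k => xg.
  move=> /smooth_atP[V [oV Vgx Vf]].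
  have cg : {for x, continuous g}.
    by apply: continuous_rowP => j; exact: regular_at_continuous (xg j).
  have H1 : \forall y \near x, V (g y) by apply: cg; exact: near_open.
  have H2 : \forall y \near x, forall j, regular_point Smooth y (fun y => g y 0 j).
    by apply: near_forall => j; exact/regular_atP.
  have [U [oU Ux UP]] := near_openP (filterI H1 H2).
  apply/smooth_atP; exists U; split => // n.
  apply: (Ck_comp oU oV) (Vf n) => [y /UP[]//|j].
  have : smooth_on U (fun y => g y 0 j).
    by move=> s y /UP[_ /(_ j) H]; exact: H.
  by move=> /smooth_onP; exact.
move=> /analytic_atP[s [M' [s0 mf]]].
have s2 : 0 < s / 2 by rewrite divr_gt0.
have /choice[r rP] : forall j, exists r, 0 < r /\
    majorized r (fun h => g (x + h) 0 j - g x 0 j) s.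
  move=> j; have /analytic_atP[t [B [t0 mg]]] := xg j.
  exact: (@majorized_small _ _ t (fun y => g y 0 j) B x s).
have [r0 [r00 r0r]] := finite_min (fun j => (rP j).1).
apply/analytic_atP; exists r0, M'; split => //.
have gm j : majorized r0 (fun h => (g (x + h) - g x) 0 j) s.
  apply: majorized_eq (majorized_shrink (ltW r00) (r0r j) (rP j).2) => h _.
  by rewrite !mxE.
apply: majorized_eq (majorized_comp (ltW r00) (ltW s0) gm mf) => h _ /=.
by rewrite subrKC.
Qed.

Lemma regular_at_hadamard k N (f : 'rV[R]_N -> R) : regular_at k 0 f ->
  exists q : 'I_N -> 'rV[R]_(N + N) -> R, (forall i, regular_at k 0 (q i)) /\
    \forall z \near (0 : 'rV[R]_(N + N)),
      f (lsubmx z + rsubmx z) = f (lsubmx z) + \sum_i rsubmx z 0 i * q i z.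
Proof.
case: k.
  move=> [U [oU U0 sf]]; have [V [oV V0 [q [qs qE]]]] := smooth_hadamard oU U0 sf.
  exists q; split=> [i|]; first by exists V.
  apply: filterS (near_open oV V0) => z; rewrite -{1}[z]hsubmxK => /qE ->.
  by rewrite hsubmxK.
move=> /analytic_atP[s [M [s0 mf]]]; have s4 : 0 < s / 4 by rewrite divr_gt0.
have {}mf : majorized (4 * (s / 4)) f M.
  rewrite mulrC divfK//; apply: majorized_eq mf => h _; by rewrite add0r.
have [q [qM qE]] := majorized_hadamard s4 mf; exists q; split=> [i|].
  apply/analytic_atP; exists (s / 4), (M / (s / 4)); split => //.
  by apply: majorized_eq (qM i) => h _; rewrite add0r.
apply: filterS (near0_norm_lt _ s4) => z zs.
by rewrite qE ?hsubmxK//; apply: le_trans (ltW zs);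
  [exact: lsubmx_norm_le|exact: rsubmx_norm_le].
Qed.

End RegularAt.

(** * Picard iteration for maps close to the identity *)

(** The steps of the iteration below shrink by the factor 1/2. *)
Lemma half_sum_le (R : realType) (c : R) n : 0 <= c ->
  \sum_(i < n) c * 2^-1 ^+ i <= 2 * c.
Proof.
move=> c0; rewrite -mulr_sumr mulrC; apply: ler_wpM2r => //.
suff -> : \sum_(i < n) 2^-1 ^+ i = 2 - 2 * 2^-1 ^+ n :> R.
  by rewrite gerBl mulr_ge0// exprn_ge0// invr_ge0.
elim: n => [|n IHn]; first by rewrite big_ord0 expr0; ring.
by rewrite big_ord_recr/= IHn exprS; field.
Qed.

Section Picard.
Variables (R : realType) (N : nat) (f : 'rV[R]_N -> 'rV[R]_N) (d : R).
Hypothesis f0 : f 0 = 0.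
Hypothesis f_near_id : forall a b, `|a| <= d -> `|b| <= d ->
  `|f b - f a - (b - a)| <= 2^-1 * `|b - a|.

(** The iteration for the equation f y = x, written as y = x + (y - f y);
    when f is close to the identity, the map on the right is a contraction. *)
Fixpoint picard n (x : 'rV[R]_N) : 'rV[R]_N :=
  if n is n'.+1 then x + (picard n' x - f (picard n' x)) else 0.

Definition picard_step n x := picard n.+1 x - picard n x.

Definition picard_limit x : 'rV[R]_N :=
  \row_j limn (fun n => \sum_(i < n) picard_step i x 0 j).

Lemma picard_sum n x j : picard n x 0 j = \sum_(i < n) picard_step i x 0 j.
Proof.
rewrite -(big_mkord xpredT (fun i => picard_step i x 0 j)).
rewrite (eq_bigr (fun i => picard i.+1 x 0 j - picard i x 0 j)); last first.
  by move=> i _; rewrite /picard_step mxE [X in _ + X]mxE.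
by rewrite (@telescope_sumr _ 0 n (fun i => picard i x 0 j))// mxE subr0.
Qed.

Lemma picard_stepE n x : picard_step n x = x - f (picard n x).
Proof.
rewrite /picard_step /=; set p := picard n x.
by apply/rowP => j; rewrite !mxE; ring.
Qed.

Lemma picard_stepS n x :
  picard_step n.+1 x = (picard n.+1 x - f (picard n.+1 x)) - (picard n x - f (picard n x)).
Proof. by rewrite {1}/picard_step /= opprD addrACA subrr add0r. Qed.

Lemma near_id0 a : `|a| <= d -> `|f a - a| <= 2^-1 * `|a|.
Proof.
move=> ad; have := @f_near_id 0 a; rewrite normr0 f0 !subr0; apply => //.
exact: le_trans (normr_ge0 a) ad.
Qed.

Variable x : 'rV[R]_N.
Hypothesis xd : `|x| <= d / 2.

Let x2d : 2 * `|x| <= d.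
Proof. by rewrite mulrC -ler_pdivlMr. Qed.

Lemma picard_bound n : `|picard n x| <= 2 * `|x|.
Proof.
elim: n => [|n IHn]; first by rewrite normr0 mulr_ge0.
apply: le_trans (ler_normD _ _) _; have := near_id0 (le_trans IHn x2d).
rewrite distrC => H; have : 2^-1 * `|picard n x| <= `|x|.
  by rewrite ler_pdivrMl.
by move: H; lra.
Qed.

Lemma picard_step_bound n : `|picard_step n x| <= `|x| * 2^-1 ^+ n.
Proof.
elim: n => [|n IHn]; first by rewrite picard_stepE/= f0 subr0 expr0 mulr1.
rewrite picard_stepS exprS mulrCA.
have -> : picard n.+1 x - f (picard n.+1 x) - (picard n x - f (picard n x)) =
  - (f (picard n.+1 x) - f (picard n x) - (picard n.+1 x - picard n x)).
  by apply/rowP => j; rewrite !mxE; ring.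
rewrite normrN; apply: le_trans (f_near_id _ _) _;
  try exact: le_trans (picard_bound _) x2d.
by rewrite ler_pM2l// invr_gt0.
Qed.

Lemma picard_cvg j : (fun n => picard n x 0 j) @ \oo --> picard_limit x 0 j.
Proof.
rewrite (_ : (fun n => _) = fun n => \sum_(i < n) picard_step i x 0 j); last first.
  by apply/funext => n; rewrite picard_sum.
have H : cvgn (fun n => \sum_(i < n) picard_step i x 0 j).
  apply: (@bounded_series_cvg _ (fun i => picard_step i x 0 j)
    (fun i => `|x| * 2^-1 ^+ i) (2 * `|x|)) => n; last exact: half_sum_le.
  exact: le_trans (coord_le_norm _ _) (picard_step_bound n).
by rewrite mxE; exact: H.
Qed.

Lemma picard_limit_bound : `|picard_limit x| <= 2 * `|x|.
Proof.
apply: row_norm_le => [|j]; first by rewrite mulr_ge0.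
have H : (fun n => `|picard n x 0 j|) @ \oo --> `|picard_limit x 0 j|.
  by apply: cvg_norm; exact: picard_cvg.
apply: (ler_cvg_to H (@cvg_cst _ (2 * `|x|) _ _ _)); apply: nearW => n.
exact: le_trans (coord_le_norm _ _) (picard_bound n).
Qed.

Lemma picard_limitK : f (picard_limit x) = x.
Proof.
apply/eqP; rewrite -subr_eq0 -normr_le0; apply/ler_addgt0Pr => e e0; rewrite add0r.
have e3 : 0 < e / 3 by rewrite divr_gt0.
have [n [n1 n2]] : exists n, `|picard_limit x - picard n x| <= e / 3 /\
    `|picard_step n x| <= e / 3.
  have H : forall j, \forall n \near \oo,
     `|picard_limit x 0 j - picard n x 0 j| <= e / 3 / 2.
    by move=> j; have /cvgrPdist_le := @picard_cvg j; apply; rewrite divr_gt0.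
  have {H}[n _ nP] := filter_forall _ H.
  have close k : (n <= k)%N -> `|picard_limit x - picard k x| <= e / 3 / 2.
    move=> nk; apply: row_norm_le => [|j]; first by rewrite !divr_ge0// ltW.
    by have := nP k nk j; rewrite !mxE.
  exists n; split.
    by apply: le_trans (close n _) _ => //; rewrite ler_pdivrMr// ler_pMr// ler1n.
  have -> : picard_step n x = (picard_limit x - picard n x) - (picard_limit x - picard n.+1 x).
    by rewrite opprB addrC addrA subrK.
  by rewrite [e / 3]splitr; apply: le_trans (ler_normB _ _) (lerD _ _); exact: close.
have := @f_near_id (picard n x) (picard_limit x).
move=> /(_ (le_trans (picard_bound n) x2d) (le_trans picard_limit_bound x2d)).
set u := picard_limit x in n1 *; set v := picard n x in n1 *; move=> H.
have -> : f u - x = (f u - f v - (u - v)) + (u - v) - picard_step n x.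
  by rewrite picard_stepE -/v; apply/rowP => j; rewrite !mxE; ring.
apply: le_trans (ler_normB _ _) _; apply: le_trans (lerD (ler_normD _ _) (lexx _)) _.
by move: H n1 n2; lra.
Qed.

End Picard.

Section NearIdentity.
Variables (R : realType) (N : nat).
Implicit Types (f : 'rV[R]_N -> 'rV[R]_N).

(** The same estimate that makes the iteration converge makes f injective
    and its inverse Lipschitz. *)
Lemma near_id_injective f d (a b : 'rV[R]_N) :
  (forall a b, `|a| <= d -> `|b| <= d ->
    `|f b - f a - (b - a)| <= 2^-1 * `|b - a|) ->
  `|a| <= d -> `|b| <= d -> `|b - a| <= 2 * `|f b - f a|.
Proof.
move=> fE ad bd; have := fE a b ad bd; rewrite [X in X <= _]distrC => H.
have := ler_normD (b - a - (f b - f a)) (f b - f a); rewrite subrK => H'.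
by move: H H'; lra.
Qed.

(** The quotients of the components of f, gathered in a matrix that is the
    identity at the origin because the Jacobian of f is; its distance from
    the identity measures how far f is from a translation. *)
Lemma hadamard_matrix k f : (forall j, regular_at k 0 (fun x => f x 0 j)) ->
  (forall i j, partial i (fun x => f x 0 j) 0 = (i == j)%:R) ->
  exists Q : 'rV[R]_(N + N) -> 'M[R]_N,
    [/\ forall i j, regular_at k 0 (fun z => Q z i j), Q 0 = 1%:M &
    \forall z \near (0 : 'rV[R]_(N + N)),
      f (lsubmx z + rsubmx z) = f (lsubmx z) + rsubmx z *m Q z].
Proof.
move=> fk fD; have /choice[q qP] := fun j => regular_at_hadamard (fk j).
exists (fun z => \matrix_(i, j) q j i z); split.
- move=> i j; apply: regular_at_eq ((qP j).1 i).
  by apply: near_all => z; rewrite mxE.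
- apply/matrixP => i j; rewrite !mxE -fD.
  have [||df dE] := @differentiable_of_quotients _ _ (fun x => f x 0 j) 0
     (fun i h => q j i (row_mx 0 h)).
  + have c0 : {for (0 : 'rV[R]_N), continuous (fun h => row_mx (0 : 'rV[R]_N) h)}.
      apply: continuous_rowP => l; case: (split_ordP l) => l' ->.
        rewrite (_ : (fun _ => _) = cst 0); first exact: cst_continuous.
        by apply/funext => h; rewrite row_mxEl mxE.
      rewrite (_ : (fun _ => _) = (fun h : 'rV[R]_N => h 0 l')); first exact: coord_continuous.
      by apply/funext => h; rewrite row_mxEr.
    have := near_comp c0 (@row_mx0 _ 1 N N) (qP j).2; apply: filterS => h.
    by rewrite row_mxKl row_mxKr.
  + move=> l; have := regular_at_continuous ((qP j).1 l).
    rewrite -{1}[0](@row_mx0 _ 1 N N); apply: continuous_comp_row => l'.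
    case: (split_ordP l') => l'' ->.
      rewrite (_ : (fun _ => _) = cst 0); first exact: cst_continuous.
      by apply/funext => h; rewrite row_mxEl mxE.
    rewrite (_ : (fun _ => _) = (fun h : 'rV[R]_N => h 0 l'')); first exact: coord_continuous.
    by apply/funext => h; rewrite row_mxEr.
  rewrite /partial deriveE// dE /linform (bigD1 i)//= mxE !eqxx mul1r row_mx0.
  by rewrite big1 ?addr0// => l /negbTE li; rewrite mxE eqxx/= li mul0r.
- have : \forall z \near (0 : 'rV[R]_(N + N)), forall j,
      f (lsubmx z + rsubmx z) 0 j =
      f (lsubmx z) 0 j + \sum_i rsubmx z 0 i * q j i z.
    by apply: near_forall => j; exact: (qP j).2.
  apply: filterS => z zP; apply/rowP => j; rewrite zP !mxE; congr (_ + _).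
  by apply: eq_bigr => i _; rewrite [X in _ = _ * X]mxE.
Qed.

(** Where the entries of the quotient matrix differ from those of the
    identity by at most 1 / (2 N + 2), f differs from a translation by at
    most half the displacement. *)
Lemma near_id_estimate f (Q : 'rV[R]_(N + N) -> 'M[R]_N) (r : R) : 0 < r ->
  (forall i j, {for 0, continuous (fun z => Q z i j)}) -> Q 0 = 1%:M ->
  (\forall z \near (0 : 'rV[R]_(N + N)),
      f (lsubmx z + rsubmx z) = f (lsubmx z) + rsubmx z *m Q z) ->
  exists d, [/\ 0 < d, d <= r & forall a b, `|a| <= d -> `|b| <= d ->
    `|f b - f a - (b - a)| <= 2^-1 * `|b - a|].
Proof.
move=> r0 cQ Q0 fQ; pose e : R := (2 * N.+1%:R)^-1.
have e0 : 0 < e by rewrite invr_gt0 mulr_gt0.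
have H : \forall z \near (0 : 'rV[R]_(N + N)), forall ij : 'I_N * 'I_N,
    `|(1%:M : 'M[R]_N) ij.1 ij.2 - Q z ij.1 ij.2| <= e.
  by apply: near_forall => -[i j]; have /continuous_epsP := cQ i j; rewrite Q0; exact.
have /near0P[d d0 dP] : \forall z \near (0 : 'rV[R]_(N + N)),
  (forall ij : 'I_N * 'I_N, `|(1%:M : 'M[R]_N) ij.1 ij.2 - Q z ij.1 ij.2| <= e) /\
  f (lsubmx z + rsubmx z) = f (lsubmx z) + rsubmx z *m Q z by exact: filterI.
exists (Num.min r (d / 3)); split.
- by rewrite lt_min r0 divr_gt0.
- by rewrite ge_min lexx.
move=> a b; rewrite !le_min => /andP[_ ad] /andP[_ bd].
have abd : `|row_mx a (b - a)| < d.
  apply: (@le_lt_trans _ _ (d / 3 + d / 3)).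
    apply: row_mx_norm_le; first by apply: le_trans ad _; rewrite lerDl divr_ge0// ltW.
    by apply: le_trans (ler_normB _ _) (lerD bd ad).
  by lra.
have [QP] := dP (row_mx a (b - a)) abd.
rewrite row_mxKl row_mxKr subrKC => ->.
set w := b - a in QP *; set A := Q _ in QP *.
have -> : f a + w *m A - f a - w = w *m (A - 1%:M).
  by rewrite mulmxBr mulmx1 [f a + _]addrC addrK.
apply: row_norm_le => [|j]; first by rewrite mulr_ge0// invr_ge0.
rewrite mxE; apply: le_trans (ler_norm_sum _ _ _) _.
apply: (@le_trans _ _ (\sum_(i < N) `|w| * e)).
  apply: ler_sum => i _; rewrite normrM; apply: ler_pM => //; first exact: coord_le_norm.
  by have := QP (i, j); rewrite !mxE distrC.
rewrite sumr_const card_ord -[leLHS]mulr_natr -mulrA mulrC ler_wpM2r//.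
by rewrite /e invfM -mulrA ler_piMr ?invr_ge0// mulrC ler_pdivrMr// mul1r ler_nat.
Qed.

End NearIdentity.

Section PicardRegularity.
Variables (R : realType) (N : nat) (f : 'rV[R]_N -> 'rV[R]_N).
Variable Q : 'rV[R]_(N + N) -> 'M[R]_N.
Hypothesis f0 : f 0 = 0.
Hypothesis Q0 : Q 0 = 1%:M.
Hypothesis fQ : \forall z \near (0 : 'rV[R]_(N + N)),
      f (lsubmx z + rsubmx z) = f (lsubmx z) + rsubmx z *m Q z.

(** The estimate of [picard_step_bound] holds for majorants and not only
    for norms, since the difference between the identity and the quotient
    matrix has a small majorant. Hence the steps form a majorized series. *)
Lemma analytic_picard_limit : (forall i j, regular_at Analytic 0 (fun z => Q z i j)) ->
  forall j, regular_at Analytic 0 (fun x => picard_limit f x 0 j).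
Proof.
move=> aQ; pose e : R := (2 * N.+1%:R)^-1.
have e0 : 0 < e by rewrite invr_gt0 mulr_gt0.
have /choice[r rP] : forall ij : 'I_N * 'I_N, exists r : R, 0 < r /\
    majorized r (fun z => (ij.1 == ij.2)%:R - Q z ij.1 ij.2) e.
  move=> -[i j].
  have /analytic_atP[t [B [t0 mQ]]] := regular_at_sub (regular_at_cst _ 0 (i == j)%:R) (aQ i j).
  have [r [r0 mr]] := @majorized_small _ _ _ (fun z => (i == j)%:R - Q z i j) _ 0 _ t0 mQ e0; exists r; split => //.
  apply: majorized_eq mr => z _; rewrite add0r Q0 !mxE.
  by case: (i == j); rewrite /= subrr subr0.
have [r0 [r00 r0r]] := finite_min (fun ij => (rP ij).1).
move/near0P: fQ => [d d0 dP].
pose t := Num.min r0 (d / 2); pose s := t / 2.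
have t0 : 0 < t by rewrite lt_min r00 divr_gt0.
have s0 : 0 < s by rewrite divr_gt0.
have td : t < d by rewrite gt_min orbC ltr_pdivrMr// ltr_pMr// ltr1n.
have st : 2 * s <= t by rewrite mulrC divfK.
have pt i j : majorized t (fun z => (i == j)%:R - Q z i j) e.
  apply: majorized_shrink (rP (i, j)).2; first exact: ltW.
  by apply: le_trans (r0r (i, j)); rewrite ge_min lexx.
have half0 n : 0 <= 2^-1 ^+ n :> R by rewrite exprn_ge0// invr_ge0.
have step_sum n : (forall i, (i < n)%N -> forall j,
      majorized s (fun x => picard_step f i x 0 j) (s * 2^-1 ^+ i)) ->
    forall j, majorized s (fun x => picard f n x 0 j) t.
  move=> H j; apply: majorizedW (le_trans (half_sum_le n (ltW s0)) st) _.
  have := @majorized_sum _ _ _ (ltW s0) 'I_n (index_enum 'I_n) xpredT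
    (fun i x => picard_step f i x 0 j) (fun i => s * 2^-1 ^+ i)
    (fun i => H i (ltn_ord i) j).
  by apply: majorized_eq => x _; rewrite picard_sum.
(* the majorants of the steps and of the iterates are bounded together: the
   bound on the next step needs the iterate to stay in the ball of radius t *)
have step_all n : forall i, (i <= n)%N -> forall j,
    majorized s (fun x => picard_step f i x 0 j) (s * 2^-1 ^+ i).
  elim: n => [|n IHn] i.
    rewrite leqn0 => /eqP -> j; rewrite expr0 mulr1.
    apply: majorized_eq (majorized_coord s j) => x _.
    by rewrite picard_stepE/= f0 subr0.
  rewrite leq_eqVlt ltnS => /predU1P[->{i} j|]; last exact: IHn.
  have mp := step_sum n (fun i lin => IHn i (ltnW lin)).
  have md := IHn n (leqnn n).
  have std : s * 2^-1 ^+ n <= t.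
    apply: le_trans st; rewrite mulrC ler_wpM2r//; first exact: ltW.
    by apply: (@le_trans _ _ 1); rewrite ?ler1n// exprn_ile1// ?invr_ge0// invf_le1// ler1n.
  have mz l : majorized s (fun x => row_mx (picard f n x) (picard_step f n x) 0 l) t.
    case: (split_ordP l) => l' ->.
      by apply: majorized_eq (mp l') => x _; rewrite row_mxEl.
    by apply: majorizedW std _; apply: majorized_eq (md l') => x _; rewrite row_mxEr.
  have := majorized_sum (ltW s0) (index_enum 'I_N) xpredT
    (fun i => majorized_mul (ltW s0) (md i) (majorized_comp (ltW s0) (ltW t0) mz (pt i j))).
  move=> H; apply: majorizedW (majorized_eq _ H).
    rewrite sumr_const card_ord -[leLHS]mulr_natr exprSr mulrA -[leLHS]mulrA.
    apply: ler_wpM2l; first by rewrite mulr_ge0// ltW.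
    rewrite /e invfM -mulrA ler_piMr ?invr_ge0// mulrC ler_pdivrMr// mul1r ler_nat.
    exact: leqnSn.
  move=> x xs.
  have zd : `|row_mx (picard f n x) (picard_step f n x)| < d.
    apply: le_lt_trans td; apply: row_norm_le => [|l]; first exact: ltW.
    exact: majorized_bound (mz l) xs.
  have := dP _ zd; rewrite row_mxKl row_mxKr => E.
  rewrite picard_stepS; have -> : picard f n.+1 x = picard f n x + picard_step f n x.
    by rewrite /picard_step subrKC.
  rewrite E; set p := picard f n x; set w := picard_step f n x; set A := Q _.
  have -> : p + w - (f p + w *m A) - (p - f p) = w *m (1%:M - A).
    by rewrite mulmxBr mulmx1; apply/rowP => l; rewrite !mxE; ring.
  by rewrite mxE; apply: eq_bigr => i _; rewrite /= !mxE.
move=> j; apply/analytic_atP; exists s, (2 * s); split => //.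
have := (majorized_limn (fun n => step_all n n (leqnn n) j) (fun n => half_sum_le n (ltW s0))).2.
by apply: majorized_eq => x _; rewrite add0r mxE.
Qed.

Variables (g : 'rV[R]_N -> 'rV[R]_N) (rho : R).
Hypothesis rho0 : 0 < rho.
Hypothesis g0 : g 0 = 0.
Hypothesis gK : forall x, `|x| < rho -> f (g x) = x.
Hypothesis g_lipschitz : forall x x', `|x| < rho -> `|x'| < rho ->
  `|g x' - g x| <= 2 * `|x' - x|.

(** The difference quotients of g are values of the inverse of the quotient
    matrix, so that the derivatives of g are the entries of that matrix at
    g x. This expresses the derivative through g itself and gains one order
    of differentiability each time. *)
Lemma smooth_right_inverse : (forall i j, regular_at Smooth 0 (fun z => Q z i j)) ->
  forall j, regular_at Smooth 0 (fun x => g x 0 j).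
Proof.
move=> sQ.
have cdet : {for 0, continuous (fun z => \det (Q z))}.
  apply: (@cvg_big _ _ _ _ _ _ _ (nbhs (0 : 'rV[R]_(N + N))) _ _ _ (nbhs_filter _)) => [|p _].
    exact: add_continuous.
  apply: cvgMl_tmp; apply: (@cvg_big _ _ _ _ _ _ _ (nbhs (0 : 'rV[R]_(N + N))) _ _ _ (nbhs_filter _)) => [|i _].
    exact: mul_continuous.
  exact: regular_at_continuous (sQ i (p i)).
have unitQ : \forall z \near (0 : 'rV[R]_(N + N)), Q z \in unitmx.
  have : \forall y \near \det (Q 0), y != 0.
    by rewrite Q0 det1; apply: open_nbhs_nbhs; split; [exact: open_neq|exact: oner_neq0].
  move=> /cdet H; apply: (@filterS _ _ (nbhs_filter _) _ _ _ H) => z.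
  by rewrite unitmxE unitfE.
have regQ : \forall z \near (0 : 'rV[R]_(N + N)), forall ij : 'I_N * 'I_N,
    regular_point Smooth z (fun z => Q z ij.1 ij.2).
  by apply: near_forall => -[i j]; have /regular_atP := sQ i j.
have /near0P[r r0 rP] : \forall z \near (0 : 'rV[R]_(N + N)), [/\ Q z \in unitmx,
    forall ij : 'I_N * 'I_N, regular_point Smooth z (fun z => Q z ij.1 ij.2) &
    f (lsubmx z + rsubmx z) = f (lsubmx z) + rsubmx z *m Q z].
  by apply: filterS3 unitQ regQ fQ.
pose V := [set z : 'rV[R]_(N + N) | `|z| < r].
have oV : open V.
  rewrite (_ : V = ball 0 r); first exact: ball_open.
  by apply/seteqP; split=> z; rewrite /V -ball_normE/= sub0r normrN.
pose I z := invmx (Q z).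
have CI n i j : Ck n V (fun z => I z i j).
  apply: (Ck_invmx oV) => [z /rP[]//|i' j'].
  suff /smooth_onP : smooth_on V (fun z => Q z i' j') by exact.
  by move=> l z /rP[_ /(_ (i', j')) H _]; exact: H.
have invQ z : V z -> rsubmx z = (f (lsubmx z + rsubmx z) - f (lsubmx z)) *m I z.
  by move=> /rP[uQ _ ->]; rewrite addrAC subrr add0r mulmxK.
pose rho' := Num.min rho (r / 2).
have rho'0 : 0 < rho' by rewrite lt_min rho0 divr_gt0.
pose O := [set x : 'rV[R]_N | `|x| < rho'].
have oO : open O.
  rewrite (_ : O = ball 0 rho'); first exact: ball_open.
  by apply/seteqP; split=> z; rewrite /O -ball_normE/= sub0r normrN.
have Orho x : O x -> `|x| < rho by rewrite /O/= lt_min => /andP[].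
have Og x : O x -> `|g x| < r.
  move=> Ox; have := g_lipschitz (x := 0) _ (Orho _ Ox); rewrite normr0 g0 !subr0.
  move=> /(_ rho0)/le_lt_trans; apply.
  by move: Ox; rewrite /O/= lt_min ltr_pdivlMr// mulrC => /andP[].
have cg x : O x -> {for x, continuous g}.
  move=> Ox; apply/continuous_epsP => e e0.
  have e2 : 0 < e / 2 by rewrite divr_gt0.
  have := near_norm_lt x e2; apply: filterS2 (near_open oO Ox) => y Oy.
  rewrite ltr_pdivlMr// mulrC => /ltW; apply: le_trans.
  by rewrite distrC; apply: g_lipschitz; exact: Orho.
have VO x : O x -> V (row_mx (g x) 0).
  move=> /Og H; rewrite /V/=; have [l gl lr] : exists2 l, `|g x| <= l & l < r by exists `|g x|.
  by apply: le_lt_trans lr; apply: row_mx_norm_le => //; rewrite normr0 (le_trans _ gl).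
have D x i j : O x -> is_derive x (delta_mx 0 i) (fun x => g x 0 j) (I (row_mx (g x) 0) i j).
  move=> Ox.
  suff H : h^-1 *: (g (h *: delta_mx 0 i + x) 0 j - g x 0 j) @[h --> 0^'] -->
      I (row_mx (g x) 0) i j.
    by apply: DeriveDef; [apply/cvg_ex; eexists; exact: H|exact/cvg_lim].
  apply/cvgrPdist_le => e e0.
  have ct : {for 0, continuous (fun w : 'rV[R]_N => I (row_mx (g x) w) i j)}.
    apply: (@continuous_comp_row _ _ _ (fun w => row_mx (g x) w) (fun z => I z i j)).
      move=> l; case: (split_ordP l) => l' ->.
        rewrite (_ : (fun _ => _) = cst (g x 0 l')); first exact: cst_continuous.
        by apply/funext => w; rewrite row_mxEl.
      rewrite (_ : (fun _ => _) = (fun w : 'rV[R]_N => w 0 l')); first exact: coord_continuous.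
      by apply/funext => w; rewrite row_mxEr.
    by apply: Ck_continuous (CI 0%N i j) _; exact: VO.
  have /near0P[b b0 bP] : \forall w \near (0 : 'rV[R]_N),
      `|I (row_mx (g x) 0) i j - I (row_mx (g x) w) i j| <= e.
    by move/continuous_epsP : ct; exact.
  have /near0P[c c0 cP] : \forall w \near (0 : 'rV[R]_N), O (x + w).
    exact: (near_shift0 x O).1 (near_open oO Ox).
  have edelta (h : R) : `|h *: (delta_mx 0 i : 'rV[R]_N)| <= `|h|.
    apply: row_norm_le => // l; rewrite !mxE eqxx/= normrM.
    by case: (l == i); rewrite ?normr1 ?mulr1// normr0 mulr0.
  near=> h.
  have h0 : h != 0 by near: h; exact: nbhs_dnbhs_neq.
  have hc : `|h| < c by near: h; exact: dnbhs0_lt.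
  have hb : `|h| < b / 2 by near: h; apply: dnbhs0_lt; rewrite divr_gt0.
  have hr : `|h| < r / 2 by near: h; apply: dnbhs0_lt; rewrite divr_gt0.
  set x' := _ + x; have Ox' : O x'.
    by rewrite /x' addrC; apply: cP; exact: le_lt_trans (edelta h) hc.
  have gxx : `|g x' - g x| <= 2 * `|h|.
    apply: le_trans (g_lipschitz (Orho _ Ox) (Orho _ Ox')) _.
    by rewrite /x' addrK ler_wpM2l.
  have Vz : V (row_mx (g x) (g x' - g x)).
    have [l gl lr] : exists2 l, `|g x| <= l & l < r by exists `|g x| => //; exact: Og.
    rewrite /V/=; apply: (@le_lt_trans _ _ (Num.max l (2 * `|h|))).
      by apply: row_mx_norm_le; rewrite le_max ?gl// gxx orbT.
    by rewrite gt_max lr/=; move: hr; rewrite ltr_pdivlMr// mulrC.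
  have := invQ _ Vz; rewrite row_mxKl row_mxKr subrKC !gK ?Orho//.
  set A := I (row_mx _ (g x' - g x)); rewrite {1}/x' addrK => E.
  have -> : g x' 0 j - g x 0 j = h * A i j.
    have -> : g x' 0 j - g x 0 j = (g x' - g x) 0 j by rewrite !mxE.
    rewrite E -scalemxAl mxE; congr (_ * _).
    by rewrite -rowE mxE.
  rewrite [_ *: _]mulrA mulVf// mul1r; apply: bP.
  by apply: le_lt_trans gxx _; move: hb; rewrite ltr_pdivlMr// mulrC.
have Cg n : forall j, Ck n O (fun x => g x 0 j).
  elim: n => [|n IHn] j; (split=> [x Ox|]; first by
    apply: (@continuous_comp _ _ _ g (fun v : 'rV[R]_N => v 0 j)); [exact: cg|exact: coord_continuous]) => //.
  split=> [x Ox i|i]; first by have [] := D x i j Ox.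
  have H : Ck n O ((fun z => I z i j) \o (fun x => row_mx (g x) 0)).
    apply: (Ck_comp oO oV) (CI n i j) => [x /VO//|l].
    case: (split_ordP l) => l' ->.
      by apply: (Ck_eq oO) (IHn l') => x _; rewrite row_mxEl.
    by apply: (Ck_eq oO) (Ck_cst oO n 0) => x _; rewrite row_mxEr mxE.
  apply: (Ck_eq oO) H => x /set_mem Ox /=.
  by have [_ <-] := D x i j Ox.
move=> j; apply/smooth_atP; exists O; split => //.
by rewrite /O/= normr0.
Unshelve. all: by end_near. Qed.

End PicardRegularity.

(** * The inverse and implicit function theorems *)

Section RegularMaps.
Variables (R : realType) (k : category).

Definition regular_map_at N M (x : 'rV[R]_N) (f : 'rV[R]_N -> 'rV[R]_M) : Prop :=
  forall j, regular_at k x (fun y => f y 0 j).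

Lemma regular_map_eq N M x (f g : 'rV[R]_N -> 'rV[R]_M) :
  (\forall y \near x, f y = g y) -> regular_map_at x f -> regular_map_at x g.
Proof.
move=> fg xf j; apply: regular_at_eq (xf j).
by apply: filterS fg => y ->.
Qed.

Lemma regular_map_comp N M P x (g : 'rV[R]_N -> 'rV[R]_M) (f : 'rV[R]_M -> 'rV[R]_P) :
  regular_map_at x g -> regular_map_at (g x) f -> regular_map_at x (f \o g).
Proof. by move=> xg xf j; exact: (regular_at_comp xg (xf j)). Qed.

Lemma regular_map_continuous N M x (f : 'rV[R]_N -> 'rV[R]_M) :
  regular_map_at x f -> {for x, continuous f}.
Proof. by move=> xf; apply: continuous_rowP => j; exact: regular_at_continuous (xf j). Qed.

Lemma regular_map_differentiable N M x (f : 'rV[R]_N -> 'rV[R]_M) :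
  regular_map_at x f -> differentiable f x.
Proof. by move=> xf; apply: differentiable_rowP => j; exact: regular_at_differentiable (xf j). Qed.

Lemma regular_map_near N M x (f : 'rV[R]_N -> 'rV[R]_M) :
  regular_map_at x f -> \forall y \near x, regular_map_at y f.
Proof. by move=> xf; apply: near_forall => j; exact: regular_at_near (xf j). Qed.

Lemma regular_map_id N (x : 'rV[R]_N) : regular_map_at x id.
Proof. by move=> j; exact: regular_at_coord. Qed.

Lemma regular_map_cst N M (x : 'rV[R]_N) (c : 'rV[R]_M) : regular_map_at x (fun=> c).
Proof. by move=> j; exact: regular_at_cst. Qed.

Lemma regular_map_add N M x (f g : 'rV[R]_N -> 'rV[R]_M) :
  regular_map_at x f -> regular_map_at x g -> regular_map_at x (fun y => f y + g y).
Proof.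
move=> xf xg j; apply: regular_at_eq (regular_at_add (xf j) (xg j)).
by apply: near_all => y; rewrite mxE.
Qed.

Lemma regular_map_opp N M x (f : 'rV[R]_N -> 'rV[R]_M) :
  regular_map_at x f -> regular_map_at x (fun y => - f y).
Proof.
move=> xf j; apply: regular_at_eq (regular_at_opp (xf j)).
by apply: near_all => y; rewrite mxE.
Qed.

Lemma regular_map_sub N M x (f g : 'rV[R]_N -> 'rV[R]_M) :
  regular_map_at x f -> regular_map_at x g -> regular_map_at x (fun y => f y - g y).
Proof. by move=> xf xg; apply: regular_map_add => //; exact: regular_map_opp. Qed.

Lemma regular_map_mulmx N M P x (f : 'rV[R]_N -> 'rV[R]_M)
    (A : 'rV[R]_N -> 'M[R]_(M, P)) :
  regular_map_at x f -> (forall i j, regular_at k x (fun y => A y i j)) ->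
  regular_map_at x (fun y => f y *m A y).
Proof.
move=> xf xA j; apply: (@regular_at_eq _ _ _ _ (fun y => \sum_i f y 0 i * A y i j)).
  by apply: near_all => y; rewrite mxE.
by apply: regular_at_sum => i _; exact: regular_at_mul.
Qed.

Lemma regular_map_mulmxl N M P x (f : 'rV[R]_N -> 'rV[R]_M) (A : 'M[R]_(M, P)) :
  regular_map_at x f -> regular_map_at x (fun y => f y *m A).
Proof. by move=> xf; apply: regular_map_mulmx => // i j; exact: regular_at_cst. Qed.

Lemma regular_map_row_mx N M P x (f : 'rV[R]_N -> 'rV[R]_M) (g : 'rV[R]_N -> 'rV[R]_P) :
  regular_map_at x f -> regular_map_at x g -> regular_map_at x (fun y => row_mx (f y) (g y)).
Proof.
move=> xf xg j; case: (split_ordP j) => l ->.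
  by apply: regular_at_eq (xf l); apply: near_all => y; rewrite row_mxEl.
by apply: regular_at_eq (xg l); apply: near_all => y; rewrite row_mxEr.
Qed.

Lemma regular_map_lsubmx N M P x (f : 'rV[R]_N -> 'rV[R]_(M + P)) :
  regular_map_at x f -> regular_map_at x (fun y => lsubmx (f y)).
Proof.
by move=> xf j; apply: regular_at_eq (xf (lshift P j)); apply: near_all => y; rewrite mxE.
Qed.

Lemma regular_map_rsubmx N M P x (f : 'rV[R]_N -> 'rV[R]_(M + P)) :
  regular_map_at x f -> regular_map_at x (fun y => rsubmx (f y)).
Proof.
by move=> xf j; apply: regular_at_eq (xf (rshift M j)); apply: near_all => y; rewrite mxE.
Qed.

(** The transpose of the usual Jacobian matrix: rows are indexed by the
    variables, as vectors act from the left, and so the chain rule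
    multiplies in the order of composition. *)
Definition gradient_mx N M (f : 'rV[R]_N -> 'rV[R]_M) x : 'M[R]_(N, M) :=
  \matrix_(i, j) partial i (fun y => f y 0 j) x.

Lemma gradient_mx_comp N M P x (g : 'rV[R]_N -> 'rV[R]_M) (f : 'rV[R]_M -> 'rV[R]_P) :
  regular_map_at x g -> regular_map_at (g x) f ->
  gradient_mx (f \o g) x = gradient_mx g x *m gradient_mx f (g x).
Proof.
move=> xg xf; apply/matrixP => i j; rewrite !mxE.
rewrite (@partial_comp _ _ _ (fun z => f z 0 j) g).
- by apply: eq_bigr => l _; rewrite !mxE.
- by move=> l; exact: regular_at_differentiable (xg l).
- exact: regular_at_differentiable (xf j).
Qed.

Lemma partial_linform N (c : 'I_N -> R) i x : partial i (linform c) x = c i.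
Proof.
have [df dE] : differentiable (linform c) x /\ 'd (linform c) x = linform c :> (_ -> _).
  apply: differentiable_of_expansion => e e0; apply: near_all => h.
  by rewrite linearD/= [linform c x + _]addrC addrK subrr normr0 mulr_ge0// ltW.
rewrite /partial deriveE// dE /linform (bigD1 i)//= mxE !eqxx mul1r.
by rewrite big1 ?addr0// => j /negbTE ji; rewrite mxE eqxx/= ji mul0r.
Qed.

Lemma gradient_mx_mulmx N M (A : 'M[R]_(N, M)) x : gradient_mx (mulmxr A) x = A.
Proof.
apply/matrixP => i j; rewrite mxE -[RHS](partial_linform (A^~ j) i x).
by congr partial; apply/funext => y; rewrite /= mxE.
Qed.

Lemma gradient_mx_eq N M x (f g : 'rV[R]_N -> 'rV[R]_M) : (\forall y \near x, f y = g y) ->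
  gradient_mx f x = gradient_mx g x.
Proof.
move=> fg; apply/matrixP => i j; rewrite !mxE; apply: partial_eq_near.
by apply: filterS fg => y ->.
Qed.

Lemma gradient_mx_id N (x : 'rV[R]_N) : gradient_mx id x = 1%:M.
Proof.
rewrite -[RHS](gradient_mx_mulmx _ x); apply: gradient_mx_eq.
by apply: near_all => y; rewrite /= mulmx1.
Qed.

Lemma regular_map_mulmxr N M x (A : 'M[R]_(N, M)) : regular_map_at x (mulmxr A).
Proof. by apply: (@regular_map_mulmxl _ _ _ x id); exact: regular_map_id. Qed.

(** After composition with the inverse Jacobian the map is close to the
    identity, where the Picard limit is a regular right inverse; it is a
    two-sided inverse since the map is injective near the origin. *)
Lemma inverse_function N (f : 'rV[R]_N -> 'rV[R]_N) : f 0 = 0 -> regular_map_at 0 f ->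
  gradient_mx f 0 \in unitmx -> diffeo_germ k f.
Proof.
move=> f0 rf uJ; set J := gradient_mx f 0 in uJ.
pose f' := mulmxr (invmx J) \o f.
have f'0 : f' 0 = 0 by rewrite /f'/= f0 mul0mx.
have rf' : regular_map_at 0 f' by apply: regular_map_comp => //; exact: regular_map_mulmxr.
have f'D i j : partial i (fun x => f' x 0 j) 0 = (i == j)%:R.
  have : gradient_mx f' 0 = 1%:M.
    rewrite gradient_mx_comp// ?gradient_mx_mulmx ?mulmxV//.
    by rewrite f0; exact: regular_map_mulmxr.
  by move=> /matrixP/(_ i j); rewrite !mxE.
have [Q [rQ Q0 fQ]] := hadamard_matrix rf' f'D.
have cQ i j : {for 0, continuous (fun z => Q z i j)} := regular_at_continuous (rQ i j).
have [d [d0 _ dE]] := near_id_estimate ltr01 cQ Q0 fQ.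
have d2 : 0 < d / 2 by rewrite divr_gt0.
pose g' := picard_limit f'.
have g'd x : `|x| <= d / 2 -> `|g' x| <= d.
  move=> xd; apply: le_trans (picard_limit_bound f'0 dE xd) _.
  by rewrite mulrC -ler_pdivlMr.
have g'K x : `|x| <= d / 2 -> f' (g' x) = x by move=> xd; exact: (picard_limitK f'0 dE).
have inj a b : `|a| <= d -> `|b| <= d -> f' a = f' b -> a = b.
  move=> ad bd fab; have := near_id_injective dE ad bd.
  by rewrite fab subrr normr0 mulr0 normr_le0 subr_eq0 => /eqP.
have g'0 : g' 0 = 0.
  by apply: inj; rewrite ?g'd ?normr0 ?g'K ?normr0 ?f'0// ltW.
have rg' : regular_map_at 0 g'.
  move: rQ; rewrite /regular_map_at; case: (k) => rQ j; last first.
    exact: analytic_picard_limit fQ rQ j.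
  apply: (smooth_right_inverse Q0 fQ d2 g'0) => // [x xd|x x' xd xd'].
    by apply: g'K; exact: ltW.
  have := near_id_injective dE (g'd _ (ltW xd)) (g'd _ (ltW xd')).
  by rewrite !g'K// ltW.
have rJ : regular_map_at 0 (mulmxr (invmx J)) by exact: regular_map_mulmxr.
split => //; exists (g' \o mulmxr (invmx J)); split.
- by rewrite /= mul0mx.
- by apply: regular_map_comp => //=; rewrite mul0mx.
- have H1 : \forall x \near (0 : 'rV[R]_N), `|x| < d by exact: near0_norm_lt.
  have H2 : \forall x \near (0 : 'rV[R]_N), `|f' x| < d / 2.
    exact: near_comp (regular_map_continuous rf') f'0 (near0_norm_lt N d2).
  apply: filterS2 H1 H2 => x xd fxd; apply: inj; last by rewrite g'K// ltW.
    by apply: g'd; exact: ltW.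
  exact: ltW.
- have : \forall y \near (0 : 'rV[R]_N), `|mulmxr (invmx J) y| < d / 2.
    apply: near_comp (regular_map_continuous rJ) _ (near0_norm_lt _ d2).
    by rewrite /= mul0mx.
  apply: filterS => y yd /=.
  have := g'K _ (ltW yd); rewrite /f' /= => /(congr1 (mulmxr J)) /=.
  by rewrite !mulmxKV.
Qed.

(** The inverse function theorem for the map that keeps the first block of
    variables and replaces the second by E. *)
Lemma implicit_function p q (E : 'rV[R]_(p + q) -> 'rV[R]_q) : E 0 = 0 ->
  regular_map_at 0 E -> dsubmx (gradient_mx E 0) \in unitmx ->
  exists Y : 'rV[R]_p -> 'rV[R]_q, [/\ Y 0 = 0, regular_map_at 0 Y &
    \forall z \near (0 : 'rV[R]_(p + q)), E z = 0 <-> rsubmx z = Y (lsubmx z)].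
Proof.
move=> E0 rE uE; pose f (z : 'rV[R]_(p + q)) := row_mx (lsubmx z) (E z).
have f0 : f 0 = 0 by rewrite /f E0 lsubmx_const row_mx_const.
have rf : regular_map_at 0 f.
  by apply: regular_map_row_mx => //; apply: regular_map_lsubmx; exact: regular_map_id.
have fD : gradient_mx f 0 = block_mx 1%:M (usubmx (gradient_mx E 0)) 0 (dsubmx (gradient_mx E 0)).
  apply/matrixP => i j; rewrite mxE; case: (split_ordP j) => l ->.
    have -> : (fun z => f z 0 (lshift q l)) = (fun z => z 0 (lshift q l)).
      by apply/funext => z; rewrite row_mxEl mxE.
    have /matrixP/(_ i (lshift q l)) := gradient_mx_id (0 : 'rV[R]_(p + q)).
    rewrite mxE => ->.
    case: (split_ordP i) => l' ->; rewrite ?block_mxEul ?block_mxEdl !mxE.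
      by rewrite (inj_eq (@lshift_inj _ _)).
    by rewrite eq_sym eq_lrshift.
  have -> : (fun z => f z 0 (rshift p l)) = (fun z => E z 0 l).
    by apply/funext => z; rewrite row_mxEr.
  by case: (split_ordP i) => l' ->; rewrite ?block_mxEur ?block_mxEdr !mxE.
have [|_ _ [g [g0 rg gf fg]]] := inverse_function f0 rf.
  by rewrite fD unitmxE det_ublock det1 mul1r -unitmxE.
pose inl (x : 'rV[R]_p) := row_mx x (0 : 'rV[R]_q).
have inl0 : inl 0 = 0 by rewrite /inl row_mx0.
have rinl (x : 'rV[R]_p) : regular_map_at x inl.
  by apply: regular_map_row_mx; [exact: regular_map_id|exact: regular_map_cst].
exists (fun x => rsubmx (g (inl x))); split.
- by rewrite inl0 g0 rsubmx_const.
- apply: (regular_map_rsubmx (f := g \o inl)); apply: regular_map_comp => //.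
  by rewrite inl0.
have H1 : \forall z \near (0 : 'rV[R]_(p + q)), f (g (inl (lsubmx z))) = inl (lsubmx z).
  apply: (near_comp (g := fun z => inl (lsubmx z))) fg; last by rewrite lsubmx_const.
  apply: (regular_map_continuous (f := inl \o lsubmx)); apply: regular_map_comp => //.
  by apply: (regular_map_lsubmx (f := id)); exact: regular_map_id.
apply: filterS2 gf H1 => z gfz fgz; split=> [Ez|zY].
  by rewrite -{1}gfz /f Ez.
move: (fgz); rewrite {1}/f => /eq_row_mx[lg].
by rewrite -{1}[g _]hsubmxK lg -zY hsubmxK.
Qed.

End RegularMaps.

(** * Second derivatives and second order expansions *)

Section PartialRules.
Variables (R : realType) (N : nat).
Implicit Types (f g : 'rV[R]_N -> R) (x : 'rV[R]_N).

Lemma near_sub x (P Q : 'rV[R]_N -> Prop) : (forall y, P y -> Q y) ->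
  (\forall y \near x, P y) -> \forall y \near x, Q y.
Proof. by move=> PQ; exact: filterS. Qed.

Lemma near_and x (P Q : 'rV[R]_N -> Prop) : (\forall y \near x, P y) ->
  (\forall y \near x, Q y) -> \forall y \near x, P y /\ Q y.
Proof. exact: filterI. Qed.

Lemma partial_cst i (c : R) x : partial i (fun=> c) x = 0.
Proof. by rewrite /partial (derive_cst c). Qed.

Lemma partialD i f g x : differentiable f x -> differentiable g x ->
  partial i (fun y => f y + g y) x = partial i f x + partial i g x.
Proof. by move=> df dg; rewrite /partial deriveD//; exact: diff_derivable. Qed.

Lemma partialB i f g x : differentiable f x -> differentiable g x ->
  partial i (fun y => f y - g y) x = partial i f x - partial i g x.
Proof. by move=> df dg; rewrite /partial deriveB//; exact: diff_derivable. Qed.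

Lemma partialN i f x : differentiable f x -> partial i (fun y => - f y) x = - partial i f x.
Proof. by move=> df; rewrite /partial deriveN//; exact: diff_derivable. Qed.

Lemma partialM i f g x : differentiable f x -> differentiable g x ->
  partial i (fun y => f y * g y) x = partial i f x * g x + f x * partial i g x.
Proof.
move=> df dg; rewrite /partial deriveM; [|exact: diff_derivable..].
by rewrite addrC [g x *: _]mulrC.
Qed.

Lemma differentiable_bigsum (I : Type) (r : seq I) (F : I -> 'rV[R]_N -> R) x :
  (forall i, differentiable (F i) x) -> differentiable (fun y => \sum_(i <- r) F i y) x.
Proof.
move=> dF; elim: r => [|j r IHr].
  by under eq_fun do rewrite big_nil; exact: differentiable_cst.
by under eq_fun do rewrite big_cons; exact: differentiableD.
Qed.

Lemma partial_sum (I : Type) (r : seq I) i (F : I -> 'rV[R]_N -> R) x :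
  (forall j, differentiable (F j) x) ->
  partial i (fun y => \sum_(j <- r) F j y) x = \sum_(j <- r) partial i (F j) x.
Proof.
move=> dF; elim: r => [|j r IHr].
  by under eq_fun do rewrite big_nil; rewrite partial_cst big_nil.
under eq_fun do rewrite big_cons.
by rewrite partialD ?big_cons ?IHr//; exact: differentiable_bigsum.
Qed.

Lemma partial_coord i j x : partial i (fun y => y 0 j) x = (i == j)%:R.
Proof. by have /matrixP/(_ i j) := gradient_mx_id x; rewrite !mxE. Qed.

Lemma diff_gradient M (f : 'rV[R]_N -> 'rV[R]_M) x v : differentiable f x ->
  'd f x v = v *m gradient_mx f x.
Proof.
move=> df; apply/rowP => j; rewrite diff_row_coord// diff_linformE.
  by rewrite mxE; apply: eq_bigr => i _; rewrite mxE.
exact: differentiable_row_coord.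
Qed.

(** Mean value theorem on the segment from the origin. *)
Lemma partial_zero_const f (d : R) x : (forall y, `|y| < d -> differentiable f y) ->
  (forall y i, `|y| < d -> partial i f y = 0) -> `|x| < d -> f x = f 0.
Proof.
move=> df Df xd.
have seg (t : R) : `|t| <= 1 -> `|t *: x| < d.
  by move=> t1; rewrite normrZ; apply: le_lt_trans xd; rewrite ler_piMl.
have [|c c1] := @MVT_line _ _ f 0 x 1.
  by move=> t; rewrite normr1 add0r => /seg/df; exact: diff_derivable.
rewrite normr1 in c1; rewrite scale1r !add0r mul1r.
rewrite deriveE; last exact/df/seg.
rewrite diff_linformE; last exact/df/seg.
rewrite /linform big1 => [/eqP|i _]; first by rewrite subr_eq0 => /eqP.
by rewrite Df ?mulr0//; exact: seg.
Qed.

End PartialRules.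

Section ProductSpace.
Variables (R : realType) (k : category).

(** A derivative depends only on the restriction of the function to a line,
    which lets one change the ambient space. *)
Lemma derive_ext_along (V W : normedModType R) (f : V -> R) (g : W -> R) v w x y :
  (forall t : R, f (t *: v + x) = g (t *: w + y)) -> 'D_v f x = 'D_w g y.
Proof.
move=> fg; rewrite /derive.
suff -> : (fun h : R => h^-1 *: ((f \o shift x) (h *: v) - f x)) =
          (fun h => h^-1 *: ((g \o shift y) (h *: w) - g y)) by [].
apply/funext => t; rewrite /= fg.
by have := fg 0; rewrite !scale0r !add0r => ->.
Qed.

Lemma row_delta_lshift n m (i : 'I_n) :
  delta_mx 0 (lshift m i) = row_mx (delta_mx 0 i) 0 :> 'rV[R]_(n + m).
Proof.
apply/rowP => j; case: (split_ordP j) => l ->.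
  by rewrite row_mxEl !mxE (inj_eq (@lshift_inj _ _)).
by rewrite row_mxEr !mxE eq_rlshift.
Qed.

Lemma row_delta_rshift n m (i : 'I_m) :
  delta_mx 0 (rshift n i) = row_mx 0 (delta_mx 0 i) :> 'rV[R]_(n + m).
Proof.
apply/rowP => j; case: (split_ordP j) => l ->.
  by rewrite row_mxEl !mxE eq_lrshift.
by rewrite row_mxEr !mxE (inj_eq (@rshift_inj _ _)).
Qed.

Lemma partial_lsubmx_l n m (f : 'rV[R]_n -> R) i (x : 'rV[R]_(n + m)) :
  partial (lshift m i) (fun y => f (lsubmx y)) x = partial i f (lsubmx x).
Proof.
apply: derive_ext_along => t; rewrite row_delta_lshift.
by rewrite linearP/= row_mxKl.
Qed.

Lemma partial_lsubmx_r n m (f : 'rV[R]_n -> R) i (x : 'rV[R]_(n + m)) :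
  partial (rshift n i) (fun y => f (lsubmx y)) x = 0.
Proof.
rewrite -[RHS](partial_cst i (f (lsubmx x)) (rsubmx x)).
apply: derive_ext_along => t; rewrite row_delta_rshift.
by rewrite linearP/= row_mxKl scaler0 add0r.
Qed.

Lemma partial_rsubmx_r n m (f : 'rV[R]_m -> R) i (x : 'rV[R]_(n + m)) :
  partial (rshift n i) (fun y => f (rsubmx y)) x = partial i f (rsubmx x).
Proof.
apply: derive_ext_along => t; rewrite row_delta_rshift.
by rewrite linearP/= row_mxKr.
Qed.

Lemma partial_rsubmx_l n m (f : 'rV[R]_m -> R) i (x : 'rV[R]_(n + m)) :
  partial (lshift m i) (fun y => f (rsubmx y)) x = 0.
Proof.
rewrite -[RHS](partial_cst i (f (rsubmx x)) (lsubmx x)).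
apply: derive_ext_along => t; rewrite row_delta_lshift.
by rewrite linearP/= row_mxKr scaler0 add0r.
Qed.

Lemma partial_row_mx_l n m (f : 'rV[R]_(n + m) -> R) i (x : 'rV[R]_n) y :
  partial i (fun x => f (row_mx x y)) x = partial (lshift m i) f (row_mx x y).
Proof.
apply: derive_ext_along => t; rewrite row_delta_lshift.
by rewrite scale_row_mx add_row_mx scaler0 add0r.
Qed.

Lemma partial_row_mx_r n m (f : 'rV[R]_(n + m) -> R) i (x : 'rV[R]_n) y :
  partial i (fun y => f (row_mx x y)) y = partial (rshift n i) f (row_mx x y).
Proof.
apply: derive_ext_along => t; rewrite row_delta_rshift.
by rewrite scale_row_mx add_row_mx scaler0 add0r.
Qed.

Lemma regular_lsubmx n m (x : 'rV[R]_(n + m)) : regular_map_at k x lsubmx.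
Proof. by apply: (regular_map_lsubmx (f := id)); exact: regular_map_id. Qed.

Lemma regular_rsubmx n m (x : 'rV[R]_(n + m)) : regular_map_at k x rsubmx.
Proof. by apply: (regular_map_rsubmx (f := id)); exact: regular_map_id. Qed.

Lemma near_regular N M (g : 'rV[R]_N -> 'rV[R]_M) x y (P : 'rV[R]_M -> Prop) :
  regular_map_at k x g -> g x = y -> (\forall z \near y, P z) ->
  \forall z \near x, P (g z).
Proof. by move=> rg; apply: near_comp; exact: regular_map_continuous rg. Qed.

Lemma near_near N (P : 'rV[R]_N -> Prop) (x : 'rV[R]_N) : (\forall y \near x, P y) ->
  \forall y \near x, \forall z \near (y : 'rV[R]_N), P z.
Proof. exact: near_join. Qed.

Lemma regular_shift N (x y : 'rV[R]_N) : regular_map_at k y (fun h => x + h).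
Proof. by apply: regular_map_add; [exact: regular_map_cst|exact: regular_map_id]. Qed.

Lemma regular_at_expansion N (f : 'rV[R]_N -> R) x : regular_at k x f ->
  exists a : 'I_N -> 'rV[R]_N -> R, (forall i, regular_at k 0 (a i)) /\
    \forall y \near (0 : 'rV[R]_N), f (x + y) = f x + \sum_i y 0 i * a i y.
Proof.
move=> rf; have rfx : regular_at k 0 (f \o (fun h => x + h)).
  by apply: regular_at_comp; [exact: regular_shift|rewrite addr0].
have [q [rq qE]] := regular_at_hadamard rfx.
have r0 : regular_map_at k (0 : 'rV[R]_N) (fun y => row_mx (0 : 'rV[R]_N) y).
  by apply: regular_map_row_mx; [exact: regular_map_cst|exact: regular_map_id].
exists (fun i y => q i (row_mx 0 y)); split=> [i|].
  by apply: (regular_at_comp (f := q i) r0); rewrite row_mx0.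
have := near_regular r0 (row_mx0 _ _ _ _) qE; apply: filterS => y /=.
by rewrite row_mxKl row_mxKr add0r addr0.
Qed.

Lemma partial_expansion N (a : 'I_N -> 'rV[R]_N -> R) l y :
  (forall i, regular_at k y (a i)) ->
  partial l (fun y => \sum_i y 0 i * a i y) y =
  a l y + \sum_i y 0 i * partial l (a i) y.
Proof.
move=> ra; rewrite partial_sum => [|i]; last first.
  apply: differentiableM; first exact: regular_at_differentiable (regular_at_coord k _ _).
  exact: regular_at_differentiable (ra i).
rewrite (eq_bigr (fun i => (l == i)%:R * a i y + y 0 i * partial l (a i) y)); last first.
  move=> i _; rewrite partialM ?partial_coord//.
    exact: regular_at_differentiable (regular_at_coord k _ _).
  exact: regular_at_differentiable (ra i).
rewrite big_split/=; congr (_ + _); rewrite (bigD1 l)//= eqxx mul1r.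
by rewrite big1 ?addr0// => i; rewrite eq_sym => /negbTE ->; rewrite mul0r.
Qed.

Lemma partial_shift N (f : 'rV[R]_N -> R) x i y :
  partial i (fun h => f (x + h)) y = partial i f (x + y).
Proof. by apply: derive_ext_along => t; rewrite addrCA. Qed.

(** Expand f twice by Hadamard's lemma: at the point itself a mixed second
    derivative is the sum of two first derivatives of quotients, a sum that
    is symmetric in the two indices. *)
Lemma schwarz N (f : 'rV[R]_N -> R) x i j : regular_at k x f ->
  partial i (partial j f) x = partial j (partial i f) x.
Proof.
move=> rf; have [a [ra aE]] := regular_at_expansion rf.
have D1 l : \forall y \near (0 : 'rV[R]_N), partial l f (x + y) =
    a l y + \sum_i y 0 i * partial l (a i) y.
  have H : \forall y \near (0 : 'rV[R]_N), forall i, regular_at k y (a i).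
    by apply: near_forall => l'; exact: regular_at_near.
  apply: filterS2 (near_near aE) H => y fE ray.
  rewrite -partial_shift (partial_eq_near l fE) partialD ?partial_cst ?add0r.
  - exact: partial_expansion.
  - exact: differentiable_cst.
  - apply: differentiable_bigsum => i'; apply: differentiableM.
      exact: regular_at_differentiable (regular_at_coord k _ _).
    exact: regular_at_differentiable (ray i').
have D2 l l' : partial l (partial l' f) x = partial l (a l') 0 + partial l' (a l) 0.
  have := partial_shift (partial l' f) x l 0; rewrite addr0 => <-.
  rewrite (partial_eq_near l (D1 l')) partialD.
  - congr (_ + _); rewrite (@partial_expansion _ (fun i => partial l' (a i))) => [|i'].
      by rewrite big1 ?addr0// => i' _; rewrite mxE mul0r.
    exact: regular_at_partial.
  - exact: regular_at_differentiable (ra l').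
  - apply: differentiable_bigsum => i'; apply: differentiableM.
      exact: regular_at_differentiable (regular_at_coord k _ _).
    exact: regular_at_differentiable (regular_at_partial l' (ra i')).
by rewrite !D2 addrC.
Qed.

Lemma taylor1 p n (U : 'rV[R]_(p + n) -> R) : regular_at k 0 U ->
  exists a : 'I_n -> 'rV[R]_(p + n) -> R, (forall i, regular_at k 0 (a i)) /\
    \forall w \near (0 : 'rV[R]_(p + n)),
      U w = U (row_mx (lsubmx w) 0) + \sum_i rsubmx w 0 i * a i w.
Proof.
move=> rU; have [q [rq qE]] := regular_at_hadamard rU.
pose c (w : 'rV[R]_(p + n)) : 'rV[R]_((p + n) + (p + n)) :=
  row_mx (row_mx (lsubmx w) 0) (row_mx 0 (rsubmx w)).
have rc : regular_map_at k 0 c.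
  apply: regular_map_row_mx; apply: regular_map_row_mx; try exact: regular_map_cst.
    exact: regular_lsubmx.
  exact: regular_rsubmx.
have c0 : c 0 = 0 by rewrite /c lsubmx_const rsubmx_const !row_mx_const.
exists (fun i => q (rshift p i) \o c); split=> [i|].
  by apply: regular_at_comp => //; rewrite c0.
have := near_regular rc c0 qE; apply: filterS => w.
rewrite /c row_mxKl row_mxKr add_row_mx addr0 add0r hsubmxK => ->; congr (_ + _).
rewrite big_split_ord/= big1 ?add0r => [|i _]; last by rewrite row_mxEl mxE mul0r.
by apply: eq_bigr => i _; rewrite row_mxEr.
Qed.

(** A function that vanishes to first order on the subspace where the last
    n coordinates are zero is a quadratic form in these coordinates with
    regular coefficients: the quotients of U vanish on the subspace, being
    there the partial derivatives of U, and are expanded once more. *)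
Lemma taylor2 p n (U : 'rV[R]_(p + n) -> R) : regular_at k 0 U ->
  (\forall x \near (0 : 'rV[R]_p), U (row_mx x 0) = 0) ->
  (forall i, \forall x \near (0 : 'rV[R]_p), partial (rshift p i) U (row_mx x 0) = 0) ->
  exists A : 'rV[R]_(p + n) -> 'M[R]_n, (forall i j, regular_at k 0 (fun w => A w i j)) /\
    \forall w \near (0 : 'rV[R]_(p + n)),
      U w = (rsubmx w *m A w *m (rsubmx w)^T) 0 0.
Proof.
move=> rU U0 DU; have [a [ra aE]] := taylor1 rU.
have rl0 : regular_map_at k 0 (lsubmx : 'rV[R]_(p + n) -> 'rV[R]_p) := regular_lsubmx _.
have rx0 : regular_map_at k (0 : 'rV[R]_p) (fun x => row_mx x (0 : 'rV[R]_n)).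
  by apply: regular_map_row_mx; [exact: regular_map_id|exact: regular_map_cst].
have a0 i : \forall x \near (0 : 'rV[R]_p), a i (row_mx x 0) = 0.
  have H1 := near_regular rx0 (row_mx0 _ _ _ _) (near_near aE).
  have H2 : \forall x \near (0 : 'rV[R]_p), forall l, regular_at k (row_mx x (0 : 'rV[R]_n)) (a l).
    apply: near_forall => l.
    exact: near_regular rx0 (row_mx0 _ _ _ _) (regular_at_near (ra l)).
  have H3 : \forall x \near (0 : 'rV[R]_p), regular_at k (row_mx x (0 : 'rV[R]_n)) U.
    exact: near_regular rx0 (row_mx0 _ _ _ _) (regular_at_near rU).
  apply: near_sub (near_and (near_and (DU i) H1) (near_and H2 H3)) => x [[DUx aEx] [rax rUx]].
  rewrite -DUx (partial_eq_near _ aEx) partialD.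
  - rewrite (partial_lsubmx_r (fun z => U (row_mx z 0))) add0r.
    rewrite partial_sum => [|l]; last first.
      apply: differentiableM; last exact: regular_at_differentiable (rax l).
      exact: regular_at_differentiable (@regular_rsubmx _ _ _ l).
    rewrite (bigD1 i)//= big1 ?addr0 => [|l li].
      rewrite partialM; last 2 first.
      + exact: regular_at_differentiable (@regular_rsubmx _ _ _ i).
      + exact: regular_at_differentiable (rax i).
      rewrite (partial_rsubmx_r (fun z : 'rV[R]_n => z 0 i)) partial_coord eqxx mul1r.
      by rewrite row_mxKr mxE mul0r addr0.
    rewrite partialM; last 2 first.
    + exact: regular_at_differentiable (@regular_rsubmx _ _ _ l).
    + exact: regular_at_differentiable (rax l).
    rewrite (partial_rsubmx_r (fun z : 'rV[R]_n => z 0 l)) partial_coord.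
    by rewrite eq_sym (negbTE li) row_mxKr mxE !mul0r addr0.
  - have -> : (fun y => U (row_mx (lsubmx y) 0)) = U \o (fun y => row_mx (lsubmx y) 0) by [].
    apply: (@regular_at_differentiable _ _ k); apply: regular_at_comp.
      by apply: regular_map_row_mx; [exact: regular_lsubmx|exact: regular_map_cst].
    by rewrite row_mxKl.
  - apply: differentiable_bigsum => l; apply: differentiableM.
      exact: regular_at_differentiable (@regular_rsubmx _ _ _ l).
    exact: regular_at_differentiable (rax l).
have /choice[b bP] := fun i => taylor1 (ra i).
exists (fun w => \matrix_(i, j) b i j w); split=> [i j|].
  by apply: regular_at_eq ((bP i).1 j); apply: near_all => w; rewrite mxE.
have H1 : \forall w \near (0 : 'rV[R]_(p + n)), forall i,
    a i w = a i (row_mx (lsubmx w) 0) + \sum_j rsubmx w 0 j * b i j w.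
  by apply: near_forall => i; exact: (bP i).2.
have H2 : \forall w \near (0 : 'rV[R]_(p + n)), forall i, a i (row_mx (lsubmx w) 0) = 0.
  apply: near_forall => i; apply: (near_regular rl0 _ (a0 i)); exact: lsubmx_const.
have H3 : \forall w \near (0 : 'rV[R]_(p + n)), U (row_mx (lsubmx w) 0) = 0.
  by apply: (near_regular rl0 _ U0); exact: lsubmx_const.
apply: near_sub (near_and (near_and aE H1) (near_and H2 H3)) => w [[-> aw] [a0w ->]].
rewrite add0r -mulmxA mxE; apply: eq_bigr => i _; rewrite aw a0w add0r mxE.
congr (_ * _); rewrite [RHS]mxE; apply: eq_bigr => j _.
by rewrite !mxE mulrC.
Qed.

End ProductSpace.

Lemma near_rsubmx (R : realType) n m (P : 'rV[R]_m -> Prop) :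
  (\forall l \near (0 : 'rV[R]_m), P l) -> \forall x \near (0 : 'rV[R]_(n + m)), P (rsubmx x).
Proof.
by apply: (near_regular (regular_rsubmx Smooth _)); exact: rsubmx_const.
Qed.

(** * Changes of the base and cotangent lifts *)

Section InverseGerms.
Variables (R : realType) (k : category).

(** A germ of diffeomorphism with its inverse exhibited, a symmetric
    notion. *)
Definition inverse_germs N M (f : 'rV[R]_N -> 'rV[R]_M) (g : 'rV[R]_M -> 'rV[R]_N) : Prop :=
  [/\ f 0 = 0 /\ g 0 = 0, regular_map_at k 0 f, regular_map_at k 0 g,
      \forall x \near (0 : 'rV[R]_N), g (f x) = x &
      \forall y \near (0 : 'rV[R]_M), f (g y) = y].

Lemma diffeo_germP N M (f : 'rV[R]_N -> 'rV[R]_M) :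
  diffeo_germ k f <-> exists g, inverse_germs f g.
Proof.
split=> [[f0 rf [g [g0 rg gf fg]]]|[g [[f0 g0] rf rg gf fg]]].
  by exists g.
by split => //; exists g.
Qed.

Lemma inverse_germs_sym N M (f : 'rV[R]_N -> 'rV[R]_M) g :
  inverse_germs f g -> inverse_germs g f.
Proof. by case=> -[]. Qed.

Lemma inverse_germs_comp N M P (f : 'rV[R]_N -> 'rV[R]_M) g
    (f' : 'rV[R]_M -> 'rV[R]_P) g' :
  inverse_germs f g -> inverse_germs f' g' -> inverse_germs (f' \o f) (g \o g').
Proof.
move=> [[f0 g0] rf rg gf fg] [[f'0 g'0] rf' rg' gf' fg']; split=> /=.
- by rewrite f0 g'0.
- by apply: regular_map_comp; rewrite ?f0.
- by apply: regular_map_comp; rewrite ?g'0.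
- by apply: near_sub (near_and gf (near_regular rf f0 gf')) => x [gfx ->].
- by apply: near_sub (near_and fg' (near_regular rg' g'0 fg)) => x [gfx ->].
Qed.

Lemma inverse_germs_gradient N M (f : 'rV[R]_N -> 'rV[R]_M) g : inverse_germs f g ->
  \forall x \near (0 : 'rV[R]_N), gradient_mx f x *m gradient_mx g (f x) = 1%:M.
Proof.
move=> [[f0 g0] rf rg gf fg].
have rgf := near_regular rf f0 (regular_map_near rg).
apply: near_sub (near_and (near_and (near_near gf) rgf) (regular_map_near rf)).
move=> x [[gfx rgfx] rfx]; rewrite -(gradient_mx_comp rfx rgfx).
by rewrite (gradient_mx_eq gfx) gradient_mx_id.
Qed.

(** The base map of a fibred diffeomorphism germ that preserves the axis
    beta = 0 is the restriction of the diffeomorphism to that axis, and the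
    same restriction of the inverse gives its inverse. *)
Lemma inverse_germs_base n1 n2 m (Psi : 'rV[R]_(n1 + m) -> 'rV[R]_(n2 + m))
    (g : 'rV[R]_(n2 + m) -> 'rV[R]_(n1 + m)) (Lambda : 'rV[R]_m -> 'rV[R]_m) :
  inverse_germs Psi g ->
  (\forall x \near (0 : 'rV[R]_(n1 + m)), rsubmx (Psi x) = Lambda (rsubmx x)) ->
  (\forall l \near (0 : 'rV[R]_m), lsubmx (Psi (row_mx 0 l)) = 0) ->
  exists Lambda', inverse_germs Lambda Lambda' /\
    \forall y \near (0 : 'rV[R]_(n2 + m)), rsubmx (g y) = Lambda' (rsubmx y).
Proof.
move=> [[P0 g0] rP rg gP Pg] fib ax.
have rax n : regular_map_at k (0 : 'rV[R]_m) (fun l => row_mx (0 : 'rV[R]_n) l).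
  by apply: regular_map_row_mx; [exact: regular_map_cst|exact: regular_map_id].
have ax0 n : row_mx (0 : 'rV[R]_n) (0 : 'rV[R]_m) = 0 by rewrite row_mx0.
have L0 : Lambda 0 = 0.
  by have := nbhs_singleton fib; rewrite P0 !rsubmx_const => <-.
have fib1 := near_regular (rax n1) (ax0 n1) fib.
have rL : regular_map_at k 0 Lambda.
  apply: (@regular_map_eq _ _ _ _ _ (fun l => rsubmx (Psi (row_mx 0 l)))).
    by apply: near_sub fib1 => l ->; rewrite row_mxKr.
  apply: regular_map_rsubmx; apply: (regular_map_comp (rax n1)); by rewrite ax0.
have rL' : regular_map_at k 0 (fun l => rsubmx (g (row_mx 0 l))).
  apply: regular_map_rsubmx; apply: (regular_map_comp (rax n2)); by rewrite ax0.
have LK : \forall l \near (0 : 'rV[R]_m), rsubmx (g (row_mx 0 (Lambda l))) = l.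
  apply: near_sub (near_and (near_and fib1 ax) (near_regular (rax n1) (ax0 n1) gP)) => l.
  rewrite row_mxKr => -[[<- Px] gPx].
  by rewrite -[X in g (row_mx X _)]Px hsubmxK gPx row_mxKr.
exists (fun l => rsubmx (g (row_mx 0 l))); split.
  split => //; first by rewrite L0 ax0 g0 rsubmx_const.
  have gax0 : g (row_mx 0 (0 : 'rV[R]_m)) = 0 by rewrite ax0.
  have rgax : regular_map_at k (0 : 'rV[R]_m) (fun l => g (row_mx 0 l)).
    by apply: (regular_map_comp (rax n2)); rewrite ax0.
  have := near_and (near_regular rgax gax0 fib) (near_regular (rax n2) (ax0 n2) Pg).
  by apply: near_sub => l [<- ->]; rewrite row_mxKr.
have rrg : regular_map_at k 0 (fun y => rsubmx (g y)) by exact: regular_map_rsubmx.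
have rg0 : rsubmx (g 0) = 0 by rewrite g0 rsubmx_const.
have := near_and (near_and (near_regular rg g0 fib) Pg) (near_regular rrg rg0 LK).
by apply: near_sub => y [[fiby gy] E]; rewrite -E -fiby gy.
Qed.

End InverseGerms.

Section Lift.
Variables (R : realType) (k : category) (m : nat).
Implicit Types (Lambda : 'rV[R]_m -> 'rV[R]_m).

Lemma dF_regular n (F : 'rV[R]_(n + m) -> R) x : regular_at k x F ->
  regular_map_at k x (dF_beta F) /\ regular_map_at k x (dF_lambda F).
Proof.
move=> rF; split=> j; apply: regular_at_eq (regular_at_partial _ rF);
  by apply: near_all => y; rewrite mxE.
Qed.

(** Chain rule: where the derivatives of F1 along beta vanish, those along
    lambda are the only ones that contribute, and g acts on lambda by the
    base map alone. *)
Lemma critical_transfer n1 n2 (F1 : 'rV[R]_(n1 + m) -> R) (F2 : 'rV[R]_(n2 + m) -> R)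
    (g : 'rV[R]_(n2 + m) -> 'rV[R]_(n1 + m)) Lambda :
  g 0 = 0 -> regular_map_at k 0 g -> regular_at k 0 F1 -> regular_map_at k 0 Lambda ->
  (\forall y \near (0 : 'rV[R]_(n2 + m)), rsubmx (g y) = Lambda (rsubmx y)) ->
  (\forall y \near (0 : 'rV[R]_(n2 + m)), F2 y = F1 (g y)) ->
  \forall y \near (0 : 'rV[R]_(n2 + m)), dF_beta F1 (g y) = 0 ->
    dF_beta F2 y = 0 /\
    dF_lambda F2 y = dF_lambda F1 (g y) *m (gradient_mx Lambda (rsubmx y))^T.
Proof.
move=> g0 rg rF rL fib FE.
have H1 := near_and (near_near fib) (near_near FE).
have H2 := near_and (regular_map_near rg) (near_regular rg g0 (regular_at_near rF)).
apply: near_sub (near_and H1 H2) => y [[fiby FEy] [rgy rFy]] Fb0.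
have dF i : partial i F2 y = \sum_j partial i (fun y => Lambda (rsubmx y) 0 j) y *
    dF_lambda F1 (g y) 0 j.
  rewrite (partial_eq_near i FEy) (@partial_comp _ _ _ F1 g).
  - rewrite big_split_ord/= big1 ?add0r => [|j _]; last first.
      by have /rowP/(_ j) := Fb0; rewrite !mxE => ->; rewrite mulr0.
    apply: eq_bigr => j _; rewrite [dF_lambda _ _ _ _]mxE; congr (_ * _).
    by apply: partial_eq_near; apply: near_sub fiby => z <-; rewrite mxE.
  - by move=> j; exact: regular_at_differentiable (rgy j).
  - exact: regular_at_differentiable rFy.
split; apply/rowP => i; rewrite mxE dF mxE.
  by rewrite big1// => j _; rewrite (partial_rsubmx_l (fun z => Lambda z 0 j)) mul0r.
apply: eq_bigr => j _; rewrite (partial_rsubmx_r (fun z => Lambda z 0 j)).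
by rewrite mulrC !mxE.
Qed.

(** The cotangent lift of Lambda, whose inverse germ Lambda' serves to
    write the inverse of the Jacobian. *)
Definition lift Lambda Lambda' (x : 'rV[R]_(m + m)) : 'rV[R]_(m + m) :=
  row_mx (lsubmx x *m (gradient_mx Lambda' (Lambda (rsubmx x)))^T) (Lambda (rsubmx x)).

(** The last clause of [generating_family]; the regularity and the rank
    condition are handled apart. *)
Definition generates n (F : 'rV[R]_(n + m) -> R) (L : set 'rV[R]_(m + m)) :=
  exists W0 : set 'rV[R]_(n + m), nbhs (0 : 'rV[R]_(n + m)) W0 /\
    forall W : set 'rV[R]_(n + m), nbhs (0 : 'rV[R]_(n + m)) W -> W `<=` W0 ->
      set_germ_eq L (generated_set F W).

Lemma lift0 Lambda Lambda' : Lambda 0 = 0 -> lift Lambda Lambda' 0 = 0.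
Proof. by move=> L0; rewrite /lift lsubmx_const mul0mx rsubmx_const L0 row_mx0. Qed.

Lemma regular_base Lambda n (x : 'rV[R]_(n + m)) : regular_map_at k (rsubmx x) Lambda ->
  regular_map_at k x (fun y => Lambda (rsubmx y)).
Proof. by move=> rL; apply: (regular_map_comp _ rL); exact: regular_rsubmx. Qed.

Lemma lift_regular Lambda Lambda' : inverse_germs k Lambda Lambda' ->
  regular_map_at k 0 (lift Lambda Lambda').
Proof.
move=> [[L0 L'0] rL rL' _ _].
have rLr : regular_map_at k (0 : 'rV[R]_(m + m)) (fun y => Lambda (rsubmx y)).
  by apply: regular_base; rewrite rsubmx_const.
apply: regular_map_row_mx => //.
apply: regular_map_mulmx; first exact: regular_lsubmx.
move=> i j; have rD : regular_at k (Lambda (rsubmx (0 : 'rV[R]_(m + m))))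
    (partial j (fun z => Lambda' z 0 i)).
  by apply: regular_at_partial; rewrite rsubmx_const L0; exact: rL'.
by apply: regular_at_eq (regular_at_comp rLr rD); apply: near_all => y; rewrite !mxE.
Qed.

(** The map Psi matches the critical points of F1 with those of F2, and
    [critical_transfer] in both directions says that the covectors
    correspond under the lift. As only germs are given, each point must be
    kept in the neighbourhoods on which these facts are known. *)
Lemma generates_lift n1 n2 (F1 : 'rV[R]_(n1 + m) -> R) (F2 : 'rV[R]_(n2 + m) -> R)
    (Psi : 'rV[R]_(n1 + m) -> 'rV[R]_(n2 + m)) g Lambda Lambda' L :
  inverse_germs k Psi g -> inverse_germs k Lambda Lambda' ->
  (\forall x \near (0 : 'rV[R]_(n1 + m)), rsubmx (Psi x) = Lambda (rsubmx x)) ->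
  (\forall y \near (0 : 'rV[R]_(n2 + m)), rsubmx (g y) = Lambda' (rsubmx y)) ->
  regular_at k 0 F1 -> regular_at k 0 F2 ->
  (\forall x \near (0 : 'rV[R]_(n1 + m)), F1 x = F2 (Psi x)) ->
  generates F2 L -> generates F1 (lift Lambda Lambda' @^-1` L).
Proof.
move=> iP iL fibP fibg rF1 rF2 FE [V0 [nV0 V0P]].
have [[P0 g0] rP rg gP Pg] := iP; have [[L0 L'0] rL rL' LK L'K] := iL.
have FE2 : \forall y \near (0 : 'rV[R]_(n2 + m)), F2 y = F1 (g y).
  by apply: near_sub (near_and (near_regular rg g0 FE) Pg) => y [-> ->].
have T1 := critical_transfer g0 rg rF1 rL' fibg FE2.
have T2 := critical_transfer P0 rP rF2 rL fibP FE.
have rlift := lift_regular iL.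
have l0 := lift0 Lambda' L0.
have LK0 : \forall x \near (0 : 'rV[R]_(m + m)), Lambda' (Lambda (rsubmx x)) = rsubmx x.
  exact: near_rsubmx LK.
have GK : \forall x \near (0 : 'rV[R]_(m + m)),
    gradient_mx Lambda (rsubmx x) *m gradient_mx Lambda' (Lambda (rsubmx x)) = 1%:M.
  exact: near_rsubmx (inverse_germs_gradient iL).
have := near_and (near_and (near_regular rP P0 nV0) (near_regular rP P0 T1))
  (near_and (near_and T2 gP) fibP).
(* admissible points for F1: those that Psi sends into the domain V0 of F2
   and at which both transfers apply *)
set W0 := (X in \forall x \near _, X x) => nW0.
exists W0; split=> // W nW WW0.
have := near_and (near_and nV0 (near_regular rg g0 nW)) (near_and Pg fibg).
(* V also asks that g leads back into W, so that the critical point of F2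
   yields one of F1 there *)
set V := (X in \forall x \near _, X x) => nV.
have E1 : set_germ_eq L (generated_set F2 V) by apply: V0P => // y [[]].
have E2 : set_germ_eq L (generated_set F2 V0) by exact: V0P.
have := near_and (near_and (near_regular rlift l0 E1) (near_regular rlift l0 E2))
  (near_and LK0 GK).
apply: near_sub => x [[E1x E2x] [LKx GKx]]; split=> [/E1x|] [b].
  set z := row_mx _ _ => -[[[V0z Wz] [Pgz fibgz]] Fz lz].
  have rz : rsubmx z = Lambda (rsubmx x) by rewrite /z row_mxKr /cot_proj /lift row_mxKr.
  have rgz : rsubmx (g z) = rsubmx x by rewrite fibgz rz LKx.
  have gzE : row_mx (lsubmx (g z)) (cot_proj x) = g z by rewrite /cot_proj -rgz hsubmxK.
  exists (lsubmx (g z)); rewrite /= gzE.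
  have [_ [[T2z _] _]] := WW0 _ Wz; rewrite Pgz in T2z.
  have [F10 F1E] := T2z Fz; split=> //.
  rewrite F1E -lz /lift row_mxKl -mulmxA -trmx_mul rgz GKx.
  by rewrite trmx1 mulmx1.
set p := row_mx _ _ => -[Wp Fp lp].
have [[V0P_ T1p] [[_ gPp] fibp]] := WW0 _ Wp; rewrite gPp in T1p.
have [F20 F2E] := T1p Fp.
have rp : rsubmx (Psi p) = Lambda (rsubmx x) by rewrite fibp /p row_mxKr.
apply/E2x; exists (lsubmx (Psi p)); rewrite /=.
have -> : row_mx (lsubmx (Psi p)) (cot_proj (lift Lambda Lambda' x)) = Psi p.
  by rewrite /cot_proj /lift row_mxKr -rp hsubmxK.
by split=> //; rewrite F2E rp -lp /lift row_mxKl.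
Qed.

(** Both sets are the set generated by F over one small neighbourhood. *)
Lemma generates_unique n (F : 'rV[R]_(n + m) -> R) L L' :
  generates F L -> generates F L' -> set_germ_eq L L'.
Proof.
move=> [W [nW WP]] [V [nV VP]].
have nI := near_and nW nV.
have EL : set_germ_eq L (generated_set F (fun x => W x /\ V x)) by apply: WP => // x [].
have EL' : set_germ_eq L' (generated_set F (fun x => W x /\ V x)) by apply: VP => // x [].
by apply: near_sub (near_and EL EL') => x [-> ->].
Qed.

Lemma generates_germ n (F : 'rV[R]_(n + m) -> R) L L' : set_germ_eq L L' ->
  generates F L' -> generates F L.
Proof.
move=> LE [W0 [nW0 WP]]; exists W0; split=> // W nW WW0.
by apply: near_sub (near_and LE (WP W nW WW0)) => x [-> ->].
Qed.

(** As 0 lies in L, there are critical points over 0 in every neighbourhood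
    of 0; continuity makes 0 itself critical. *)
Lemma generates_critical0 n (F : 'rV[R]_(n + m) -> R) (L : set 'rV[R]_(m + m)) :
  regular_at k 0 F -> generates F L -> L 0 -> dF_beta F 0 = 0.
Proof.
move=> rF [W0 [nW0 WP]] L0; have [rb _] := dF_regular rF.
have cb := regular_map_continuous rb.
apply/eqP; rewrite -normr_le0; apply/ler_addgt0Pr => e e0; rewrite add0r.
have /continuous_epsP/(_ e e0) nb := cb.
have nW := near_and nW0 nb.
have : set_germ_eq L (generated_set F (fun y => W0 y /\ `|dF_beta F 0 - dF_beta F y| <= e)).
  by apply: WP => // y [].
by move=> /nbhs_singleton/iffLR/(_ L0)[b [[_ be] b0 _]]; rewrite b0 subr0 in be.
Qed.

Lemma lift_inverse_germs Lambda Lambda' : inverse_germs k Lambda Lambda' ->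
  inverse_germs k (lift Lambda Lambda') (lift Lambda' Lambda).
Proof.
suff H L L' : inverse_germs k L L' ->
    \forall x \near (0 : 'rV[R]_(m + m)), lift L' L (lift L L' x) = x.
  move=> iL; have iL' := inverse_germs_sym iL; have [[L0 L'0] _ _ _ _] := iL.
  split; [by rewrite !lift0|exact: lift_regular..|exact: H|exact: H].
move=> iL; have [[L0 L'0] rL rL' LK L'K] := iL.
have LK0 : \forall x \near (0 : 'rV[R]_(m + m)), L' (L (rsubmx x)) = rsubmx x.
  exact: near_rsubmx LK.
have GK : \forall x \near (0 : 'rV[R]_(m + m)),
    gradient_mx L (rsubmx x) *m gradient_mx L' (L (rsubmx x)) = 1%:M.
  exact: near_rsubmx (inverse_germs_gradient iL).
apply: near_sub (near_and LK0 GK) => x [LKx GKx].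
rewrite /lift row_mxKr row_mxKl LKx -mulmxA -trmx_mul GKx trmx1 mulmx1.
by rewrite hsubmxK.
Qed.

Lemma omegaE (u v : 'rV[R]_(m + m)) :
  omega u v = (lsubmx u *m (rsubmx v)^T - lsubmx v *m (rsubmx u)^T) 0 0.
Proof.
rewrite /omega sumrB !mxE; congr (_ - _); apply: eq_bigr => i _; by rewrite !mxE.
Qed.

Lemma gradient_base Lambda n (x : 'rV[R]_(n + m)) :
  gradient_mx (fun y => Lambda (rsubmx y)) x = col_mx 0 (gradient_mx Lambda (rsubmx x)).
Proof.
apply/matrixP => i j; rewrite mxE; case: (split_ordP i) => l ->.
  by rewrite col_mxEu mxE (partial_rsubmx_l (fun z => Lambda z 0 j)).
by rewrite col_mxEd mxE (partial_rsubmx_r (fun z => Lambda z 0 j)).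
Qed.

Lemma gradient_mx_row_mx N p q (f : 'rV[R]_N -> 'rV[R]_p) (g : 'rV[R]_N -> 'rV[R]_q) x :
  gradient_mx (fun y => row_mx (f y) (g y)) x = row_mx (gradient_mx f x) (gradient_mx g x).
Proof.
apply/matrixP => i j; rewrite mxE; case: (split_ordP j) => l ->.
  by rewrite row_mxEl mxE; congr partial; apply/funext => y; rewrite row_mxEl.
by rewrite row_mxEr mxE; congr partial; apply/funext => y; rewrite row_mxEr.
Qed.

Lemma lift_odd Lambda Lambda' x :
  lift Lambda Lambda' (zeta x) = zeta (lift Lambda Lambda' x).
Proof. by rewrite /lift /zeta !row_mxKl !row_mxKr mulNmx. Qed.

(** The Jacobian of the lift is block triangular with diagonal blocks S and
    G inverse transposed to each other, so the symplectic identity reduces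
    to the symmetry of T G^T, where T collects the derivatives of S.
    Differentiating S G^T = 1 turns that product into second derivatives of
    Lambda, which commute. *)
Lemma lift_symplectic Lambda Lambda' : inverse_germs k Lambda Lambda' ->
  symplectomorphism_germ k (lift Lambda Lambda').
Proof.
move=> iL; have iT := lift_inverse_germs iL; split; first by apply/diffeo_germP; exists (lift Lambda' Lambda).
have [[l0 _] rl _ _ _] := iT; have [[L0 L'0] rL rL' LK L'K] := iL.
pose S (l : 'rV[R]_m) := (gradient_mx Lambda' (Lambda l))^T.
have rS i j : regular_at k 0 (fun l => S l i j).
  have rD : regular_at k (Lambda 0) (partial j (fun z => Lambda' z 0 i)).
    by rewrite L0; apply: regular_at_partial; exact: rL'.
  by apply: regular_at_eq (regular_at_comp rL rD); apply: near_all => y; rewrite !mxE.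
have SG : \forall l \near (0 : 'rV[R]_m), S l *m (gradient_mx Lambda l)^T = 1%:M.
  apply: near_sub (inverse_germs_gradient iL) => l GS.
  by rewrite /S -trmx_mul GS trmx1.
have rSn : \forall l \near (0 : 'rV[R]_m), forall i j, regular_at k l (fun l => S l i j).
  apply: near_forall => i; apply: near_forall => j; exact: regular_at_near.
have SD : \forall l \near (0 : 'rV[R]_m), forall i a b,
    \sum_j partial a (fun l => S l i j) l * gradient_mx Lambda l b j =
    \sum_j partial b (fun l => S l i j) l * gradient_mx Lambda l a j.
  apply: near_sub (near_and (near_near SG) (near_and rSn (regular_map_near rL))).
  move=> l [SGl [rSl rLl]] i.
  have dS j : differentiable (fun l => S l i j) l.
    exact: regular_at_differentiable (rSl i j).
  have dD a j : differentiable (partial a (fun y => Lambda y 0 j)) l.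
    exact: regular_at_differentiable (regular_at_partial a (rLl j)).
  have H a b : \sum_j partial a (fun l => S l i j) l * gradient_mx Lambda l b j =
      - \sum_j S l i j * partial a (partial b (fun y => Lambda y 0 j)) l.
    apply/eqP; rewrite -subr_eq0 opprK -big_split/=; apply/eqP.
    rewrite -[RHS](partial_cst a ((1%:M : 'M[R]_m) i b) l).
    have SE : \forall y \near l, (1%:M : 'M[R]_m) i b =
        \sum_j S y i j * partial b (fun y => Lambda y 0 j) y.
      apply: near_sub SGl => y <-; rewrite mxE.
      by apply: eq_bigr => j _; rewrite !mxE.
    rewrite (partial_eq_near a SE) partial_sum => [|j].
      by apply: eq_bigr => j _; rewrite partialM// [gradient_mx _ _ _ _]mxE.
    exact: differentiableM.
  move=> a b; apply: etrans (H a b) (etrans _ (esym (H b a))).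
  apply: (congr1 (fun f => - \sum_j f j)); apply/funext => j.
  exact: (congr1 ( *%R (S l i j)) (schwarz a b (rLl j))).
apply: near_sub (near_and (near_and (near_rsubmx m SG) (near_rsubmx m SD))
  (near_and (regular_map_near rl) (near_rsubmx m rSn))) => x [[SGx SDx] [rlx rSx]] u v.
have dl := regular_map_differentiable rlx.
(* derivatives of kappa *m S along the base, kappa being fixed *)
pose T : 'M[R]_m := \matrix_(a, j) \sum_i x 0 (lshift m i) * partial a (fun l => S l i j) (rsubmx x).
pose G := gradient_mx Lambda (rsubmx x).
have gE : gradient_mx (lift Lambda Lambda') x = block_mx (S (rsubmx x)) 0 T G.
  rewrite [LHS](gradient_mx_row_mx (fun x => lsubmx x *m S (rsubmx x)) (fun x => Lambda (rsubmx x))).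
  rewrite gradient_base block_mxEh; congr row_mx.
  apply/matrixP => a j; rewrite mxE.
  have E : (fun y : 'rV[R]_(m + m) => (lsubmx y *m S (rsubmx y)) 0 j) =
      fun y => \sum_i y 0 (lshift m i) * S (rsubmx y) i j.
    by apply/funext => y; rewrite mxE; apply: eq_bigr => i _; rewrite mxE.
  have dSr i : differentiable (fun y : 'rV[R]_(m + m) => S (rsubmx y) i j) x.
    apply: (@regular_at_differentiable _ _ k).
    exact: (regular_at_comp (f := fun l => S l i j) (regular_rsubmx k x) (rSx i j)).
  have dx i : differentiable (fun y : 'rV[R]_(m + m) => y 0 (lshift m i)) x.
    exact: regular_at_differentiable (regular_at_coord k _ _).
  rewrite E partial_sum => [|i]; last exact: differentiableM.
  under eq_bigr => i _ do rewrite partialM// partial_coord.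
  rewrite big_split/=; case: (split_ordP a) => b ->.
    rewrite col_mxEu [X in _ + X]big1 ?addr0 => [|i _]; last first.
      by rewrite (partial_rsubmx_l (fun l => S l i j)) mulr0.
    rewrite (bigD1 b)//= eqxx mul1r big1 ?addr0// => i ib.
    by rewrite (inj_eq (@lshift_inj _ _)) eq_sym (negbTE ib) mul0r.
  rewrite col_mxEd mxE big1 ?add0r => [|i _]; last by rewrite eq_rlshift mul0r.
  by apply: eq_bigr => i _; rewrite (partial_rsubmx_r (fun l => S l i j)).
have TG : (T *m G^T)^T = T *m G^T.
  apply/matrixP => a b; rewrite mxE !mxE.
  have E a' b' : \sum_j T a' j * G^T j b' = \sum_i x 0 (lshift m i) *
      \sum_j partial a' (fun l => S l i j) (rsubmx x) * G b' j.
    under eq_bigr => j _ do rewrite !mxE mulr_suml.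
    rewrite exchange_big/=; apply: eq_bigr => i _; rewrite mulr_sumr.
    by apply: eq_bigr => j _; rewrite mulrA !mxE.
  by rewrite !E; apply: eq_bigr => i _; rewrite SDx.
have lE (w : 'rV[R]_(m + m)) : 'd (lift Lambda Lambda') x w =
    row_mx (lsubmx w *m S (rsubmx x) + rsubmx w *m T) (rsubmx w *m G).
  rewrite (diff_gradient _ dl) gE -{1}[w]hsubmxK mul_row_block.
  by rewrite mulmx0 add0r.
rewrite !lE !omegaE !row_mxKl !row_mxKr !trmx_mul !mulmxDl.
have A (a b : 'rV[R]_m) : a *m S (rsubmx x) *m (G^T *m b^T) = a *m b^T.
  by rewrite mulmxA -[a *m _ *m _]mulmxA SGx mulmx1.
rewrite !A; set p := lsubmx u *m _; set q := lsubmx v *m _.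
have -> : rsubmx v *m T *m (G^T *m (rsubmx u)^T) = (rsubmx u *m T *m (G^T *m (rsubmx v)^T))^T.
  by rewrite !mulmxA -[_ *m T *m _]mulmxA -[X in _ = X^T]mulmxA 2!trmx_mul trmxK -mulmxA -TG !trmx_mul !trmxK !mulmxA.
by rewrite !mxE; ring.
Qed.

End Lift.

(** * Odd fibred symplectomorphisms are cotangent lifts *)

Section SymplecticIsLift.
Variables (R : realType) (k : category) (m : nat).

Lemma regular_slice n p (f : 'rV[R]_(n + p) -> R) x y : regular_at k (row_mx x y) f ->
  regular_at k x (fun x => f (row_mx x y)).
Proof.
move=> rf; apply: (@regular_at_comp _ k _ _ x (fun x => row_mx x y) f _ rf).
by apply: regular_map_row_mx; [exact: regular_map_id|exact: regular_map_cst].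
Qed.

(** Fibredness and oddness provide the base map, because the zero section
    is fixed by the involution and hence preserved. The functions f i below
    measure how far the fibre component is from that of the lift; they
    vanish on the zero section, and the symplectic identity says that their
    derivatives along the fibres vanish. *)
Lemma symplectic_is_lift (Phi : 'rV[R]_(m + m) -> 'rV[R]_(m + m)) :
  symplectomorphism_germ k Phi -> fibred_germ Phi -> odd_germ Phi ->
  exists Lambda Lambda', inverse_germs k Lambda Lambda' /\
    \forall x \near (0 : 'rV[R]_(m + m)), Phi x = lift Lambda Lambda' x.
Proof.
move=> [/diffeo_germP[g iP] om] [U [nU fU]] odd.
have [[P0 g0] rP rg gP Pg] := iP.
pose Lambda l := rsubmx (Phi (row_mx 0 l)).
have rax : regular_map_at k (0 : 'rV[R]_m) (fun l => row_mx (0 : 'rV[R]_m) l).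
  by apply: regular_map_row_mx; [exact: regular_map_cst|exact: regular_map_id].
have raxr : regular_map_at k (0 : 'rV[R]_(m + m)) (fun x => row_mx (0 : 'rV[R]_m) (rsubmx x)).
  by apply: regular_map_row_mx; [exact: regular_map_cst|exact: regular_rsubmx].
have ax0 : row_mx (0 : 'rV[R]_m) (0 : 'rV[R]_m) = 0 by rewrite row_mx0.
have axr0 : row_mx (0 : 'rV[R]_m) (rsubmx (0 : 'rV[R]_(m + m))) = 0.
  by rewrite rsubmx_const ax0.
have nU' : \forall x \near (0 : 'rV[R]_(m + m)), U x by [].
have fib : \forall x \near (0 : 'rV[R]_(m + m)), rsubmx (Phi x) = Lambda (rsubmx x).
  apply: near_sub (near_and nU' (near_regular raxr axr0 nU')) => x [Ux Ux0].
  by apply: fU => //; rewrite /cot_proj row_mxKr.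
have ax : \forall l \near (0 : 'rV[R]_m), lsubmx (Phi (row_mx 0 l)) = 0.
  apply: near_sub (near_regular rax ax0 odd) => l.
  rewrite {1}/zeta row_mxKl row_mxKr oppr0 => E.
  have : lsubmx (Phi (row_mx 0 l)) = - lsubmx (Phi (row_mx 0 l)).
    by rewrite {1}E /zeta row_mxKl.
  by move=> /eqP; rewrite -addr_eq0 -mulr2n -scaler_nat scaler_eq0 pnatr_eq0/= => /eqP.
have [Lambda' [iL _]] := inverse_germs_base iP fib ax.
exists Lambda, Lambda'; split=> //.
have [[L0 L'0] rL rL' LK L'K] := iL.
pose f i (x : 'rV[R]_(m + m)) : R :=
  \sum_j Phi x 0 (lshift m j) * partial i (fun l => Lambda l 0 j) (rsubmx x) - x 0 (lshift m i).
have rf i : regular_at k 0 (f i).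
  apply: regular_at_sub; last exact: regular_at_coord.
  apply: regular_at_sum => j _; apply: regular_at_mul; first exact: rP.
  apply: (regular_at_comp (f := partial i (fun l => Lambda l 0 j)) (regular_rsubmx k _)).
  by apply: regular_at_partial; rewrite rsubmx_const; exact: rL.
have rf' : \forall x \near (0 : 'rV[R]_(m + m)), forall i, regular_at k x (f i).
  by apply: near_forall => i; exact: regular_at_near.
have Df : \forall x \near (0 : 'rV[R]_(m + m)), forall i j, partial (lshift m j) (f i) x = 0.
  have := near_and (near_and om (near_near fib))
    (near_and (regular_map_near rP) (near_rsubmx m (regular_map_near rL))).
  apply: near_sub => x [[omx fibx] [rPx rLx]] i a.
  have dP := regular_map_differentiable rPx.
  have dPj j : differentiable (fun y => Phi y 0 (lshift m j)) x.
    exact: regular_at_differentiable (rPx _).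
  have dL j : differentiable (fun y : 'rV[R]_(m + m) => partial i (fun l => Lambda l 0 j) (rsubmx y)) x.
    apply: (@regular_at_differentiable _ _ k).
    apply: (regular_at_comp (f := partial i (fun l => Lambda l 0 j)) (regular_rsubmx k _)).
    by apply: regular_at_partial; exact: rLx.
  have dc : differentiable (fun y : 'rV[R]_(m + m) => y 0 (lshift m i)) x.
    exact: regular_at_differentiable (regular_at_coord k _ _).
  rewrite /f partialB ?partial_coord//; last first.
    by apply: differentiable_bigsum => j; exact: differentiableM.
  rewrite partial_sum => [|j]; last exact: differentiableM.
  have Pr b j : partial b (fun y => Phi y 0 (rshift m j)) x =
      partial b (fun y : 'rV[R]_(m + m) => Lambda (rsubmx y) 0 j) x.
    by apply: partial_eq_near; apply: near_sub fibx => y <-; rewrite mxE.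
  have D b j : 'd Phi x (delta_mx 0 b) 0 j = partial b (fun y => Phi y 0 j) x.
    by rewrite diff_row_coord// /partial deriveE//; exact: differentiable_row_coord.
  (* the symplectic identity for the kappa_a and the lambda_i directions *)
  have := omx (delta_mx 0 (lshift m a)) (delta_mx 0 (rshift m i)).
  rewrite /omega [RHS](bigD1 a)//= [X in _ + X]big1 ?addr0 => [|j ja]; last first.
    rewrite !mxE (inj_eq (@lshift_inj _ _)) (negbTE ja).
    by rewrite eq_lrshift eq_rlshift !andbF !mul0r subr0.
  rewrite !mxE !eqxx eq_lrshift eq_rlshift /= mul0r subr0 mul1r.
  rewrite !(inj_eq (@rshift_inj _ _)) (inj_eq (@lshift_inj _ _)) => <-.
  apply/eqP; rewrite subr_eq0; apply/eqP; apply: eq_bigr => j _.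
  rewrite !D !Pr (partial_rsubmx_l (fun l => Lambda l 0 j)).
  rewrite (partial_rsubmx_r (fun l => Lambda l 0 j)) mulr0 subr0 partialM//.
  rewrite (partial_rsubmx_l (partial i (fun l => Lambda l 0 j))) mulr0 addr0.
  by [].
have f0 : \forall x \near (0 : 'rV[R]_(m + m)), forall i, f i x = 0.
  have ax' := near_rsubmx m ax.
  have /near0P[d d0 H] := near_and rf' Df.
  have nd : \forall x \near (0 : 'rV[R]_(m + m)), `|x| < d by exact: near0_norm_lt.
  apply: near_sub (near_and nd ax') => x [xd axx] i.
  have sd (y : 'rV[R]_m) : `|y| < d -> `|row_mx y (rsubmx x)| < d.
    move=> yd; have : `|row_mx y (rsubmx x)| <= Num.max `|y| `|x|.
      apply: row_mx_norm_le; first by rewrite le_max lexx.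
      by rewrite le_max rsubmx_norm_le orbT.
    by move=> /le_lt_trans; apply; rewrite gt_max yd.
  have xl : `|lsubmx x| < d by exact: le_lt_trans (lsubmx_norm_le _) xd.
  have := @partial_zero_const R m (fun y => f i (row_mx y (rsubmx x))) d (lsubmx x) _ _ xl.
  rewrite hsubmxK => ->.
  - rewrite /f row_mxEl mxE subr0 big1// => j _.
    by have /rowP/(_ j) := axx; rewrite !mxE => ->; rewrite mul0r.
  - move=> y /sd/H[/(_ i) r _]; apply: (@regular_at_differentiable _ _ k).
    exact: regular_slice r.
  - by move=> y j /sd/H[_ Dy]; rewrite partial_row_mx_l Dy.
have GK := near_rsubmx m (inverse_germs_gradient iL).
apply: near_sub (near_and (near_and f0 GK) fib) => x [[f0x GKx] fibx].
rewrite -[Phi x]hsubmxK fibx /lift; congr row_mx.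
have <- : lsubmx (Phi x) *m (gradient_mx Lambda (rsubmx x))^T = lsubmx x.
  apply/rowP => i; have /eqP := f0x i; rewrite subr_eq0 => /eqP E.
  by rewrite !mxE -E; apply: eq_bigr => j _; rewrite !mxE.
by rewrite -mulmxA -trmx_mul (mulmx1C GKx) trmx1 mulmx1.
Qed.

Lemma lift_fibred (Lambda Lambda' : 'rV[R]_m -> 'rV[R]_m) : fibred_germ (lift Lambda Lambda').
Proof.
exists setT; split=> [|x y _ _]; first exact: filterT.
by rewrite /cot_proj /lift !row_mxKr => ->.
Qed.

Lemma jacobian_gradient N M (f : 'rV[R]_N -> 'rV[R]_M) x : regular_map_at k x f ->
  jacobian f x = gradient_mx f x.
Proof.
move=> rf; apply/matrixP => i j; rewrite /jacobian.
rewrite !mxE diff_gradient; last exact: regular_map_differentiable rf.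
by rewrite -rowE !mxE.
Qed.

End SymplecticIsLift.

(** * Odd families and their critical points *)

Section Parity.
Variables (R : realType) (m : nat).

Lemma self_opp p q (A : 'M[R]_(p, q)) : A = - A -> A = 0.
Proof.
move=> AN; apply/matrixP => i j; have /matrixP/(_ i j) := AN; rewrite !mxE => H.
by lra.
Qed.

Lemma zetaK n : involutive (@zeta R n m).
Proof. by move=> x; rewrite /zeta row_mxKl row_mxKr opprK hsubmxK. Qed.

Lemma zeta0 n : @zeta R n m 0 = 0.
Proof. by rewrite /zeta lsubmx_const rsubmx_const oppr0 row_mx_const. Qed.

Lemma zeta_axis n (l : 'rV[R]_m) : @zeta R n m (row_mx 0 l) = row_mx 0 l.
Proof. by rewrite /zeta row_mxKl row_mxKr oppr0. Qed.

Lemma zeta_row_mx n (b : 'rV[R]_n) (l : 'rV[R]_m) : zeta (row_mx b l) = row_mx (- b) l.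
Proof. by rewrite /zeta row_mxKl row_mxKr. Qed.

Lemma regular_zeta k n (x : 'rV[R]_(n + m)) : regular_map_at k x (@zeta R n m).
Proof.
apply: regular_map_row_mx; last exact: regular_rsubmx.
by apply: regular_map_opp; exact: regular_lsubmx.
Qed.

Lemma near_zeta n (P : 'rV[R]_(n + m) -> Prop) : (\forall x \near (0 : 'rV[R]_(n + m)), P x) ->
  \forall x \near (0 : 'rV[R]_(n + m)), P (zeta x).
Proof. by apply: (near_regular (regular_zeta Smooth _)); exact: zeta0. Qed.

Lemma regular_axis k n (l : 'rV[R]_m) : regular_map_at k l (fun l => row_mx (0 : 'rV[R]_n) l).
Proof. by apply: regular_map_row_mx; [exact: regular_map_cst|exact: regular_map_id]. Qed.

Lemma near_axis n (P : 'rV[R]_(n + m) -> Prop) : (\forall x \near (0 : 'rV[R]_(n + m)), P x) ->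
  \forall l \near (0 : 'rV[R]_m), P (row_mx 0 l).
Proof. by apply: (near_regular (regular_axis Smooth _)); exact: row_mx0. Qed.

Lemma partial_zeta_l n (f : 'rV[R]_(n + m) -> R) x i : differentiable f (zeta x) ->
  partial (lshift m i) (fun y => f (zeta y)) x = - partial (lshift m i) f (zeta x).
Proof.
move=> df; have -> : partial (lshift m i) (fun y => f (zeta y)) x =
    'D_(- delta_mx 0 (lshift m i)) f (zeta x).
  apply: derive_ext_along => t; congr f; rewrite -[RHS]hsubmxK /zeta row_delta_lshift.
  by rewrite opp_row_mx oppr0 !linearP/= !row_mxKl !row_mxKr scaler0 add0r scalerN.
by rewrite /partial !deriveE// linearN.
Qed.

Lemma partial_zeta_r n (f : 'rV[R]_(n + m) -> R) x i :
  partial (rshift n i) (fun y => f (zeta y)) x = partial (rshift n i) f (zeta x).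
Proof.
apply: derive_ext_along => t; congr f; rewrite -[RHS]hsubmxK /zeta row_delta_rshift.
by rewrite !linearP/= !row_mxKl !row_mxKr oppr0 scaler0 !add0r.
Qed.

(** Differentiating an odd function along an odd variable gives an even
    function, along an even variable an odd one. *)
Lemma odd_family_dF k n (F : 'rV[R]_(n + m) -> R) : regular_at k 0 F -> odd_family F ->
  \forall x \near (0 : 'rV[R]_(n + m)),
    dF_beta F (zeta x) = dF_beta F x /\ dF_lambda F (zeta x) = - dF_lambda F x.
Proof.
move=> rF oF.
apply: near_sub (near_and (near_near oF) (near_and (near_zeta (regular_at_near rF)) (regular_at_near rF))).
move=> x [oFx [rFx rFx']]; have dFx := regular_at_differentiable rFx.
have dFx' := regular_at_differentiable rFx'.
split; apply/rowP => i; rewrite !mxE.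
  apply/oppr_inj; rewrite -partial_zeta_l// (partial_eq_near _ oFx).
  by rewrite partialN.
by rewrite -partial_zeta_r (partial_eq_near _ oFx) partialN.
Qed.

Lemma odd_family_axis n (F : 'rV[R]_(n + m) -> R) : odd_family F ->
  \forall l \near (0 : 'rV[R]_m), F (row_mx 0 l) = 0.
Proof.
by move=> oF; apply: near_sub (near_axis oF) => l; rewrite zeta_axis => H; lra.
Qed.

Lemma odd_family_dF_axis k n (F : 'rV[R]_(n + m) -> R) : regular_at k 0 F -> odd_family F ->
  \forall l \near (0 : 'rV[R]_m), dF_lambda F (row_mx 0 l) = 0.
Proof.
move=> rF oF; apply: near_sub (near_axis (odd_family_dF rF oF)) => l.
by rewrite zeta_axis => -[_ /self_opp].
Qed.

(** The block of second derivatives in lambda and beta at the origin. For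
    an odd family it is, up to transposition, the only nonzero block of the
    Jacobians of [dF_beta F] and of [dF_lambda F], and it has full column
    rank. *)
Definition mixed n (F : 'rV[R]_(n + m) -> R) : 'M[R]_(m, n) :=
  dsubmx (gradient_mx (dF_beta F) 0).

Lemma gradient_dF_beta k n (F : 'rV[R]_(n + m) -> R) : regular_at k 0 F -> odd_family F ->
  gradient_mx (dF_beta F) 0 = col_mx 0 (mixed F).
Proof.
move=> rF oF; rewrite -[LHS]vsubmxK; congr col_mx; apply: self_opp.
apply/matrixP => i j; rewrite !mxE.
have rb : regular_at k 0 (fun x => dF_beta F x 0 j) by exact: (dF_regular rF).1.
have Z := @partial_zeta_l n (fun x => dF_beta F x 0 j) 0 i; rewrite zeta0 in Z.
rewrite -Z; last exact: regular_at_differentiable rb.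
apply: partial_eq_near; apply: near_sub (odd_family_dF rF oF) => x [-> _].
by [].
Qed.

Lemma gradient_dF_lambda k n (F : 'rV[R]_(n + m) -> R) : regular_at k 0 F -> odd_family F ->
  gradient_mx (dF_lambda F) 0 = col_mx (mixed F)^T 0.
Proof.
move=> rF oF; apply/matrixP => i j; rewrite mxE; case: (split_ordP i) => l ->.
  rewrite col_mxEu !mxE.
  under eq_fun do rewrite mxE; rewrite (schwarz _ _ rF).
  by congr partial; apply/funext => x; rewrite mxE.
rewrite col_mxEd mxE -(row_mx0 _ 1 n m) -partial_row_mx_r.
rewrite -[RHS](partial_cst l 0 (0 : 'rV[R]_m)); apply: partial_eq_near.
by apply: near_sub (odd_family_dF_axis rF oF) => y ->; rewrite mxE.
Qed.

(** What remains of an odd generating family when the germ that it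
    generates is forgotten. *)
Definition critical_family k n (F : 'rV[R]_(n + m) -> R) : Prop :=
  [/\ regular_at k 0 F, odd_family F, dF_beta F 0 = 0 &
      \rank (gradient_mx (dF_beta F) 0) = n].

Lemma mixed_inverse k n (F : 'rV[R]_(n + m) -> R) : critical_family k F ->
  exists P : 'M[R]_(n, m), P *m mixed F = 1%:M.
Proof.
move=> [rF oF _ rk]; apply/row_fullP.
by apply/eqP; rewrite -[RHS]rk (gradient_dF_beta rF oF) rank_col_0mx.
Qed.

End Parity.

Section Matching.
Variables (R : realType) (k : category) (m n1 n2 : nat).
Variables (F : 'rV[R]_(n1 + m) -> R) (G : 'rV[R]_(n2 + m) -> R).

(** Two families that generate the same germ satisfy this in both
    directions; it is [matching] that makes the partner b a regular
    function of x. *)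
Definition critical_points_matched : Prop :=
  forall W : set 'rV[R]_(n2 + m), (\forall y \near (0 : 'rV[R]_(n2 + m)), W y) ->
  \forall x \near (0 : 'rV[R]_(n1 + m)), dF_beta F x = 0 ->
    exists b, [/\ W (row_mx b (rsubmx x)), dF_beta G (row_mx b (rsubmx x)) = 0 &
      dF_lambda G (row_mx b (rsubmx x)) = dF_lambda F x].

Hypotheses (cF : critical_family k F) (cG : critical_family k G) (FG : critical_points_matched).

(** The partner of a critical point solves dF_lambda G (b, lambda) =
    dF_lambda F x, a system of m equations for n2 unknowns. Projecting it
    with the left inverse of the mixed block of G leaves n2 equations that
    the implicit function theorem solves at all points x, critical or not.
    On critical points the solution is the partner, by uniqueness;
    uniqueness also makes the solution odd. *)
Lemma matching : exists e : 'rV[R]_(n1 + m) -> 'rV[R]_n2,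
  [/\ e 0 = 0, regular_map_at k 0 e,
      \forall x \near (0 : 'rV[R]_(n1 + m)), e (zeta x) = - e x,
      \forall x \near (0 : 'rV[R]_(n1 + m)), dF_beta F x = 0 ->
        dF_beta G (row_mx (e x) (rsubmx x)) = 0 /\
        dF_lambda G (row_mx (e x) (rsubmx x)) = dF_lambda F x &
      exists D, gradient_mx e 0 = col_mx D 0].
Proof.
have [P PA] := mixed_inverse cG; have [rF oF F0 _] := cF; have [rG oG G0 _] := cG.
pose K (z : 'rV[R]_((n1 + m) + n2)) : 'rV[R]_(n2 + m) := row_mx (rsubmx z) (rsubmx (lsubmx z)).
(* the projected system, with z = (x, b) *)
pose E (z : 'rV[R]_((n1 + m) + n2)) := (dF_lambda G (K z) - dF_lambda F (lsubmx z)) *m P^T.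
have K0 : K 0 = 0 by rewrite /K !(lsubmx_const, rsubmx_const) row_mx_const.
have rK x : regular_map_at k x K.
  apply: regular_map_row_mx; first exact: regular_rsubmx.
  by apply: regular_map_rsubmx; exact: regular_lsubmx.
have [rFb rFl] := dF_regular rF; have [rGb rGl] := dF_regular rG.
have rGK : regular_map_at k 0 (dF_lambda G \o K) by apply: regular_map_comp; rewrite ?K0.
have rFL : regular_map_at k 0 (dF_lambda F \o (lsubmx : 'rV[R]_((n1 + m) + n2) -> _)).
  by apply: regular_map_comp; [exact: regular_lsubmx|rewrite lsubmx_const].
have rE : regular_map_at k 0 E.
  by apply: regular_map_mulmxl; exact: regular_map_sub.
have axis0 n (H : 'rV[R]_(n + m) -> R) : regular_at k 0 H -> odd_family H -> dF_lambda H 0 = 0.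
  by move=> rH oH; have := nbhs_singleton (odd_family_dF_axis rH oH); rewrite row_mx0.
have E0 : E 0 = 0 by rewrite /E K0 lsubmx_const !axis0// subr0 mul0mx.
have gK : gradient_mx K 0 = row_mx (col_mx 0 1%:M) (col_mx (col_mx 0 1%:M) 0).
  rewrite [LHS]gradient_mx_row_mx; congr row_mx.
    by rewrite (gradient_base (fun y => y)) gradient_mx_id.
  apply/matrixP => i j; rewrite mxE; case: (split_ordP i) => l ->.
    rewrite (partial_lsubmx_l (fun y : 'rV[R]_(n1 + m) => rsubmx y 0 j)) col_mxEu.
    have /matrixP/(_ l j) := gradient_base (fun y : 'rV[R]_m => y) (lsubmx (0 : 'rV[R]_((n1 + m) + n2))).
    by rewrite gradient_mx_id mxE.
  by rewrite (partial_lsubmx_r (fun y : 'rV[R]_(n1 + m) => rsubmx y 0 j)) col_mxEd mxE.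
have gL : gradient_mx (lsubmx : 'rV[R]_((n1 + m) + n2) -> 'rV[R]_(n1 + m)) 0 = col_mx 1%:M 0.
  apply/matrixP => i j; rewrite mxE; case: (split_ordP i) => l ->.
    by rewrite (partial_lsubmx_l (fun y : 'rV[R]_(n1 + m) => y 0 j)) partial_coord col_mxEu mxE.
  by rewrite (partial_lsubmx_r (fun y : 'rV[R]_(n1 + m) => y 0 j)) col_mxEd mxE.
have gE : gradient_mx E 0 = col_mx (- (col_mx (mixed F)^T 0 *m P^T)) 1%:M.
  pose d z := dF_lambda G (K z) - dF_lambda F (lsubmx z).
  have rd : regular_map_at k 0 d by exact: regular_map_sub.
  have -> : gradient_mx E 0 = gradient_mx d 0 *m P^T.
    rewrite -[X in _ *m X](gradient_mx_mulmx P^T (d 0)).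
    have -> : E = mulmxr P^T \o d by [].
    rewrite (gradient_mx_comp rd); first by [].
    exact: regular_map_mulmxr.
  have -> : gradient_mx d 0 = gradient_mx (dF_lambda G \o K) 0 -
      gradient_mx (dF_lambda F \o (lsubmx : 'rV[R]_((n1 + m) + n2) -> _)) 0.
    apply/matrixP => i j; rewrite !mxE -partialB; last 2 first.
    - exact: regular_at_differentiable (rGK j).
    - exact: regular_at_differentiable (rFL j).
    suff -> : (fun y => d y 0 j) =
        (fun y => (dF_lambda G \o K) y 0 j - dF_lambda F (lsubmx y) 0 j) by [].
    by apply/funext => y; rewrite [LHS]mxE [X in _ + X]mxE.
  rewrite (gradient_mx_comp (rK 0)) ?K0//.
  rewrite (gradient_mx_comp (regular_lsubmx k _)) ?lsubmx_const//.
  rewrite gK gL !(gradient_dF_lambda rF, gradient_dF_lambda rG)// mul_row_col mulmx0 addr0.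
  rewrite !mul_col_mx mul0mx mul1mx mul1mx mul0mx opp_col_mx add_col_mx sub0r oppr0 addr0.
  have GP : (mixed G)^T *m P^T = 1%:M by rewrite -trmx_mul PA trmx1.
  by rewrite [LHS]mul_col_mx mulNmx mul_col_mx GP.
have uE : dsubmx (gradient_mx E 0) \in unitmx by rewrite gE col_mxKd unitmx1.
have [e [e0 re eP]] := implicit_function E0 rE uE.
have rxe : regular_map_at k (0 : 'rV[R]_(n1 + m)) (fun x => row_mx x (e x)).
  by apply: regular_map_row_mx => //; exact: regular_map_id.
have xe0 : row_mx (0 : 'rV[R]_(n1 + m)) (e 0) = 0 by rewrite e0 row_mx0.
have Ee : \forall x \near (0 : 'rV[R]_(n1 + m)), E (row_mx x (e x)) = 0.
  by apply: near_sub (near_regular rxe xe0 eP) => x; rewrite row_mxKl row_mxKr => ->.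
exists e; split=> //.
- have rze : regular_map_at k (0 : 'rV[R]_(n1 + m)) (fun x => row_mx (zeta x) (- e x)).
    by apply: regular_map_row_mx; [exact: regular_zeta|exact: regular_map_opp].
  have ze0 : row_mx (zeta (0 : 'rV[R]_(n1 + m))) (- e 0) = 0.
    by rewrite e0 oppr0 zeta0 row_mx0.
  have rh : regular_map_at k (0 : 'rV[R]_(n1 + m)) (fun x => row_mx (e x) (rsubmx x)).
    by apply: regular_map_row_mx => //; exact: regular_rsubmx.
  have h0 : row_mx (e 0) (rsubmx (0 : 'rV[R]_(n1 + m))) = 0.
    by rewrite e0 rsubmx_const row_mx0.
  apply: near_sub (near_and (near_and Ee (near_regular rze ze0 eP)) (near_and
    (odd_family_dF rF oF) (near_regular rh h0 (odd_family_dF rG oG)))).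
  move=> x [[Ex]]; rewrite row_mxKl row_mxKr => eP' [[_ oFx] [_ oGx]].
  apply/esym/eP'; rewrite /E /K row_mxKl row_mxKr oFx.
  have -> : row_mx (- e x) (rsubmx (zeta x)) = zeta (row_mx (e x) (rsubmx x)).
    by rewrite zeta_row_mx /zeta row_mxKr.
  rewrite oGx -opprD mulNmx.
  by move: Ex; rewrite /E /K row_mxKl row_mxKr => ->; rewrite oppr0.
- move: (eP) => /near0P[d d0 H].
  have nd : \forall x \near (0 : 'rV[R]_(n1 + m)), `|x| < d by exact: near0_norm_lt.
  have nd2 : \forall y \near (0 : 'rV[R]_(n2 + m)), `|y| < d by exact: near0_norm_lt.
  apply: near_sub (near_and nd (FG nd2)) => x [xd FGx] /FGx[b [/= yd Gb Gl]].
  suff <- : b = e x by [].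
  have xbd : `|row_mx x b| < d.
    have : `|row_mx x b| <= Num.max `|x| `|row_mx b (rsubmx x)|.
      apply: row_mx_norm_le; first by rewrite le_max lexx.
      by rewrite le_max -{2}[b](@row_mxKl _ _ _ _ b (rsubmx x)) lsubmx_norm_le orbT.
    by move=> /le_lt_trans; apply; rewrite gt_max xd.
  have /iffLR := H _ xbd; rewrite row_mxKl row_mxKr; apply.
  by rewrite /E /K row_mxKl row_mxKr Gl subrr mul0mx.
- exists ((mixed F)^T *m P^T).
  have : gradient_mx (E \o (fun x => row_mx x (e x))) 0 = 0.
    rewrite -[RHS](gradient_mx_mulmx (0 : 'M[R]_(n1 + m, n2)) 0); apply: gradient_mx_eq.
    by apply: near_sub Ee => x /= ->; rewrite mulmx0.
  rewrite (gradient_mx_comp rxe) ?xe0// gradient_mx_row_mx gradient_mx_id gE.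
  rewrite mul_row_col mul1mx mulmx1 => /eqP; rewrite addrC subr_eq0 => /eqP ->.
  by rewrite mul_col_mx mul0mx.
Qed.

End Matching.

(** * Straightening an odd family *)

Section Straighten.
Variables (R : realType) (k : category) (m n : nat).
Implicit Types (F : 'rV[R]_(n + m) -> R).

(** The rank condition says that [dF_beta F] restricts to a local
    diffeomorphism on the affine subspaces directed by the rows of a left
    inverse P of the mixed block. So moving x within such a subspace,
    [dF_beta F] may be given any small value w; r is this motion. *)
Lemma straighten F : critical_family k F ->
  exists r : 'rV[R]_((n + m) + n) -> 'rV[R]_(n + m),
    [/\ r 0 = 0, regular_map_at k 0 r, forall w, lsubmx (r w) = lsubmx (lsubmx w),
        \forall w \near (0 : 'rV[R]_((n + m) + n)), dF_beta F (r w) = rsubmx w &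
        \forall x \near (0 : 'rV[R]_(n + m)), r (row_mx x (dF_beta F x)) = x].
Proof.
move=> cF; have [P PA] := mixed_inverse cF; have [rF oF F0 _] := cF.
have [rFb _] := dF_regular rF.
pose N := ((n + m) + n)%N.
(* z = (x, w, s): the point x moved by s along the rows of P *)
pose K (z : 'rV[R]_(N + n)) : 'rV[R]_(n + m) :=
  row_mx (lsubmx (lsubmx (lsubmx z))) (rsubmx (lsubmx (lsubmx z)) + rsubmx z *m P).
pose E (z : 'rV[R]_(N + n)) := dF_beta F (K z) - rsubmx (lsubmx z).
have K0 : K 0 = 0.
  by rewrite /K !(lsubmx_const, rsubmx_const) mul0mx addr0 row_mx_const.
have rll x : regular_map_at k x (fun z : 'rV[R]_(N + n) => lsubmx (lsubmx z)).
  by apply: regular_map_lsubmx; exact: regular_lsubmx.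
have rrP x : regular_map_at k x (fun z : 'rV[R]_(N + n) => rsubmx z *m P).
  by apply: regular_map_mulmxl; exact: regular_rsubmx.
have rK x : regular_map_at k x K.
  apply: regular_map_row_mx; first exact: regular_map_lsubmx.
  by apply: regular_map_add; first exact: regular_map_rsubmx.
have rFK : regular_map_at k 0 (dF_beta F \o K) by apply: regular_map_comp; rewrite ?K0.
have rE : regular_map_at k 0 E.
  apply: regular_map_sub => //; apply: regular_map_rsubmx; exact: regular_lsubmx.
have E0 : E 0 = 0 by rewrite /E K0 F0 !(lsubmx_const, rsubmx_const) subr0.
have gK : dsubmx (gradient_mx K 0) = row_mx 0 P.
  have -> : gradient_mx K 0 =
      row_mx (gradient_mx (fun z : 'rV[R]_(N + n) => lsubmx (lsubmx (lsubmx z))) 0)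
       (gradient_mx (fun z : 'rV[R]_(N + n) => rsubmx (lsubmx (lsubmx z)) + rsubmx z *m P) 0).
    exact: gradient_mx_row_mx.
  apply/matrixP => i j; rewrite mxE; case: (split_ordP j) => l ->.
    by rewrite !row_mxEl !mxE (partial_lsubmx_r (fun y : 'rV[R]_N => lsubmx (lsubmx y) 0 l)).
  rewrite !row_mxEr mxE.
  have -> : (fun y : 'rV[R]_(N + n) => (rsubmx (lsubmx (lsubmx y)) + rsubmx y *m P) 0 l) =
      (fun y => rsubmx (lsubmx (lsubmx y)) 0 l + (rsubmx y *m P) 0 l).
    by apply/funext => y; rewrite mxE.
  rewrite partialD; last 2 first.
  - apply: (@regular_at_differentiable _ _ k); exact: (regular_map_rsubmx (rll 0) l).
  - apply: (@regular_at_differentiable _ _ k); exact: (rrP 0 l).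
  rewrite (partial_lsubmx_r (fun y : 'rV[R]_N => rsubmx (lsubmx y) 0 l)) add0r.
  rewrite (partial_rsubmx_r (fun y : 'rV[R]_n => (y *m P) 0 l)).
  by have /matrixP/(_ i l) := gradient_mx_mulmx P (rsubmx (0 : 'rV[R]_(N + n))); rewrite mxE.
have gE : dsubmx (gradient_mx E 0) = 1%:M.
  have -> : dsubmx (gradient_mx E 0) = dsubmx (gradient_mx (dF_beta F \o K) 0).
    apply/matrixP => i j; rewrite !mxE.
    have -> : (fun y : 'rV[R]_(N + n) => E y 0 j) =
        (fun y => (dF_beta F \o K) y 0 j - rsubmx (lsubmx y) 0 j).
      by apply/funext => y; rewrite /E !mxE.
    rewrite partialB; last 2 first.
    - exact: regular_at_differentiable (rFK j).
    - apply: (@regular_at_differentiable _ _ k).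
      apply: (regular_map_rsubmx (f := lsubmx) _ j); exact: regular_lsubmx.
    by rewrite (partial_lsubmx_r (fun y : 'rV[R]_N => rsubmx y 0 j)) subr0.
  rewrite (gradient_mx_comp (rK 0)) ?K0// (gradient_dF_beta rF oF).
  rewrite -[gradient_mx K 0]vsubmxK gK mul_col_mx col_mxKd mul_row_col mul0mx add0r.
  exact: PA.
have uE : dsubmx (gradient_mx E 0) \in unitmx by rewrite gE unitmx1.
have [s [s0 rs sP]] := implicit_function E0 rE uE.
have rws : regular_map_at k (0 : 'rV[R]_N) (fun w => row_mx w (s w)).
  by apply: regular_map_row_mx => //; exact: regular_map_id.
have ws0 : row_mx (0 : 'rV[R]_N) (s 0) = 0 by rewrite s0 row_mx0.
have Es : \forall w \near (0 : 'rV[R]_N), E (row_mx w (s w)) = 0.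
  by apply: near_sub (near_regular rws ws0 sP) => w; rewrite row_mxKl row_mxKr => ->.
exists (fun w => K (row_mx w (s w))); split.
- by rewrite ws0 K0.
- by apply: (regular_map_comp rws); exact: rK.
- by move=> w; rewrite /K !row_mxKl.
- apply: near_sub Es => w; rewrite /E row_mxKl => /eqP.
  by rewrite subr_eq0 => /eqP.
- pose j (x : 'rV[R]_(n + m)) : 'rV[R]_(N + n) := row_mx (row_mx x (dF_beta F x)) 0.
  have rj : regular_map_at k 0 j.
    apply: regular_map_row_mx; last exact: regular_map_cst.
    by apply: regular_map_row_mx => //; exact: regular_map_id.
  have j0 : j 0 = 0 by rewrite /j F0 !row_mx0.
  apply: near_sub (near_regular rj j0 sP) => x; rewrite /j row_mxKl row_mxKr => sPx.
  have Kj : K (row_mx (row_mx x (dF_beta F x)) 0) = x.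
    by rewrite /K !row_mxKl row_mxKr mul0mx addr0 hsubmxK.
  by rewrite -(iffLR sPx) ?Kj// /E Kj row_mxKl row_mxKr subrr.
Qed.

(** On the critical set, which [straighten] parametrises, dF_lambda F =
    dF_lambda G o (e, lambda). Differentiating along beta at the origin
    shows that the transposed mixed block of F, of rank n, factors through
    D. *)
Lemma matching_rank n2 F (G : 'rV[R]_(n2 + m) -> R) e D :
  critical_family k F -> critical_family k G -> e 0 = 0 -> regular_map_at k 0 e ->
  (\forall x \near (0 : 'rV[R]_(n + m)), dF_beta F x = 0 ->
    dF_lambda G (row_mx (e x) (rsubmx x)) = dF_lambda F x) ->
  gradient_mx e 0 = col_mx D 0 -> \rank D = n.
Proof.
move=> cF cG e0 re eP gD; have [r [r0 rr lr rb _]] := straighten cF.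
have [rF oF F0 _] := cF; have [rG oG G0 _] := cG.
have [_ rFl] := dF_regular rF; have [_ rGl] := dF_regular rG.
pose j (x : 'rV[R]_(n + m)) := row_mx x (0 : 'rV[R]_n).
have rj x : regular_map_at k x j.
  by apply: regular_map_row_mx; [exact: regular_map_id|exact: regular_map_cst].
have j0 : j 0 = 0 by rewrite /j row_mx0.
pose rho x := r (j x).
have rho0 : rho 0 = 0 by rewrite /rho j0.
have rrho : regular_map_at k 0 rho by apply: (regular_map_comp (rj 0)); rewrite j0.
pose H x := row_mx (e x) (rsubmx x).
have H0 : H 0 = 0 by rewrite /H e0 rsubmx_const row_mx_const.
have rH : regular_map_at k 0 H.
  by apply: regular_map_row_mx => //; exact: regular_rsubmx.
have gH : gradient_mx H 0 = row_mx (col_mx D 0) (col_mx 0 1%:M).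
  by rewrite [LHS]gradient_mx_row_mx gD (gradient_base (fun y => y)) gradient_mx_id.
have E : \forall x \near (0 : 'rV[R]_(n + m)),
    (dF_lambda F \o rho) x = (dF_lambda G \o (H \o rho)) x.
  apply: near_sub (near_and (near_regular (rj 0) j0 rb) (near_regular rrho rho0 eP)).
  by move=> x [rbx ePx] /=; rewrite -ePx// [LHS]rbx row_mxKr.
have rHrho : regular_map_at k 0 (H \o rho) by apply: regular_map_comp; rewrite ?rho0.
have Hrho0 : (H \o rho) 0 = 0 by rewrite /= rho0.
have := gradient_mx_eq E.
rewrite (gradient_mx_comp rrho) ?rho0// (gradient_mx_comp rHrho) ?Hrho0//.
rewrite (gradient_mx_comp rrho) ?rho0// !(gradient_dF_lambda rF, gradient_dF_lambda rG)//.
rewrite gH -mulmxA mul_row_col mulmx0 addr0.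
have lrho : lsubmx (usubmx (gradient_mx rho 0)) = 1%:M.
  apply/matrixP => i l; rewrite !mxE.
  have -> : (fun y => rho y 0 (lshift m l)) = (fun y => y 0 (lshift m l)).
    apply/funext => y; have /rowP/(_ l) := lr (j y).
    by rewrite /j row_mxKl !mxE.
  by rewrite partial_coord (inj_eq (@lshift_inj _ _)).
move=> /(congr1 usubmx); rewrite -[gradient_mx rho 0]vsubmxK !mul_col_mx !col_mxKu.
rewrite -[usubmx _]hsubmxK lrho !mul_row_col !mul0mx !mulmx0 !addr0 !mul1mx => AD.
have rkA : \rank (mixed F)^T = n.
  have [_ _ _] := cF; rewrite (gradient_dF_beta rF oF) rank_col_0mx mxrank_tr.
  by [].
apply/eqP; rewrite eqn_leq rank_leq_row/= -{1}rkA AD.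
exact: mxrankM_maxl.
Qed.

End Straighten.

Section Quadratic.
Variables (R : realType) (k : category) (m n : nat).
Implicit Types (F G : 'rV[R]_(n + m) -> R).

Lemma half_double (c : R) : 2^-1 * (c - - c) = c.
Proof. by lra. Qed.

(** A quadratic form that changes sign with the reflected matrix is given
    by the odd part of its matrix. *)
Lemma odd_part_form (v : 'rV[R]_n) (A B : 'M[R]_n) c :
  (v *m A *m v^T) 0 0 = c -> (v *m B *m v^T) 0 0 = - c ->
  (v *m (2^-1 *: (A - B)) *m v^T) 0 0 = c.
Proof.
move=> Ac Bc; rewrite -scalemxAr -scalemxAl mxE mulmxBr mulmxBl mxE Ac mxE Bc.
exact: half_double.
Qed.

(** By [critical_transfer] all partial derivatives of the difference vanish
    at the critical points of F. In the coordinates of [straighten] these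
    are the points with w = 0, so [taylor2] applies; setting w = [dF_beta F
    x] comes back to x. Since the difference is odd and [dF_beta F] even,
    only the odd part of the matrix matters. *)
Lemma critical_difference F G e :
  critical_family k F -> regular_at k 0 G -> odd_family G -> e 0 = 0 ->
  regular_map_at k 0 e -> (\forall x \near (0 : 'rV[R]_(n + m)), e (zeta x) = - e x) ->
  (\forall x \near (0 : 'rV[R]_(n + m)), dF_beta F x = 0 ->
     dF_beta G (row_mx (e x) (rsubmx x)) = 0 /\
     dF_lambda G (row_mx (e x) (rsubmx x)) = dF_lambda F x) ->
  exists A : 'rV[R]_(n + m) -> 'M[R]_n,
    [/\ forall i j, regular_at k 0 (fun x => A x i j), forall x, A (zeta x) = - A x &
      \forall x \near (0 : 'rV[R]_(n + m)),
        F x - G (row_mx (e x) (rsubmx x)) = (dF_beta F x *m A x *m (dF_beta F x)^T) 0 0].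
Proof.
move=> cF rG oG e0 re oe eP; have [r [r0 rr lr rb rK]] := straighten cF.
have [rF oF F0 _] := cF; have [rFb _] := dF_regular rF.
pose H x := row_mx (e x) (rsubmx x).
have H0 : H 0 = 0 by rewrite /H e0 rsubmx_const row_mx_const.
have rH : regular_map_at k 0 H.
  by apply: regular_map_row_mx => //; exact: regular_rsubmx.
have rGH : regular_at k 0 (G \o H) by apply: regular_at_comp => //; rewrite H0.
pose u x := F x - (G \o H) x.
have ru : regular_at k 0 u by exact: regular_at_sub.
have fH : \forall y \near (0 : 'rV[R]_(n + m)), rsubmx (H y) = id (rsubmx y).
  by apply: near_all => y; rewrite /H row_mxKr.
have GE : \forall y \near (0 : 'rV[R]_(n + m)), (G \o H) y = G (H y).
  exact: near_all.
have Du : \forall x \near (0 : 'rV[R]_(n + m)), dF_beta F x = 0 ->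
    forall i, partial i u x = 0.
  have T := critical_transfer H0 rH rG (regular_map_id _ _) fH GE.
  apply: near_sub (near_and (near_and eP T) (near_and (regular_at_near rF) (regular_at_near rGH))).
  move=> x [[ePx Tx] [rFx rGHx]] Fx; have [Gb Gl] := ePx Fx; have [Hb Hl] := Tx Gb.
  move=> i; rewrite partialB; last 2 first.
  - exact: regular_at_differentiable rFx.
  - exact: regular_at_differentiable rGHx.
  case: (split_ordP i) => l ->.
    have /rowP/(_ l) := Fx; have /rowP/(_ l) := Hb; rewrite !mxE => -> ->.
    by rewrite subr0.
  have GlH : dF_lambda G (H x) = dF_lambda F x by exact: Gl.
  have /rowP/(_ l) := Hl; rewrite gradient_mx_id trmx1 mulmx1 GlH.
  by rewrite !mxE => ->; rewrite subrr.
pose U w := u (r w).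
have rU : regular_at k 0 U by apply: (regular_at_comp (f := u) rr); rewrite r0.
pose j (x : 'rV[R]_(n + m)) := row_mx x (0 : 'rV[R]_n).
have rj x : regular_map_at k x j.
  by apply: regular_map_row_mx; [exact: regular_map_id|exact: regular_map_cst].
have j0 : j 0 = 0 by rewrite /j row_mx0.
have DU : \forall x \near (0 : 'rV[R]_(n + m)), forall i, partial i U (j x) = 0.
  have rrj : regular_map_at k 0 (r \o j) by apply: regular_map_comp; rewrite ?j0.
  have rj0 : (r \o j) 0 = 0 by rewrite /= j0.
  apply: near_sub (near_and (near_and (near_regular (rj 0) j0 rb) (near_regular rrj rj0 Du))
    (near_and (near_regular (rj 0) j0 (regular_map_near rr))
       (near_regular rrj rj0 (regular_at_near ru)))).
  move=> x [[rbx Dux] [rrx rux]] i; rewrite (@partial_comp _ _ _ u r).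
  - by rewrite big1// => l _; rewrite [partial l u _]Dux ?mulr0// [LHS]rbx row_mxKr.
  - by move=> l; exact: regular_at_differentiable (rrx l).
  - exact: regular_at_differentiable rux.
have U0 : \forall x \near (0 : 'rV[R]_(n + m)), U (j x) = 0.
  have /near0P[d d0 dP] := near_and DU (near_regular (rj 0) j0 (regular_at_near rU)).
  have nd : \forall x \near (0 : 'rV[R]_(n + m)), `|x| < d by exact: near0_norm_lt.
  apply: near_sub nd => x xd; have := @partial_zero_const R _ (fun x => U (j x)) d x _ _ xd.
  rewrite j0 => ->.
  - rewrite /U r0 /u /= H0; have := nbhs_singleton (odd_family_axis oF).
    by have := nbhs_singleton (odd_family_axis oG); rewrite !row_mx0 => -> ->; rewrite subrr.
  - move=> y /dP[_ rUy]; apply: (@regular_at_differentiable _ _ k).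
    exact: (regular_slice rUy).
  - by move=> y i /dP[Dy _]; rewrite partial_row_mx_l; exact: Dy.
have [i|A [rA AE]] := taylor2 rU U0; first by apply: near_sub DU => x; exact.
pose q (x : 'rV[R]_(n + m)) := row_mx x (dF_beta F x).
have rq : regular_map_at k 0 q by apply: regular_map_row_mx => //; exact: regular_map_id.
have q0 : q 0 = 0 by rewrite /q F0 row_mx0.
pose A1 x := A (q x).
have uA : \forall x \near (0 : 'rV[R]_(n + m)), u x = (dF_beta F x *m A1 x *m (dF_beta F x)^T) 0 0.
  apply: near_sub (near_and rK (near_regular rq q0 AE)) => x [rKx].
  by rewrite /U rKx row_mxKr.
have rA1 a b : regular_at k 0 (fun x => A1 x a b).
  by apply: (regular_at_comp (f := fun w => A w a b) rq); rewrite q0.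
exists (fun x => 2^-1 *: (A1 x - A1 (zeta x))); split.
- move=> a b; apply: (@regular_at_eq _ _ _ _ (fun x => 2^-1 * (A1 x a b - A1 (zeta x) a b))).
    by apply: near_all => x; rewrite !mxE.
  apply: regular_at_mul; first exact: regular_at_cst.
  apply: regular_at_sub => //.
  apply: (regular_at_comp (f := fun x => A1 x a b) (regular_zeta k 0)).
  by rewrite zeta0.
- by move=> x; rewrite zetaK -scalerN opprB.
- have ou : \forall x \near (0 : 'rV[R]_(n + m)), u (zeta x) = - u x.
    apply: near_sub (near_and oF (near_and oe (near_regular rH H0 oG))) => x [Fx [ex Gx]].
    rewrite /u /= Fx; have -> : H (zeta x) = zeta (H x).
      by rewrite /H ex zeta_row_mx /zeta row_mxKr.
    by rewrite Gx opprB opprK addrC.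
  apply: near_sub (near_and (near_and uA (near_zeta uA)) (near_and ou (odd_family_dF rF oF))).
  move=> x [[ux uzx] [oux [Fbx _]]]; rewrite Fbx oux in uzx.
  by rewrite (odd_part_form (esym ux) (esym uzx)).
Qed.

(** Taylor's formula of order two for F in beta, with a remainder matrix
    that is odd because F is. *)
Lemma second_order F : regular_at k 0 F -> odd_family F ->
  exists H : 'rV[R]_((n + m) + n) -> 'M[R]_n,
    [/\ forall i j, regular_at k 0 (fun w => H w i j),
      forall x v, H (row_mx (zeta x) (- v)) = - H (row_mx x v) &
      \forall w \near (0 : 'rV[R]_((n + m) + n)),
        F (row_mx (lsubmx (lsubmx w) + rsubmx w) (rsubmx (lsubmx w))) =
        F (lsubmx w) + (rsubmx w *m (dF_beta F (lsubmx w))^T) 0 0 +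
        (rsubmx w *m H w *m (rsubmx w)^T) 0 0].
Proof.
move=> rF oF; have [rFb _] := dF_regular rF.
pose N := ((n + m) + n)%N.
pose K (w : 'rV[R]_N) : 'rV[R]_(n + m) := row_mx (lsubmx (lsubmx w) + rsubmx w) (rsubmx (lsubmx w)).
have rl x : regular_map_at k x (lsubmx : 'rV[R]_N -> 'rV[R]_(n + m)) by exact: regular_lsubmx.
have l0 : lsubmx (0 : 'rV[R]_N) = 0 :> 'rV[R]_(n + m) by rewrite lsubmx_const.
have rK x : regular_map_at k x K.
  apply: regular_map_row_mx; last exact: regular_map_rsubmx.
  by apply: regular_map_add; [exact: regular_map_lsubmx|exact: regular_rsubmx].
have K0 : K 0 = 0 by rewrite /K !(lsubmx_const, rsubmx_const) addr0 row_mx_const.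
pose V w := F (K w) - F (lsubmx w) - \sum_i rsubmx w 0 i * dF_beta F (lsubmx w) 0 i.
have rV : regular_at k 0 V.
  apply: regular_at_sub.
    apply: regular_at_sub.
      by apply: (regular_at_comp (f := F) (rK 0)); rewrite K0.
    by apply: (regular_at_comp (f := F) (rl 0)); rewrite l0.
  apply: regular_at_sum => i _; apply: regular_at_mul; first exact: regular_rsubmx.
  apply: (regular_at_comp (f := fun x => dF_beta F x 0 i) (rl 0)); rewrite l0.
  exact: rFb.
have V0 : \forall x \near (0 : 'rV[R]_(n + m)), V (row_mx x 0) = 0.
  apply: near_all => x; rewrite /V /K !row_mxKl row_mxKr addr0 hsubmxK subrr sub0r.
  by rewrite big1 ?oppr0// => i _; rewrite mxE mul0r.
have DV i : \forall x \near (0 : 'rV[R]_(n + m)), partial (rshift (n + m) i) V (row_mx x 0) = 0.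
  apply: near_sub (regular_at_near rF) => x rFx; rewrite -partial_row_mx_r.
  have -> : (fun y => V (row_mx x y)) = (fun y => F (row_mx (lsubmx x + y) (rsubmx x)) - F x -
      linform (fun i => dF_beta F x 0 i) y).
    by apply/funext => y; rewrite /V /K !row_mxKl row_mxKr.
  have rs : regular_at k 0 (fun y => F (row_mx (lsubmx x + y) (rsubmx x))).
    have rsh := regular_shift k (lsubmx x) 0.
    apply: (regular_at_comp (f := fun y => F (row_mx y (rsubmx x))) rsh).
    by apply: regular_slice; rewrite addr0 hsubmxK.
  have dl : differentiable (linform (fun i => dF_beta F x 0 i)) (0 : 'rV[R]_n).
    apply: differentiable_bigsum => l; apply: differentiableM.
      exact: regular_at_differentiable (regular_at_coord k _ _).
    exact: differentiable_cst.
  have ds := regular_at_differentiable rs.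
  rewrite partialB//; last by apply: differentiableB => //; exact: differentiable_cst.
  rewrite partialB//.
  rewrite partial_cst subr0 partial_linform mxE.
  rewrite (partial_shift (fun y => F (row_mx y (rsubmx x)))) partial_row_mx_l addr0 hsubmxK.
  by rewrite subrr.
have [A [rA AE]] := taylor2 rV V0 DV.
pose tau (w : 'rV[R]_N) : 'rV[R]_N := row_mx (zeta (lsubmx w)) (- rsubmx w).
have rtau x : regular_map_at k x tau.
  apply: regular_map_row_mx; last by apply: regular_map_opp; exact: regular_rsubmx.
  by apply: (regular_map_comp (rl x)); exact: regular_zeta.
have tau0 : tau 0 = 0 by rewrite /tau !(lsubmx_const, rsubmx_const) zeta0 oppr0 row_mx_const.
have oV : \forall w \near (0 : 'rV[R]_N), V (tau w) = - V w.
  apply: near_sub (near_and (near_regular (rK 0) K0 oF)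
    (near_and (near_regular (rl 0) l0 oF) (near_regular (rl 0) l0 (odd_family_dF rF oF)))).
  move=> w [FK [Fl [Fbl _]]]; rewrite /V.
  have -> : K (tau w) = zeta (K w).
    rewrite /K /tau !row_mxKl !row_mxKr zeta_row_mx opprD.
    by [].
  rewrite FK /tau row_mxKl row_mxKr Fl Fbl !opprB opprK -sumrN addrC.
  under eq_bigr => i _ do rewrite mxE mulNr opprK.
  by rewrite addrA [F _ + _]addrC !addrA.
exists (fun w => 2^-1 *: (A w - A (tau w))); split.
- move=> a b; apply: (@regular_at_eq _ _ _ _ (fun x => 2^-1 * (A x a b - A (tau x) a b))).
    by apply: near_all => x; rewrite !mxE.
  apply: regular_at_mul; first exact: regular_at_cst.
  apply: regular_at_sub => //.
  apply: (regular_at_comp (f := fun x => A x a b) (rtau 0)).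
  by rewrite tau0.
- move=> x v; rewrite /tau !row_mxKl !row_mxKr zetaK opprK -scalerN opprB.
  by [].
- apply: near_sub (near_and (near_and AE (near_regular (rtau 0) tau0 AE)) oV) => w [[Aw Atw] oVw].
  have rt : rsubmx (tau w) = - rsubmx w by rewrite /tau row_mxKr.
  rewrite oVw rt mulNmx linearN/= mulmxN mulNmx opprK in Atw.
  have -> : F (row_mx (lsubmx (lsubmx w) + rsubmx w) (rsubmx (lsubmx w))) = V w + F (lsubmx w) +
      (rsubmx w *m (dF_beta F (lsubmx w))^T) 0 0.
    have -> : (rsubmx w *m (dF_beta F (lsubmx w))^T) 0 0 =
        \sum_i rsubmx w 0 i * dF_beta F (lsubmx w) 0 i.
      by rewrite mxE; apply: eq_bigr => i _; rewrite [_^T _ _]mxE.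
    rewrite -/(K w) /V; move: (\sum_i _) (F (K w)) (F (lsubmx w)) => a b c.
    by ring.
  rewrite (odd_part_form (esym Aw) (esym Atw)) -addrA addrC.
  by [].
Qed.

End Quadratic.

(** * Absorbing the difference of two families *)

Section Correction.
Variables (R : realType) (k : category) (m n : nat).

Lemma regular_mx_mul N p q r (x : 'rV[R]_N) (A : 'rV[R]_N -> 'M[R]_(p, q))
    (B : 'rV[R]_N -> 'M[R]_(q, r)) :
  (forall i j, regular_at k x (fun y => A y i j)) ->
  (forall i j, regular_at k x (fun y => B y i j)) ->
  forall i j, regular_at k x (fun y => (A y *m B y) i j).
Proof.
move=> rA rB i j; apply: (@regular_at_eq _ _ _ _ (fun y => \sum_l A y i l * B y l j)).
  by apply: near_all => y; rewrite mxE.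
by apply: regular_at_sum => l _; exact: regular_at_mul.
Qed.

Lemma partial_mul_zero N (f g : 'rV[R]_N -> R) x i : differentiable f x ->
  differentiable g x -> f x = 0 -> g x = 0 -> partial i (fun y => f y * g y) x = 0.
Proof. by move=> df dg f0 g0; rewrite partialM// f0 g0 mulr0 mul0r addr0. Qed.

Lemma partial_mulmx_zero N p q r (x : 'rV[R]_N) (A : 'rV[R]_N -> 'M[R]_(p, q))
    (B : 'rV[R]_N -> 'M[R]_(q, r)) i j l :
  (forall i j, regular_at k x (fun y => A y i j)) ->
  (forall i j, regular_at k x (fun y => B y i j)) -> A x = 0 -> B x = 0 ->
  partial l (fun y => (A y *m B y) i j) x = 0.
Proof.
move=> rA rB A0 B0; have dA a b := regular_at_differentiable (rA a b).
have dB a b := regular_at_differentiable (rB a b).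
have -> : (fun y => (A y *m B y) i j) = (fun y => \sum_l A y i l * B y l j).
  by apply/funext => y; rewrite mxE.
rewrite partial_sum => [|a]; last exact: differentiableM.
by apply: big1 => a _; rewrite partial_mul_zero ?A0 ?B0 ?mxE.
Qed.

(** Put v = f B with f = [dF_beta F x]. By [second_order], F (beta + v,
    lambda) = F x + f (B + B H B^T) f^T, where H is taken at (x, f B). So
    it suffices that B + B H B^T + A = 0. The quadratic term is of order
    two in B and A vanishes at the origin, so the implicit function theorem
    applies with the identity as partial derivative; B is odd by
    uniqueness. *)
Lemma quadratic_correction (F : 'rV[R]_(n + m) -> R) (A : 'rV[R]_(n + m) -> 'M[R]_n) :
  regular_at k 0 F -> odd_family F -> dF_beta F 0 = 0 ->
  (forall i j, regular_at k 0 (fun x => A x i j)) -> (forall x, A (zeta x) = - A x) ->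
  exists B : 'rV[R]_(n + m) -> 'M[R]_n,
    [/\ forall i j, regular_at k 0 (fun x => B x i j), B 0 = 0,
      \forall x \near (0 : 'rV[R]_(n + m)), B (zeta x) = - B x &
      \forall x \near (0 : 'rV[R]_(n + m)),
        F (row_mx (lsubmx x + dF_beta F x *m B x) (rsubmx x)) =
        F x - (dF_beta F x *m A x *m (dF_beta F x)^T) 0 0].
Proof.
move=> rF oF F0 rA oA; have [H [rH oH HE]] := second_order rF oF.
have [rFb _] := dF_regular rF.
have A0 : A 0 = 0 by apply: self_opp; rewrite -oA zeta0.
pose N := ((n + m) + n * n)%N.
(* z = (x, c), where c lists the entries of the unknown matrix *)
pose b (z : 'rV[R]_N) : 'M[R]_n := vec_mx (rsubmx z).
pose h (z : 'rV[R]_N) : 'rV[R]_((n + m) + n) := row_mx (lsubmx z) (dF_beta F (lsubmx z) *m b z).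
pose Q z := b z *m H (h z) *m (b z)^T + A (lsubmx z).
pose E z : 'rV[R]_(n * n) := rsubmx z + mxvec (Q z).
have b0 : b 0 = 0 by rewrite /b rsubmx_const linear0.
have h0 : h 0 = 0 by rewrite /h b0 mulmx0 lsubmx_const row_mx0.
have l0 : lsubmx (0 : 'rV[R]_N) = 0 :> 'rV[R]_(n + m) by rewrite lsubmx_const.
have rl x : regular_map_at k x (lsubmx : 'rV[R]_N -> 'rV[R]_(n + m)) by exact: regular_lsubmx.
have rb x i j : regular_at k x (fun z => b z i j).
  apply: regular_at_eq (@regular_rsubmx _ k _ _ x (mxvec_index i j)).
  by apply: near_all => z; rewrite /b [RHS]mxE.
have rFl : regular_map_at k 0 (fun z : 'rV[R]_N => dF_beta F (lsubmx z)).
  by apply: (regular_map_comp (rl 0)); rewrite l0.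
have rh : regular_map_at k 0 h.
  by apply: regular_map_row_mx => //; exact: regular_map_mulmx.
have rHh i j : regular_at k 0 (fun z => H (h z) i j).
  by apply: (regular_at_comp (f := fun w => H w i j) rh); rewrite h0.
have rbH := regular_mx_mul (rb 0) rHh.
have rbT i j : regular_at k 0 (fun z => (b z)^T i j).
  by apply: regular_at_eq (rb 0 j i); apply: near_all => z; rewrite [RHS]mxE.
have rbHb := regular_mx_mul rbH rbT.
have rAl i j : regular_at k 0 (fun z : 'rV[R]_N => A (lsubmx z) i j).
  by apply: (regular_at_comp (f := fun x => A x i j) (rl 0)); rewrite l0.
have EE i j : (fun z => E z 0 (mxvec_index i j)) = (fun z => rsubmx z 0 (mxvec_index i j) +
    ((b z *m H (h z) *m (b z)^T) i j + A (lsubmx z) i j)).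
  apply/funext => z; rewrite /E [LHS]mxE mxvecE.
  by rewrite /Q; congr (_ + _); rewrite mxE.
have rE : regular_map_at k 0 E.
  move=> l; case/mxvec_indexP: l => i j; rewrite EE.
  apply: regular_at_add; first exact: regular_rsubmx.
  by apply: regular_at_add; [exact: rbHb|exact: rAl].
have E0 : E 0 = 0.
  by rewrite /E rsubmx_const add0r /Q b0 !mul0mx l0 A0 addr0 linear0.
have gE : dsubmx (gradient_mx E 0) = 1%:M.
  apply/matrixP => a l; case/mxvec_indexP: l => i j; rewrite !mxE EE.
  have d1 : differentiable (fun z : 'rV[R]_N => rsubmx z 0 (mxvec_index i j)) 0.
    by apply: (@regular_at_differentiable _ _ k); exact: regular_rsubmx.
  have d2 := regular_at_differentiable (rbHb i j).
  have d3 := regular_at_differentiable (rAl i j).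
  rewrite partialD//; last exact: differentiableD.
  rewrite partialD// (partial_lsubmx_r (fun x => A x i j)) addr0.
  rewrite (partial_mulmx_zero _ _ _ rbH rbT) ?b0 ?mul0mx ?trmx0// addr0.
  by rewrite (partial_rsubmx_r (fun y : 'rV[R]_(n * n) => y 0 (mxvec_index i j))) partial_coord.
have uE : dsubmx (gradient_mx E 0) \in unitmx by rewrite gE unitmx1.
have [c [c0 rc cP]] := implicit_function E0 rE uE.
have rxc : regular_map_at k (0 : 'rV[R]_(n + m)) (fun x => row_mx x (c x)).
  by apply: regular_map_row_mx => //; exact: regular_map_id.
have xc0 : row_mx (0 : 'rV[R]_(n + m)) (c 0) = 0 by rewrite c0 row_mx0.
have Ec : \forall x \near (0 : 'rV[R]_(n + m)), E (row_mx x (c x)) = 0.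
  by apply: near_sub (near_regular rxc xc0 cP) => w; rewrite row_mxKl row_mxKr => ->.
exists (fun x => vec_mx (c x)); split.
- move=> i j; apply: regular_at_eq (rc (mxvec_index i j)).
  by apply: near_all => z; rewrite [RHS]mxE.
- by rewrite c0 linear0.
- have rzc : regular_map_at k (0 : 'rV[R]_(n + m)) (fun x => row_mx (zeta x) (- c x)).
    by apply: regular_map_row_mx; [exact: regular_zeta|exact: regular_map_opp].
  have zc0 : row_mx (zeta (0 : 'rV[R]_(n + m))) (- c 0) = 0.
    by rewrite c0 oppr0 zeta0 row_mx0.
  apply: near_sub (near_and (near_and Ec (near_regular rzc zc0 cP)) (odd_family_dF rF oF)).
  move=> x [[Ex]]; rewrite row_mxKl row_mxKr => cP' [Fb _].
  suff : - c x = c (zeta x) by move=> <-; rewrite linearN.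
  apply/cP'; move: Ex; rewrite /E /Q /h /b !row_mxKl !row_mxKr Fb.
  have -> : vec_mx (- c x) = - (vec_mx (c x) : 'M[R]_n) by apply/matrixP => i j; rewrite !mxE.
  set B := vec_mx (c x); have -> : (- B)^T = - B^T by apply/matrixP => i j; rewrite !mxE.
  rewrite [dF_beta F x *m - _]mulmxN oH oA !(mulmxN, mulNmx) !opprK -opprD => /eqP.
  rewrite addr_eq0 => /eqP ->; apply/rowP => l; case/mxvec_indexP: l => i j.
  by rewrite !mxE !mxvecE !mxE opprK subrr.
- have h0' : h (row_mx 0 (c 0)) = 0 by rewrite xc0.
  have rhc : regular_map_at k (0 : 'rV[R]_(n + m)) (fun x => h (row_mx x (c x))).
    by apply: (regular_map_comp rxc); rewrite xc0.
  apply: near_sub (near_and Ec (near_regular rhc h0' HE)) => x [Ex].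
  rewrite /h /b !row_mxKl !row_mxKr => ->.
  set B := vec_mx (c x); set f := dF_beta F x; set Hx := H _.
  have BE : B *m Hx *m B^T = - B - A x.
    rewrite -opprD; apply/eqP; rewrite -addr_eq0 addrCA; apply/eqP.
    apply: (can_inj mxvecK); rewrite linearD/= vec_mxK linear0.
    by move: Ex; rewrite /E /Q /h /b !row_mxKl !row_mxKr.
  have -> : f *m B *m Hx *m (f *m B)^T = f *m (B *m Hx *m B^T) *m f^T.
    by rewrite trmx_mul !mulmxA.
  have -> : f *m B *m f^T = f *m (B *m f^T) by rewrite mulmxA.
  rewrite BE mulmxBr mulmxBl mulmxN mulNmx mulmxA -addrA [X in _ + (_ + X)]mxE.
  by rewrite [X in _ + (_ + (X + _))]mxE addNKr [X in _ + X]mxE.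
Qed.

End Correction.

Section Equivalence.
Variables (R : realType) (k : category) (m : nat).

Lemma inverse_germs_zeta n1 n2 (f : 'rV[R]_(n1 + m) -> 'rV[R]_(n2 + m)) g :
  inverse_germs k f g ->
  (\forall x \near (0 : 'rV[R]_(n1 + m)), f (zeta x) = zeta (f x)) ->
  \forall y \near (0 : 'rV[R]_(n2 + m)), g (zeta y) = zeta (g y).
Proof.
move=> [[f0 g0] rf rg gf fg] fz.
apply: near_sub (near_and (near_and fg (near_regular rg g0 fz))
  (near_regular rg g0 (near_zeta gf))) => y [[fgy fzy] gfy].
by rewrite -[RHS]gfy fzy fgy.
Qed.

(** With H = (e, lambda) from [matching] and K = (beta + dF_beta F . B,
    lambda) from [quadratic_correction], F o K = G o H, whence F = G o (H o
    K^-1). *)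
Lemma odd_families_equivalent n1 n2 (F : 'rV[R]_(n1 + m) -> R) (G : 'rV[R]_(n2 + m) -> R) :
  critical_family k F -> critical_family k G ->
  critical_points_matched F G -> critical_points_matched G F ->
  exists Psi g, [/\ inverse_germs k Psi g,
    \forall x \near (0 : 'rV[R]_(n1 + m)), rsubmx (Psi x) = rsubmx x,
    \forall x \near (0 : 'rV[R]_(n1 + m)), Psi (zeta x) = zeta (Psi x) &
    \forall x \near (0 : 'rV[R]_(n1 + m)), F x = G (Psi x)].
Proof.
move=> cF cG FG GF.
have [e [e0 re oe eP [D gD]]] := matching cF cG FG.
have [e' [e'0 re' oe' eP' [D' gD']]] := matching cG cF GF.
have rkD : \rank D = n1.
  apply: matching_rank cF cG e0 re _ gD.
  by apply: near_sub eP => x ePx /ePx[].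
have rkD' : \rank D' = n2.
  apply: matching_rank cG cF e'0 re' _ gD'.
  by apply: near_sub eP' => x ePx /ePx[].
(* D is n1 by n2 of rank n1, and D' is n2 by n1 of rank n2 *)
have n12 : n1 = n2.
  by apply/eqP; rewrite eqn_leq -{1}rkD rank_leq_col -rkD' rank_leq_col.
move: (n1) n12 F e D cF FG GF e0 re oe eP gD rkD e' {D' e'0 re' oe' eP' gD' rkD'}.
move=> n ? F e D cF FG GF e0 re oe eP gD rkD _; subst n2.
have [rF oF F0 _] := cF; have [rG oG G0 _] := cG; have [rFb _] := dF_regular rF.
pose H x := row_mx (e x) (rsubmx x).
have H0 : H 0 = 0 by rewrite /H e0 rsubmx_const row_mx_const.
have rH : regular_map_at k 0 H.
  by apply: regular_map_row_mx => //; exact: regular_rsubmx.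
have /(inverse_function H0 rH)/diffeo_germP[H' iH] : gradient_mx H 0 \in unitmx.
  rewrite [gradient_mx _ _]gradient_mx_row_mx gD (gradient_base (fun y => y)) gradient_mx_id.
  rewrite -block_mxEh unitmxE det_lblock det1 mulr1 -unitmxE.
  by rewrite -row_free_unit /row_free rkD.
have [A [rA oA AE]] := critical_difference cF rG oG e0 re oe eP.
have [B [rB B0 oB BE]] := quadratic_correction rF oF F0 rA oA.
pose K x := row_mx (lsubmx x + dF_beta F x *m B x) (rsubmx x).
have K0 : K 0 = 0 by rewrite /K B0 mulmx0 addr0 hsubmxK.
have rFB : regular_map_at k 0 (fun x => dF_beta F x *m B x) by exact: regular_map_mulmx.
have rK : regular_map_at k 0 K.
  apply: regular_map_row_mx; last exact: regular_rsubmx.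
  by apply: regular_map_add => //; exact: regular_lsubmx.
have /(inverse_function K0 rK)/diffeo_germP[K' iK] : gradient_mx K 0 \in unitmx.
  suff -> : gradient_mx K 0 = gradient_mx id 0 by rewrite gradient_mx_id unitmx1.
  apply/matrixP => i j; rewrite !mxE; case: (split_ordP j) => l ->; last first.
    suff -> : (fun x => K x 0 (rshift n l)) = (fun x => x 0 (rshift n l)) by [].
    by apply/funext => x; rewrite /K row_mxEr mxE.
  have -> : (fun x => K x 0 (lshift m l)) = (fun x => x 0 (lshift m l) + (dF_beta F x *m B x) 0 l).
    by apply/funext => x; rewrite /K row_mxEl !mxE.
  rewrite partialD; last 2 first.
  - exact: regular_at_differentiable (regular_at_coord k _ _).
  - exact: regular_at_differentiable (rFB l).
  rewrite (@partial_mulmx_zero _ k) ?addr0// => a b.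
  by rewrite (ord1 a); exact: rFb.
have [[_ K'0] _ rK' KK' K'K] := iK.
have KH : \forall x \near (0 : 'rV[R]_(n + m)), F (K x) = G (H x).
  apply: near_sub (near_and AE BE) => x [AEx BEx].
  by rewrite [LHS]BEx -AEx opprB addrC subrK.
have oK : \forall x \near (0 : 'rV[R]_(n + m)), K (zeta x) = zeta (K x).
  apply: near_sub (near_and oB (odd_family_dF rF oF)) => x [oBx [oFx _]].
  by rewrite /K oBx oFx mulmxN zeta_row_mx opprD /zeta row_mxKl row_mxKr.
have oH : \forall x \near (0 : 'rV[R]_(n + m)), H (zeta x) = zeta (H x).
  by apply: near_sub oe => x oex; rewrite /H oex zeta_row_mx /zeta row_mxKr.
exists (H \o K'), (K \o H'); split.
- by have := inverse_germs_comp (inverse_germs_sym iK) iH.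
- apply: near_sub K'K => y K'Ky /=.
  by rewrite /H row_mxKr -{2}K'Ky /K row_mxKr.
- have oK' := inverse_germs_zeta iK oK.
  by apply: near_sub (near_and oK' (near_regular rK' K'0 oH)) => x [/= -> ->].
- by apply: near_sub (near_and K'K (near_regular rK' K'0 KH)) => x [E <-]; rewrite E.
Qed.

End Equivalence.

(** * From Lagrangian germs to families and back *)

Section Final.
Variables (R : realType) (k : category) (m : nat).

(** A critical point x of F gives the point (dF_lambda F x, lambda) of L,
    close to 0 because dF_lambda F vanishes at 0; this point is generated
    by G over the given neighbourhood. *)
Lemma generates_critical_points_matched n1 n2 (F : 'rV[R]_(n1 + m) -> R)
    (G : 'rV[R]_(n2 + m) -> R) L :
  regular_at k 0 F -> odd_family F -> generates F L -> generates G L ->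
  critical_points_matched F G.
Proof.
move=> rF oF [V [nV VP]] [V' [nV' V'P]] W nW.
have [_ rFl] := dF_regular rF.
have Fl0 : dF_lambda F 0 = 0.
  by have := nbhs_singleton (odd_family_dF_axis rF oF); rewrite row_mx0.
pose p (x : 'rV[R]_(n1 + m)) := row_mx (dF_lambda F x) (rsubmx x).
have rp : regular_map_at k 0 p.
  by apply: regular_map_row_mx => //; exact: regular_rsubmx.
have p0 : p 0 = 0 by rewrite /p Fl0 rsubmx_const row_mx_const.
have nWV' := near_and nW nV'.
have E1 : set_germ_eq L (generated_set F V) by exact: VP.
have E2 : set_germ_eq L (generated_set G (fun y => W y /\ V' y)) by apply: V'P => // y [].
have nVx : \forall x \near (0 : 'rV[R]_(n1 + m)), V x by [].
apply: near_sub (near_and nVx (near_and (near_regular rp p0 E1) (near_regular rp p0 E2))).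
move=> x [Vx [E1x E2x]] Fx.
have pr : cot_proj (p x) = rsubmx x by rewrite /cot_proj /p row_mxKr.
have : generated_set G (fun y => W y /\ V' y) (p x).
  apply/E2x/E1x; exists (lsubmx x); rewrite /= pr hsubmxK.
  by split=> //; rewrite /p row_mxKl.
move=> [b] /=; rewrite pr => -[[Wb _] Gb Gl]; exists b; split=> //.
by rewrite -Gl /p row_mxKl.
Qed.

Lemma lagrangian_germ0 (L : set 'rV[R]_(m + m)) : lagrangian_germ k L -> L 0.
Proof.
move=> [phi [[phi0 _ _] LE _]]; apply/(nbhs_singleton LE).
by rewrite phi0 rsubmx_const.
Qed.

Lemma generating_family_critical n (F : 'rV[R]_(n + m) -> R) L :
  L 0 -> odd_family F -> generating_family k F L -> critical_family k F /\ generates F L.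
Proof.
move=> L0 oF [rF rk gF]; have rF' : regular_at k 0 F := rF; split=> //; split=> //.
  exact: generates_critical0 rF' gF L0.
by rewrite -(jacobian_gradient (dF_regular rF').1).
Qed.

Lemma base_change_inverse_germs n (Lambda Lambda' : 'rV[R]_m -> 'rV[R]_m) :
  inverse_germs k Lambda Lambda' ->
  inverse_germs k (fun y : 'rV[R]_(n + m) => row_mx (lsubmx y) (Lambda (rsubmx y)))
     (fun y => row_mx (lsubmx y) (Lambda' (rsubmx y))).
Proof.
move=> [[L0 L'0] rL rL' LK L'K]; split.
- by rewrite lsubmx_const rsubmx_const L0 L'0 row_mx0.
- apply: regular_map_row_mx; first exact: regular_lsubmx.
  by apply: regular_base; rewrite rsubmx_const.
- apply: regular_map_row_mx; first exact: regular_lsubmx.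
  by apply: regular_base; rewrite rsubmx_const.
- apply: near_sub (near_rsubmx n LK) => y.
  by rewrite row_mxKl row_mxKr => ->; rewrite hsubmxK.
- apply: near_sub (near_rsubmx n L'K) => y.
  by rewrite row_mxKl row_mxKr => ->; rewrite hsubmxK.
Qed.

(** A change of the base multiplies the Jacobian of [dF_beta F] by an
    invertible matrix. *)
Lemma base_change_family n (F : 'rV[R]_(n + m) -> R) (Lambda Lambda' : 'rV[R]_m -> 'rV[R]_m) :
  inverse_germs k Lambda Lambda' -> regular_at k 0 F -> odd_family F ->
  \rank (gradient_mx (dF_beta F) 0) = n ->
  let gamma (y : 'rV[R]_(n + m)) := row_mx (lsubmx y) (Lambda (rsubmx y)) in
  [/\ regular_at k 0 (F \o gamma), odd_family (F \o gamma) &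
      \rank (gradient_mx (dF_beta (F \o gamma)) 0) = n].
Proof.
move=> iL rF oF rk gamma; have [[L0 L'0] rL rL' LK L'K] := iL.
have g0 : gamma 0 = 0 by rewrite /gamma lsubmx_const rsubmx_const L0 row_mx0.
have rLr : regular_map_at k (0 : 'rV[R]_(n + m)) (fun y => Lambda (rsubmx y)).
  by apply: regular_base; rewrite rsubmx_const.
have rg : regular_map_at k 0 gamma.
  by apply: regular_map_row_mx => //; exact: regular_lsubmx.
have [rFb _] := dF_regular rF.
split.
- by apply: regular_at_comp => //; rewrite g0.
- apply: near_sub (near_regular rg g0 oF) => y /= <-; congr F.
  by rewrite /gamma zeta_row_mx /zeta row_mxKl row_mxKr.
- have -> : dF_beta (F \o gamma) = dF_beta F \o gamma.
    apply/funext => y; apply/rowP => i; rewrite !mxE; apply: derive_ext_along => t.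
    rewrite /= /gamma row_delta_lshift !linearP/= !row_mxKl !row_mxKr !scaler0 !add0r.
    by rewrite scale_row_mx scaler0 add_row_mx add0r.
  rewrite (gradient_mx_comp rg) ?g0//.
  have gg := nbhs_singleton (inverse_germs_gradient (base_change_inverse_germs n iL)).
  have [ug _] := mulmx1_unit gg.
  by rewrite eqmxMfull ?rk// row_full_unit.
Qed.

Lemma diffeo_germ_eq N M (f g : 'rV[R]_N -> 'rV[R]_M) :
  (\forall x \near (0 : 'rV[R]_N), f x = g x) -> diffeo_germ k f -> diffeo_germ k g.
Proof.
move=> fg /diffeo_germP[h [[f0 h0] rf rh hf fh]]; apply/diffeo_germP; exists h; split=> //.
- by rewrite -(nbhs_singleton fg).
- exact: regular_map_eq fg rf.
- by apply: near_sub (near_and fg hf) => x [<-].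
- by apply: near_sub (near_and (near_regular rh h0 fg) fh) => x [<-].
Qed.

(** The inverse of a slice is the slice of the inverse; oddness makes both
    fix the origin of the fibre. *)
Lemma slice_diffeo n1 n2 (Psi : 'rV[R]_(n1 + m) -> 'rV[R]_(n2 + m)) g :
  inverse_germs k Psi g ->
  (\forall x \near (0 : 'rV[R]_(n1 + m)), rsubmx (Psi x) = rsubmx x) ->
  (\forall x \near (0 : 'rV[R]_(n1 + m)), Psi (zeta x) = zeta (Psi x)) ->
  \forall l \near (0 : 'rV[R]_m), diffeo_germ k (fun b => lsubmx (Psi (row_mx b l))).
Proof.
move=> iP fib odd; have [[P0 g0] rP rg gP Pg] := iP.
have oddg := inverse_germs_zeta iP odd.
have fibg : \forall y \near (0 : 'rV[R]_(n2 + m)), rsubmx (g y) = rsubmx y.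
  by apply: near_sub (near_and (near_regular rg g0 fib) Pg) => y [<- ->].
have axis0 p q (f : 'rV[R]_(p + m) -> 'rV[R]_(q + m)) :
    (\forall x \near (0 : 'rV[R]_(p + m)), f (zeta x) = zeta (f x)) ->
    \forall l \near (0 : 'rV[R]_m), lsubmx (f (row_mx 0 l)) = 0.
  move=> of_; apply: near_sub (near_axis of_) => l; rewrite zeta_axis => E.
  by apply: self_opp; rewrite {1}E /zeta row_mxKl.
have rsl p q (f : 'rV[R]_(p + m) -> 'rV[R]_(q + m)) l : regular_map_at k (row_mx 0 l) f ->
    regular_map_at k 0 (fun b => lsubmx (f (row_mx b l))).
  move=> rf; apply: regular_map_lsubmx => j.
  exact: (regular_slice (f := fun x => f x 0 j) (rf j)).
have nsl p (P : 'rV[R]_(p + m) -> Prop) l :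
    (\forall x \near row_mx (0 : 'rV[R]_p) l, P x) ->
    \forall b \near (0 : 'rV[R]_p), P (row_mx b l).
  apply: (near_regular (k := k) (g := fun b => row_mx b l)) => //.
  by apply: regular_map_row_mx; [exact: regular_map_id|exact: regular_map_cst].
apply: near_sub (near_and (near_and (near_and (axis0 _ _ _ odd) (axis0 _ _ _ oddg))
  (near_and (near_axis (regular_map_near rP)) (near_axis (regular_map_near rg))))
  (near_and (near_and (near_axis (near_near fib)) (near_axis (near_near fibg)))
   (near_and (near_axis (near_near gP)) (near_axis (near_near Pg))))).
move=> l [[[P0l g0l] [rPl rgl]] [[/nsl fibl /nsl fibgl] [/nsl gPl /nsl Pgl]]].
apply/diffeo_germP; exists (fun b => lsubmx (g (row_mx b l))); split; [by []| | | |].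
- exact: rsl.
- exact: rsl.
- apply: near_sub (near_and fibl gPl) => b []; rewrite row_mxKr => E gPb.
  by rewrite -{2}E hsubmxK gPb row_mxKl.
- apply: near_sub (near_and fibgl Pgl) => b []; rewrite row_mxKr => E gPb.
  by rewrite -{2}E hsubmxK gPb row_mxKl.
Qed.

End Final.

Theorem theorem4p17 (R : realType) (k : category) (m n1 n2 : nat)
    (L1 L2 : set 'rV[R]_(m + m))
    (F1 : 'rV[R]_(n1 + m) -> R) (F2 : 'rV[R]_(n2 + m) -> R)
    (HL1 : fibred_Z2_symmetric_lagrangian k L1)
    (HL2 : fibred_Z2_symmetric_lagrangian k L2)
    (HF1 : odd_family F1) (HG1 : generating_family k F1 L1)
    (HF2 : odd_family F2) (HG2 : generating_family k F2 L2) :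
  Z2_lagrangian_equiv k L1 L2 <-> fibred_Rodd_equiv k F1 F2.
Proof.
have L10 := lagrangian_germ0 HL1.1; have L20 := lagrangian_germ0 HL2.1.
have [cF1 gF1] := generating_family_critical L10 HF1 HG1.
have [cF2 gF2] := generating_family_critical L20 HF2 HG2.
have [rF1 _ _ _] := cF1; have [rF2 _ _ rk2] := cF2.
split=> [[Phi [sP fP oP PL]]|[Phi [Lambda [dP _ oP FE]]]].
  have [Lambda [Lambda' [iL PE]]] := symplectic_is_lift sP fP oP.
  (* lagrangian equivalence to family equivalence: after the base change by
     Lambda both families generate L1 *)
  have L1E : set_germ_eq L1 (lift Lambda Lambda' @^-1` L2).
    by apply: near_sub (near_and PL PE) => x [E Ex]; rewrite /preimage/= -Ex.
  have [rG oG rkG] := base_change_family iL rF2 HF2 rk2.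
  have iG := @base_change_inverse_germs _ _ _ n2 _ _ iL.
  set gamma := (fun y : 'rV[R]_(n2 + m) => row_mx (lsubmx y) (Lambda (rsubmx y))) in rG oG rkG iG.
  have gG : generates (F2 \o gamma) L1.
    apply: generates_germ L1E _.
    apply: (generates_lift iG iL) gF2 => //; apply: near_all => y; by rewrite ?/gamma ?row_mxKr.
  have cG : critical_family k (F2 \o gamma).
    by split=> //; exact: generates_critical0 rG gG L10.
  have FG := generates_critical_points_matched rF1 HF1 gF1 gG.
  have GF := generates_critical_points_matched rG oG gG gF1.
  have [Psi [g [iP fib odd FE]]] := odd_families_equivalent cF1 cG FG GF.
  have [_ rP _ _ _] := iP.
  exists (fun b l => lsubmx (Psi (row_mx b l))), Lambda; split.
  - have [h ih] : exists h, inverse_germs k (gamma \o Psi) h.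
      by eexists; exact: inverse_germs_comp iP iG.
    apply: (@diffeo_germ_eq _ _ _ _ (gamma \o Psi)); last by apply/diffeo_germP; exists h.
    by apply: near_sub fib => x fibx; rewrite /gamma/= fibx hsubmxK.
  - exact: slice_diffeo iP fib odd.
  - apply: near_sub odd => x oddx.
    by rewrite -/(zeta x) hsubmxK oddx /zeta row_mxKl.
  - apply: near_sub (near_and FE fib) => x [-> fibx].
    by rewrite hsubmxK /= /gamma fibx.
(* family equivalence to lagrangian equivalence: the lift of the base map
   of Psi *)
move: dP; set Psi := (fun x => _) => /diffeo_germP[g iP].
have fib : \forall x \near (0 : 'rV[R]_(n1 + m)), rsubmx (Psi x) = Lambda (rsubmx x).
  by apply: near_all => x; rewrite /Psi row_mxKr.
have ax : \forall l \near (0 : 'rV[R]_m), lsubmx (Psi (row_mx 0 l)) = 0.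
  apply: near_sub (near_axis oP) => l; rewrite !row_mxKl !row_mxKr oppr0 => E.
  exact: self_opp.
have [Lambda' [iL fibg]] := inverse_germs_base iP fib ax.
have gL := generates_lift iP iL fib fibg rF1 rF2 FE gF2.
exists (lift Lambda Lambda'); split.
- exact: lift_symplectic.
- exact: lift_fibred.
- by apply: near_all => x; rewrite lift_odd.
- exact: generates_unique gF1 gL.
Qed.
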